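(* Let $F$ be a rigid field and let $\varphi$ be an anisotropic quadratic form over $F$ of dimension $16$ whose Witt class lies in $I^3F$. Then $\varphi$ is Witt equivalent to a sum of at most three forms in $GP_3F$.
   Context: All fields have characteristic different from $2$; quadratic form means finite-dimensional non-degenerate quadratic form. $IF$ is the fundamental ideal of the Witt ring $WF$ and $I^3F=(IF)^3$. For $a_1,\dots,a_n\in F^\ast$, the $n$-fold Pfister form is $\langle\langle a_1,\ldots,a_n\rangle\rangle:=\langle 1,-a_1\rangle\otimes\cdots\otimes\langle 1,-a_n\rangle$, and $GP_nF$ denotes the set of forms similar to some $n$-fold Pfister form. A field $F$ is rigid if every binary anisotropic quadratic form over $F$ represents at most $2$ square classes of $F^\ast/F^{\ast 2}$. *)

(* Defs.v *)
From HB Require Import structures.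
From mathcomp Require Import all_boot all_order all_algebra.
From mathcomp Require Import mxtens.

Set Implicit Arguments.
Unset Strict Implicit.
Unset Printing Implicit Defensive.

Import GRing.Theory.
Local Open Scope ring_scope.

(* The multiplicative group F^* as a subtype, so that diagonal forms with
   entries in F^* are non-degenerate by typing. *)
Definition unitsF (F : fieldType) := {a : F | a != 0}.

Definition one_unit (F : fieldType) : unitsF F := exist _ 1 (oner_neq0 F).

Lemma opp_unit_proof (F : fieldType) (a : unitsF F) : - val a != 0.
Proof. by rewrite oppr_eq0 (valP a). Qed.

Definition opp_unit (F : fieldType) (a : unitsF F) : unitsF F :=
  exist _ (- val a) (opp_unit_proof a).

Definition same_square_class (F : fieldType) (a b : unitsF F) : Prop :=
  exists x : F, val a = val b * x ^+ 2.

(* In characteristic different from 2, a non-degenerate quadratic form on F^n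
   is the same thing as an invertible symmetric n x n Gram matrix A, with
   associated quadratic map v |-> v A v^T on row vectors. *)
Record qform (F : fieldType) := QForm {
  qdim : nat;
  gram : 'M[F]_qdim;
  gram_sym : gram^T = gram;
  gram_unit : gram \in unitmx
}.

Definition qeval (F : fieldType) (q : qform F) (v : 'rV[F]_(qdim q)) : F :=
  (v *m gram q *m v^T) 0 0.

Definition anisotropic (F : fieldType) (q : qform F) : Prop :=
  forall v : 'rV[F]_(qdim q), v != 0 -> qeval v != 0.

Definition represents (F : fieldType) (q : qform F) (a : unitsF F) : Prop :=
  exists v : 'rV[F]_(qdim q), qeval v = val a.

(* The linear map v |-> v P is bijective exactly when P is both row-free and
   row-full; this avoids casting along an equality of dimensions. *)
Definition isometric (F : fieldType) (q1 q2 : qform F) : Prop :=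
  exists P : 'M[F]_(qdim q1, qdim q2),
    [/\ row_free P, row_full P & P *m gram q2 *m P^T = gram q1].

Section Constructions.

Variable F : fieldType.
Implicit Types (q : qform F) (c a : unitsF F).

Lemma diag_sym n (s : n.-tuple (unitsF F)) :
  (diag_mx (\row_i val (tnth s i)))^T = diag_mx (\row_i val (tnth s i)).
Proof. exact: tr_diag_mx. Qed.

Lemma diag_unit n (s : n.-tuple (unitsF F)) :
  diag_mx (\row_i val (tnth s i)) \in unitmx.
Proof.
rewrite unitmxE det_diag unitfE; apply/prodf_neq0 => i _.
by rewrite mxE (valP (tnth s i)).
Qed.

Definition qdiag n (s : n.-tuple (unitsF F)) : qform F :=
  QForm (diag_sym s) (diag_unit s).

Definition qzero : qform F := qdiag [tuple].

Lemma qsum_sym q1 q2 :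
  (block_mx (gram q1) 0 0 (gram q2))^T = block_mx (gram q1) 0 0 (gram q2).
Proof. by rewrite tr_block_mx !trmx0 !gram_sym. Qed.

Lemma qsum_unit q1 q2 : block_mx (gram q1) 0 0 (gram q2) \in unitmx.
Proof. by rewrite unitmxE det_ublock unitrM -!unitmxE !gram_unit. Qed.

Definition qsum q1 q2 : qform F := QForm (qsum_sym q1 q2) (qsum_unit q1 q2).

Lemma qtens_sym q1 q2 : (gram q1 *t gram q2)^T = gram q1 *t gram q2.
Proof. by rewrite trmx_tens !gram_sym. Qed.

Lemma tens1mx1 m n : (1%:M : 'M[F]_m) *t (1%:M : 'M[F]_n) = 1%:M.
Proof.
apply/matrixP => i j.
case: (mxtens_indexP i) => i0 i1; case: (mxtens_indexP j) => j0 j1.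
rewrite tensmxE !mxE (inj_eq (can_inj (@mxtens_indexK m n))) xpair_eqE.
by rewrite -natrM mulnb.
Qed.

Lemma qtens_unit q1 q2 : gram q1 *t gram q2 \in unitmx.
Proof.
have: (gram q1 *t gram q2) *m (invmx (gram q1) *t invmx (gram q2)) = 1%:M.
  by rewrite tensmx_mul !mulmxV ?gram_unit // tens1mx1.
by case/mulmx1_unit.
Qed.

Definition qtens q1 q2 : qform F := QForm (qtens_sym q1 q2) (qtens_unit q1 q2).

Lemma qscale_sym c q : (val c *: gram q)^T = val c *: gram q.
Proof. by rewrite linearZ /= gram_sym. Qed.

Lemma qscale_unit c q : val c *: gram q \in unitmx.
Proof. by rewrite unitmxZ ?gram_unit // unitfE (valP c). Qed.

Definition qscale c q : qform F := QForm (qscale_sym c q) (qscale_unit c q).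

Definition hyperbolic_plane : qform F :=
  qdiag [tuple one_unit F; opp_unit (one_unit F)].

Definition qsum_family k (f : 'I_k -> qform F) : qform F :=
  \big[qsum/qzero]_(i < k) f i.

Definition hyperbolic m : qform F :=
  qsum_family (fun _ : 'I_m => hyperbolic_plane).

(* Equality of Witt classes. *)
Definition witt_equiv q1 q2 : Prop :=
  exists m n : nat,
    isometric (qsum q1 (hyperbolic m)) (qsum q2 (hyperbolic n)).

(* Subsets of the Witt ring WF are represented by predicates on forms that are
   invariant under Witt equivalence: J q reads "the Witt class of q is in J". *)

(* IF: the classes of even-dimensional forms. *)
Definition fundamental_ideal q : Prop := ~~ odd (qdim q).

(* The product ideal: all finite sums of products x y with x in I, y in J,
   where sum and product in WF are induced by qsum and qtens. *)
Definition ideal_mul (I J : qform F -> Prop) q : Prop :=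
  exists (k : nat) (x y : 'I_k -> qform F),
    [/\ forall i, I (x i), forall i, J (y i) &
        witt_equiv q (qsum_family (fun i => qtens (x i) (y i)))].

Definition fundamental_ideal3 : qform F -> Prop :=
  ideal_mul (ideal_mul fundamental_ideal fundamental_ideal) fundamental_ideal.

(* <<a_1, ..., a_n>> = <1,-a_1> (x) ... (x) <1,-a_n>, the empty product being
   the unit form <1>. *)
Definition pfister n (s : n.-tuple (unitsF F)) : qform F :=
  \big[qtens/qdiag [tuple one_unit F]]_(i < n)
    qdiag [tuple one_unit F; opp_unit (tnth s i)].

Definition GP n q : Prop :=
  exists (c : unitsF F) (s : n.-tuple (unitsF F)),
    isometric q (qscale c (pfister s)).

End Constructions.

Definition rigid_field (F : fieldType) : Prop :=
  forall q : qform F, qdim q = 2%N -> anisotropic q ->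
  exists a b : unitsF F, forall c : unitsF F, represents q c ->
    same_square_class c a \/ same_square_class c b.

(* Main.v *)
Require Import Defs.
From mathcomp Require Import all_boot all_order all_algebra.
From mathcomp Require Import all_fingroup mxtens ring zify.
From mathcomp Require Import boolp classical_sets.

(** Let [V] be the group of square classes of a rigid field [F]. An anisotropic
    form [<a, b>] represents only the classes of [a] and [b] and, when [a = b]
    in [V] and [-1] is a sum of two squares, the class of [-a]. Hence the Witt
    ring is the group ring of [V] modulo [<-1> = -1], divided moreover by 4 when
    [-1] is a sum of two squares, and the theorem becomes a statement on lists
    of 16 elements of [V].

    Classes in the cube of the fundamental ideal are recognized by characters of
    [V]: if [al] and [be] vanish at [-1], the number of entries at which both
    are nonzero is even, and if [al] does not vanish at [-1], the signature of
    the list with respect to [al] is divisible by 8 ([I3_test]). The role of the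
    extension [F(sqrt v)] is played by the group of the characters that vanish
    at [v] ([kill]): it is the character group of [V / v], and the conditions
    pass to it. Write a list as [<<-w>> rho + tau] with [rho] as long as
    possible; then [tau] remains anisotropic after division by [-w], and it is
    shorter. An induction on the size, for all groups of characters at once,
    shows that nonempty anisotropic lists have size at least 8 and not 10, that
    those of size 8 are 3-fold Pfister forms up to a scalar ([aniso_size8]),
    that those of size 12 are multiples of a binary form, that those of size 14
    contain three pairs of a common ratio, and that for a list of size 16 the
    ratio [w] can be chosen so that [rho] has size 8, or [rho] has size 4 and
    [tau] is a Pfister form modulo [-w] ([aniso_size16]).

    If [rho] has size 8, it has trivial discriminant modulo [w], so it is a sum
    of three scaled 2-fold Pfister forms. If [rho] has size 4, then
    [tau = pi - <<-w>> eta], where [pi] is a scaled 3-fold Pfister form and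
    [eta] has size 0 or 2 ([twisted_flat]); the list is [pi + <<-w>> (rho - eta)],
    and [rho - eta] is a scaled 2-fold Pfister form or an Albert form, which is a
    sum of two of them ([sum3_I3]).

    If [-1] is a sum of two squares, the signatures are defined modulo 4 only,
    their differences modulo 8, and they may all be 4 modulo 8. If two entries
    agree, replacing [<a, a>] by the isometric [<-a, -a>] makes them 0. If the
    entries are distinct up to sign, the structure of lists of size 16 is applied
    to [V / -1], and the signs are studied afterwards ([sum3_level2]). The
    configuration that is not covered by the previous arguments is
    [a <<-u, x>> + c <<u, xz>> + e <<-x, -z>> + d <<-xu, z>>]; the four 2-fold
    forms have the sum [4 = 0], so that subtracting [d] times this sum leaves
    three scaled 3-fold forms ([cross_identity]).

    Forms are linked to lists by diagonalization ([qform_diag]) and by the fact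
    that suitable sums over the entries are invariants of isometry
    ([weight_isometric]), which is Witt cancellation together with the
    description of the binary forms ([rigid_rep]); Zorn's lemma provides
    the characters ([uchar_exists]). *)

Set Implicit Arguments.
Unset Strict Implicit.
Unset Printing Implicit Defensive.

(** * Characters of square classes and lists of diagonal entries *)

Ltac perm_by :=
  let p := fresh "p" in apply/seq.permP => p;
  repeat match goal with H : is_true (perm_eq _ _) |- _ =>
    generalize (seq.permP H p); clear H end;
  rewrite /unzip1 /unzip2 /=; repeat (rewrite count_cat /=);
  repeat match goal with |- context [nat_of_bool ?b] =>
    generalize (nat_of_bool b) end;
  intros; lia.

Section Characters.

Variables (V : eqType) (mul : V -> V -> V) (m : V).
Local Infix "**" := mul (at level 40, left associativity).

Implicit Types (Y : (V -> bool) -> Prop) (a b c v w : V) (s t : seq V).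
Implicit Types (ps : seq (V * V)).

(** A group of characters stands for a quotient of [V], namely that by the
    common kernel; working with the characters avoids forming quotients. The
    operation [mul] satisfies no axiom: only its image under characters matters. *)
Record char_group Y : Prop := CharGroup {
  charM : forall al, Y al -> forall a b, al (a ** b) = al a (+) al b;
  charD : forall al be, Y al -> Y be -> Y (fun a => al a (+) be a) }.

Definition eqv Y a b := forall al, Y al -> al a = al b.

(** The characters of the quotient by [v]. *)
Definition kill Y v : (V -> bool) -> Prop := fun al => Y al /\ al v = false.

Lemma kill_group Y v : char_group Y -> char_group (kill Y v).
Proof.
case=> YM YD; split=> [al [Yal _]|al be [Yal al0] [Ybe be0]]; first exact: YM.
by split; [exact: YD|rewrite al0 be0].
Qed.

Lemma not_eqv Y a b : ~ eqv Y a b -> exists2 al, Y al & al a = ~~ al b.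
Proof.
move=> nab; apply: contrapT => h; apply: nab => al Yal.
by apply: contrapT => ne; apply: h; exists al => //; case: (al a) (al b) ne => [] [].
Qed.

(** Two elements that agree modulo [v] differ by 1 or [v]. If [al] separates
    [a] from [b] and [be] separates [a] from [v b], both must be nonzero at [v];
    their sum then vanishes at [v] and separates [a] from [b]. *)
Lemma eqv_kill Y v a b :
  char_group Y -> eqv (kill Y v) a b -> eqv Y a b \/ eqv Y a (v ** b).
Proof.
move=> YG ab; case: (EM (eqv Y a b)) => [|/not_eqv[al Yal ala]]; first by left.
case: (EM (eqv Y a (v ** b))) => [|/not_eqv[be Ybe]]; first by right.
rewrite (charM YG) // => bea.
case alv: (al v); last by have := ab al (conj Yal alv); rewrite ala; case: (al b).
case bev: (be v) bea => bea; last first.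
  by have := ab be (conj Ybe bev); rewrite bea; case: (be b).
have := ab _ (conj (charD YG Yal Ybe) _); rewrite /= alv bev => /(_ erefl).
by rewrite ala bea; case: (al b); case: (be b).
Qed.

(** With [m = -1], this is anisotropy over a rigid field in which [-1] is not a
    sum of two squares, or is a square. *)
Definition aniso Y s :=
  forall a b t, perm_eq s [:: a, b & t] -> ~ eqv Y b (m ** a).

Lemma aniso_perm Y s t : perm_eq s t -> aniso Y s -> aniso Y t.
Proof. by move=> st sA a b r tr; apply: (sA a b r); exact: perm_trans st tr. Qed.

Lemma aniso_cat Y s t : aniso Y (s ++ t) -> aniso Y t.
Proof.
move=> sA a b r tr; apply: (sA a b (s ++ r)).
perm_by.
Qed.

(** [I3_test_sgn] says that the signature [size s - 2 * count al s] is
    divisible by 8. The other two conditions express the vanishing of the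
    dimension index, the discriminant (take [be = al]) and the Clifford invariant
    when [-1] is a square. *)
Record I3_test Y s : Prop := I3Test {
  I3_test_size : ~~ odd (size s);
  I3_test_mul : forall al be, Y al -> Y be -> al m = false -> be m = false ->
    ~~ odd (count (fun a => al a && be a) s);
  I3_test_sgn : forall al, Y al -> al m = true ->
    (size s + 6 * count al s) %% 8 = 0 }.

Lemma I3_test_perm Y s t : perm_eq s t -> I3_test Y s -> I3_test Y t.
Proof.
move=> st [h1 h2 h3]; have cE := seq.permP st.
by split=> *; rewrite -?cE -?(perm_size st); auto.
Qed.

Lemma I3_test_cat Y s t : I3_test Y s -> I3_test Y t -> I3_test Y (s ++ t).
Proof.
move=> [h1 h2 h3] [k1 k2 k3]; split=> [|al be ? ? ? ?|al Yal alm].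
- by rewrite size_cat oddD (negbTE h1).
- by rewrite count_cat oddD (negbTE (h2 _ _ _ _ _ _)) // k2.
- by move: (h3 al Yal alm) (k3 al Yal alm); rewrite size_cat count_cat; lia.
Qed.

Lemma I3_test_kill Y v s : I3_test Y s -> I3_test (kill Y v) s.
Proof.
case=> h1 h2 h3; split=> // [al be [? _] [? _]|al [? _]]; [exact: h2|exact: h3].
Qed.

(** Hyperbolic planes satisfy all conditions, so they may be added freely. *)
Lemma I3_test_hyp Y a : char_group Y -> I3_test Y [:: a; m ** a].
Proof.
move=> YG; split=> // [al be Yal Ybe alm bem|al Yal alm] /=;
  rewrite ?(charM YG) // ?alm ?bem; by case: (al a) => //; case: (be a).
Qed.

(** A pair [(p, q)] with [q = w p] is the binary form [<p, w p>], a scalar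
    multiple of [<<-w>>]. *)
Definition flatten_pairs ps := unzip1 ps ++ unzip2 ps.

Definition pairs_ratio Y w ps := forall p, p \in ps -> eqv Y p.2 (w ** p.1).

Lemma size_flatten_pairs ps : size (flatten_pairs ps) = (size ps).*2.
Proof. by rewrite size_cat !size_map addnn. Qed.

Lemma count_pairs P ps :
  count P (flatten_pairs ps) = count P (unzip1 ps) + count P (unzip2 ps).
Proof. exact: count_cat. Qed.

Lemma pairs_ratio_cons Y w p ps :
  pairs_ratio Y w (p :: ps) <-> eqv Y p.2 (w ** p.1) /\ pairs_ratio Y w ps.
Proof.
split=> [h|[h1 h2] q]; last by rewrite inE => /predU1P[->|/h2].
by split=> [|q qps]; apply: h; rewrite inE ?eqxx ?qps ?orbT.
Qed.

Lemma pairs_count Y w al ps : char_group Y -> pairs_ratio Y w ps -> Y al ->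
  count al (unzip2 ps) =
    if al w then size ps - count al (unzip1 ps) else count al (unzip1 ps).
Proof.
move=> YG + Yal; elim: ps => [|p ps IH]; first by case: ifP.
move=> /pairs_ratio_cons[pw /IH] /= ->; rewrite (pw _ Yal) (charM YG) //.
have := count_size al (unzip1 ps); rewrite size_map.
by case: (al w); case: (al p.1) => /=; lia.
Qed.

Lemma pairs_count2 Y w al be ps : char_group Y -> pairs_ratio Y w ps ->
    Y al -> Y be ->
  odd (count (fun a => al a && be a) (flatten_pairs ps)) =
   [&& al w, be w & odd (size ps)] (+) (al w && odd (count be (unzip1 ps)))
   (+) (be w && odd (count al (unzip1 ps))).
Proof.
move=> YG + Yal Ybe; rewrite count_pairs.
elim: ps => [|p ps IH]; first by rewrite /= !andbF.
move=> /pairs_ratio_cons[pw /IH] /=; rewrite (pw _ Yal) (pw _ Ybe) !(charM YG) //.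
rewrite !oddD !oddb.
case: (odd (count _ _)); case: (odd (count _ (unzip2 _)));
case: (al w); case: (be w); case: (odd (size _)); case: (odd (count be _));
case: (odd (count al _)); case: (al p.1); case: (be p.1); by [].
Qed.

(** The form [<<-w>>] becomes hyperbolic modulo [-w]. *)
Lemma I3_test_pairs Y w ps : char_group Y -> pairs_ratio Y w ps ->
  I3_test (kill Y (m ** w)) (flatten_pairs ps).
Proof.
move=> YG psw; split=> [|al be [Yal alw] [Ybe bew] alm bem|al [Yal alw] alm].
- by rewrite size_flatten_pairs odd_double.
- move: alw bew; rewrite !(charM YG) // alm bem /= => alw bew.
  by rewrite (pairs_count2 YG psw) // alw bew.
- move: alw; rewrite (charM YG) // alm /= => /negbFE alw.
  rewrite size_flatten_pairs count_pairs (pairs_count YG psw) // alw.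
  by have := count_size al (unzip1 ps); rewrite size_map; lia.
Qed.

(** Pairs of ratio [w] are split off as long as possible. *)
Lemma pairing Y w ps t : char_group Y -> pairs_ratio Y w ps ->
  exists ps' t', [/\ perm_eq (flatten_pairs ps ++ t) (flatten_pairs ps' ++ t'),
    pairs_ratio Y w ps', size ps <= size ps' &
    forall a b r, perm_eq t' [:: a, b & r] -> ~ eqv Y b (w ** a)].
Proof.
move=> YG; have [n] := ubnP (size t); elim: n ps t => // n IH ps t tn psw.
case: (EM (exists a b r, perm_eq t [:: a, b & r] /\ eqv Y b (w ** a))); last first.
  move=> h; exists ps, t; split=> // a b r ar ab; apply: h.
  by exists a, b, r.
move=> [a [b [r [tr ab]]]].
have [||ps' [t' [p1 p2 p3 p4]]] := IH ((a, b) :: ps) r.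
- by move: tn; rewrite (perm_size tr) /=; lia.
- by apply/pairs_ratio_cons.
exists ps', t'; split=> //; last exact: ltnW.
apply: perm_trans p1; rewrite /flatten_pairs; perm_by.
Qed.

(** If [-w] were trivial, a pair of ratio [w] would be a hyperbolic plane. *)
Lemma pairs_nontriv Y w s ps t : aniso Y s -> perm_eq s (flatten_pairs ps ++ t) ->
  pairs_ratio Y w ps -> 0 < size ps -> char_group Y ->
  exists2 be, Y be & be (m ** w) = true.
Proof.
case: ps => // -[a b] ps sA sp /pairs_ratio_cons[/= ab _] _ YG.
have /not_eqv[be Ybe bb]: ~ eqv Y b (m ** a).
  apply: (sA a b (unzip1 ps ++ unzip2 ps ++ t)); apply: perm_trans sp _.
  by rewrite /flatten_pairs; perm_by.
exists be => //; move: bb; rewrite (ab _ Ybe) !(charM YG) //.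
by case: (be w); case: (be m); case: (be a).
Qed.

(** Modulo [-w], a hyperbolic pair of [t] comes either from a hyperbolic pair or
    from a pair of ratio [w]; the analogue for forms is the description of the
    anisotropic part over [F(sqrt (-w))]. *)
Lemma aniso_kill Y w s t : char_group Y -> aniso Y (s ++ t) ->
  (forall a b r, perm_eq t [:: a, b & r] -> ~ eqv Y b (w ** a)) ->
  aniso (kill Y (m ** w)) t.
Proof.
move=> YG sA tw a b r tr /(eqv_kill YG)[|h]; first exact: (aniso_cat sA tr).
apply: (tw a b r tr) => al Yal; rewrite (h _ Yal) !(charM YG) //.
by case: (al m); case: (al w); case: (al a).
Qed.

(** If [<<-w>> rho] lies in the cube of the fundamental ideal, then [rho] lies in
    its square modulo the annihilator [<<w>>] of [<<-w>>]: its dimension is even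
    and its signed discriminant is 1 modulo [w]. A character [al] that does not
    vanish at [-1] sees [<<-w>> rho] with signature twice that of [rho]; one that
    vanishes at [-1] is combined with a character that does not vanish at
    [-w]. *)
Lemma pairs_test Y w ps t be : char_group Y -> pairs_ratio Y w ps ->
    I3_test Y (flatten_pairs ps ++ t) -> I3_test Y t -> Y be -> be (m ** w) = true ->
  ~~ odd (size ps) /\ forall al, Y al -> al w = false ->
    odd (count al (unzip1 ps)) = odd (size ps)./2 && al m.
Proof.
move=> YG psw [h1 h2 h3] [k1 k2 k3] Ybe; rewrite (charM YG) // => bmw.
have sgn al : Y al -> al m = true -> al w = false ->
    ~~ odd (size ps) /\ odd (count al (unzip1 ps)) = odd (size ps)./2.
  move=> Yal alm alw; move: (h3 _ Yal alm) (k3 _ Yal alm).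
  rewrite size_cat count_cat size_flatten_pairs count_pairs.
  rewrite (pairs_count YG psw) // alw; lia.
case bm: (be m) bmw => /= bw.
  have {}bw: be w = false by case: (be w) bw.
  have [ev cb] := sgn _ Ybe bm bw; split=> // al Yal alw.
  case alm: (al m); first by rewrite andbT; case: (sgn _ Yal alm alw).
  have := sgn _ (charD YG Yal Ybe); rewrite /= alm bm alw bw => /(_ erefl erefl)[_].
  rewrite andbF -cb => {cb}; have: odd (count (fun a => al a (+) be a) (unzip1 ps)) =
    odd (count al (unzip1 ps)) (+) odd (count be (unzip1 ps)).
    elim: (unzip1 ps) => //= a l IH; rewrite !oddD IH !oddb.
    by case: (al a); case: (be a); case: (odd _); case: (odd _).
  by move=> -> ; case: (odd _); case: (odd _).
have bmul al : Y al -> al m = false ->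
  odd (count (fun a => al a && be a) (flatten_pairs ps)) = false.
  move=> Yal alm; move: (h2 _ _ Yal Ybe alm bm) (k2 _ _ Yal Ybe alm bm).
  by rewrite count_cat oddD; case: (odd _) => //; case: (odd _).
split.
  have := bmul _ Ybe bm; rewrite (pairs_count2 YG psw) // bw /=.
  by case: (odd _); case: (odd _).
move=> al Yal alw; case alm: (al m); first by rewrite andbT; case: (sgn _ Yal alm alw).
by have := bmul _ Yal alm; rewrite (pairs_count2 YG psw) // alw bw andbF /= => ->.
Qed.

End Characters.

(** * Flats: the lists of 3-fold Pfister forms *)

Ltac char_tac YG :=
  let al := fresh "al" in let Yal := fresh "Yal" in
  move=> al Yal;
  rewrite ?(charM YG Yal);
  repeat match goal with H : eqv _ ?a _ |- context [al ?a] =>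
    rewrite !(H al Yal) ?(charM YG Yal); clear H end;
  repeat match goal with |- context [al ?x] => generalize (al x) end;
  clear; do ?case; by [].

Section Flats.

Variables (V : eqType) (mul : V -> V -> V) (m : V).
Local Infix "**" := mul (at level 40, left associativity).

Implicit Types (Y : (V -> bool) -> Prop) (a b c v w : V) (s t : seq V).
Implicit Types (ps : seq (V * V)).

Local Notation char_group := (char_group mul).
Local Notation aniso := (aniso mul m).
Local Notation I3_test := (I3_test m).

Fixpoint same Y s t : Prop :=
  match s, t with
  | [::], [::] => True
  | a :: s', b :: t' => eqv Y a b /\ same Y s' t'
  | _, _ => False
  end.

Lemma same_refl Y s : same Y s s.
Proof. by elim: s => //= a s IH; split. Qed.

Lemma same_sym Y s t : same Y s t -> same Y t s.
Proof.
by elim: s t => [|a s IH] [|b t] //= [ab /IH]; split=> // al Yal; rewrite ab.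
Qed.

Lemma same_size Y s t : same Y s t -> size s = size t.
Proof. by elim: s t => [|a s IH] [|b t] //= [_ /IH ->]. Qed.

Lemma same_count Y s t al : same Y s t -> Y al -> count al s = count al t.
Proof.
by move=> st Yal; elim: s t st => [|a s IH] [|b t] //= [/(_ al Yal) -> /IH ->].
Qed.

Lemma same_count2 Y s t al be : same Y s t -> Y al -> Y be ->
  count (fun a => al a && be a) s = count (fun a => al a && be a) t.
Proof.
move=> st Yal Ybe.
by elim: s t st => [|a s IH] [|b t] //= [ab /IH ->]; rewrite !ab.
Qed.

Lemma I3_test_same Y s t : same Y s t -> I3_test Y s -> I3_test Y t.
Proof.
move=> st [h1 h2 h3]; split=> [|al be Yal Ybe alm bem|al Yal alm].
- by rewrite -(same_size st).
- by rewrite -(same_count2 st) //; auto.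
- by rewrite -(same_count st) // -(same_size st); auto.
Qed.

(** The entries of [c <<-x, -y, -z>>]; in [V] they form an affine subspace of
    dimension 3, possibly degenerate. The entries are ordered so that those in
    positions [2i] and [2i+1] have the ratio [z]. *)
Definition flat3 c x y z :=
  [:: c; c ** z; c ** x; c ** x ** z; c ** y; c ** y ** z; c ** x ** y;
      c ** x ** y ** z].

Lemma I3_test_flat Y c x y z : char_group Y -> I3_test Y (flat3 c x y z).
Proof.
move=> YG; split=> // [al be Yal Ybe alm bem|al Yal alm] /=;
  rewrite !(charM YG) //; case: (al c); case: (al x); case: (al y);
  case: (al z) => //; case: (be c); case: (be x); case: (be y);
  case: (be z) => //.
Qed.

(** The equality is modulo the quotient defined by [Y] and up to the order. *)
Definition is_flat Y s :=
  exists c x y z t, perm_eq s t /\ same Y t (flat3 c x y z).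

(** A lift of a flat along the quotient by [v] multiplies its entries by [v]
    according to a Boolean function of three variables. Affine functions are
    absorbed in [c, x, y, z], and every Boolean function of three variables
    is at distance at most 2 from an affine one; the three cases are the
    distances 0, 1 and 2. The choice of the affine coordinates moves the
    exceptional points to the first positions. *)
Lemma twisted_flat Y v s : char_group Y -> is_flat (kill Y v) s ->
  exists c x y z t, perm_eq s t /\
    [\/ same Y t (flat3 c x y z),
        same Y t (v ** c :: behead (flat3 c x y z)) |
        same Y t (v ** c :: v ** (c ** z) :: drop 2 (flat3 c x y z))].
Proof.
move=> YG [c [x [y [z [t [st]]]]]].
case: t st => [|t0 [|t1 [|t2 [|t3 [|t4 [|t5 [|t6 [|t7 []]]]]]]]] //=; try tauto.
pose tw (r : bool) a := if r then v ** a else a.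
have twE (r : bool) a al : Y al -> al (tw r a) = (r && al v) (+) al a.
  by move=> Yal; rewrite /tw; case: r; rewrite ?(charM YG).
have eqv_tw a b : eqv (kill Y v) a b -> exists r, eqv Y a (tw r b).
  by move=> /(eqv_kill YG)[]; [exists false|exists true].
move=> st [/eqv_tw[r0 h0]] [/eqv_tw[r1 h1]] [/eqv_tw[r2 h2]] [/eqv_tw[r3 h3]].
move=> [/eqv_tw[r4 h4]] [/eqv_tw[r5 h5]] [/eqv_tw[r6 h6]] [/eqv_tw[r7 h7]] _.
(* [c', x', y', z'] absorb the affine part of the twist, so that the entries
   0, 1, 2 and 4 become untwisted; 16 patterns on the other four remain. *)
pose c' := tw r0 c; pose z' := tw (r0 (+) r1) z.
pose x' := tw (r0 (+) r2) x; pose y' := tw (r0 (+) r4) y.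
have {}h0 : eqv Y t0 c' by [].
have norm a b d (r : bool) : eqv Y a (tw r b) -> eqv Y (tw r b) d -> eqv Y a d.
  by move=> h k al Yal; rewrite h // k.
have {}h1 : eqv Y t1 (c' ** z').
  apply: norm h1 _ => al Yal; rewrite !(twE, charM YG) //.
  by case: (r0) (r1) (al v) (al c) (al z) => [] [] [] [] [].
have {}h2 : eqv Y t2 (c' ** x').
  apply: norm h2 _ => al Yal; rewrite !(twE, charM YG) //.
  by case: (r0) (r2) (al v) (al c) (al x) => [] [] [] [] [].
have {}h4 : eqv Y t4 (c' ** y').
  apply: norm h4 _ => al Yal; rewrite !(twE, charM YG) //.
  by case: (r0) (r4) (al v) (al c) (al y) => [] [] [] [] [].
have {}h3 : eqv Y t3 (tw (r0 (+) r1 (+) r2 (+) r3) (c' ** x' ** z')).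
  apply: norm h3 _ => al Yal; rewrite !(twE, charM YG) //.
  rewrite -!addbA; move: (al c) (al x) (al z) => A B C.
  by case: (r0) (r1) (r2) (r3) (al v) => [] [] [] [] []; case: A; case: B; case: C.
have {}h5 : eqv Y t5 (tw (r0 (+) r1 (+) r4 (+) r5) (c' ** y' ** z')).
  apply: norm h5 _ => al Yal; rewrite !(twE, charM YG) //.
  rewrite -!addbA; move: (al c) (al y) (al z) => A B C.
  by case: (r0) (r1) (r4) (r5) (al v) => [] [] [] [] []; case: A; case: B; case: C.
have {}h6 : eqv Y t6 (tw (r0 (+) r2 (+) r4 (+) r6) (c' ** x' ** y')).
  apply: norm h6 _ => al Yal; rewrite !(twE, charM YG) //.
  rewrite -!addbA; move: (al c) (al x) (al y) => A B C.
  by case: (r0) (r2) (r4) (r6) (al v) => [] [] [] [] []; case: A; case: B; case: C.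
have {}h7 : eqv Y t7 (tw (r1 (+) r2 (+) r4 (+) r7) (c' ** x' ** y' ** z')).
  apply: norm h7 _ => al Yal; rewrite !(twE, charM YG) //.
  rewrite -!addbA; move: (al c) (al x) (al y) (al z) => A B C D.
  by case: (r0) (r1) (r2) (r4) (r7) (al v) => [] [] [] [] [] [];
     case: A; case: B; case: C; case: D.
move: (_ (+) r3) (_ (+) r5) (_ (+) r6) (_ (+) r7) h3 h5 h6 h7.
move: c' x' y' z' h0 h1 h2 h4 => {c x y z twE eqv_tw norm} c x y z.
rewrite /tw => h0 h1 h2 h4 [] [] [] [] h3 h5 h6 h7 {tw}.
- by exists (c ** x ** y), (x), (y), (x ** y ** z ** v),
    [:: t6; t1; t4; t3; t2; t5; t0; t7]; split; [perm_by|apply: Or33; do ?split; by char_tac YG].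
- by exists (c ** v), (x ** v), (y ** v), (z ** v),
    [:: t0; t1; t2; t3; t4; t5; t6; t7]; split; [perm_by|apply: Or32; do ?split; by char_tac YG].
- by exists (c ** z ** v), (z ** v), (x), (y),
    [:: t1; t5; t0; t4; t3; t7; t2; t6]; split; [perm_by|apply: Or32; do ?split; by char_tac YG].
- by exists (c ** x ** z), (z), (y), (x ** y),
    [:: t3; t5; t2; t4; t7; t1; t6; t0]; split; [perm_by|apply: Or33; do ?split; by char_tac YG].
- by exists (c ** x ** v), (z), (x ** v), (y),
    [:: t2; t6; t3; t7; t0; t4; t1; t5]; split; [perm_by|apply: Or32; do ?split; by char_tac YG].
- by exists (c ** x ** y), (y), (x), (y ** z),
    [:: t6; t3; t2; t7; t4; t1; t0; t5]; split; [perm_by|apply: Or33; do ?split; by char_tac YG].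
- by exists (c ** x ** z), (z), (x), (y),
    [:: t3; t7; t2; t6; t1; t5; t0; t4]; split; [perm_by|apply: Or33; do ?split; by char_tac YG].
- by exists (c ** x ** z), (z), (y), (x),
    [:: t3; t1; t2; t0; t7; t5; t6; t4]; split; [perm_by|apply: Or32; do ?split; by char_tac YG].
- by exists (c ** y ** v), (z), (x), (y ** v),
    [:: t4; t0; t5; t1; t6; t2; t7; t3]; split; [perm_by|apply: Or32; do ?split; by char_tac YG].
- by exists (c ** x ** y), (y), (x), (x ** z),
    [:: t6; t5; t2; t1; t4; t7; t0; t3]; split; [perm_by|apply: Or33; do ?split; by char_tac YG].
- by exists (c ** y ** z), (y), (z), (x),
    [:: t5; t7; t1; t3; t4; t6; t0; t2]; split; [perm_by|apply: Or33; do ?split; by char_tac YG].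
- by exists (c ** y ** z), (x), (z), (y),
    [:: t5; t1; t7; t3; t4; t0; t6; t2]; split; [perm_by|apply: Or32; do ?split; by char_tac YG].
- by exists (c ** x ** y), (y), (x), (z),
    [:: t6; t7; t2; t3; t4; t5; t0; t1]; split; [perm_by|apply: Or33; do ?split; by char_tac YG].
- by exists (c ** x ** y), (y), (x), (z),
    [:: t6; t7; t2; t3; t4; t5; t0; t1]; split; [perm_by|apply: Or32; do ?split; by char_tac YG].
- by exists (c ** x ** y ** z), (z), (x), (y),
    [:: t7; t3; t6; t2; t5; t1; t4; t0]; split; [perm_by|apply: Or32; do ?split; by char_tac YG].
- by exists (c), (x), (y), (z),
    [:: t0; t1; t2; t3; t4; t5; t6; t7]; split; [perm_by|apply: Or31; do ?split; by char_tac YG].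
Qed.

End Flats.

(** * Anisotropic lists in the cube of the fundamental ideal, size by size *)

Section Sizes.

Variables (V : eqType) (mul : V -> V -> V) (m : V).
Local Infix "**" := mul (at level 40, left associativity).

Implicit Types (Y : (V -> bool) -> Prop) (a b c v w : V) (s t : seq V).
Implicit Types (ps : seq (V * V)).

Local Notation char_group := (char_group mul).
Local Notation aniso := (aniso mul m).
Local Notation I3_test := (I3_test m).
Local Notation flat3 := (flat3 mul).
Local Notation is_flat := (is_flat mul).
Local Notation pairs_ratio := (pairs_ratio mul).

Lemma I3_test_cancel Y s t : I3_test Y (s ++ t) -> I3_test Y s -> I3_test Y t.
Proof.
move=> [h1 h2 h3] [k1 k2 k3]; split=> [|al be Yal Ybe alm bem|al Yal alm].
- by move: h1 k1; rewrite size_cat oddD; case: (odd _); case: (odd _).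
- move: (h2 _ _ Yal Ybe alm bem) (k2 _ _ Yal Ybe alm bem).
  by rewrite count_cat oddD; case: (odd _); case: (odd _).
- by move: (h3 al Yal alm) (k3 al Yal alm); rewrite size_cat count_cat; lia.
Qed.

(** The anisotropic part modulo [-w] of a list in the cube of the fundamental
    ideal, when at least the pairs [ps] are split off. *)
Lemma residue Y w s ps r : char_group Y -> aniso Y s -> I3_test Y s ->
    perm_eq s (flatten_pairs ps ++ r) -> pairs_ratio Y w ps ->
  exists ps' t, [/\ perm_eq s (flatten_pairs ps' ++ t), pairs_ratio Y w ps',
    size ps <= size ps', aniso (kill Y (m ** w)) t & I3_test (kill Y (m ** w)) t].
Proof.
move=> YG sA sT sp psw; have [ps' [t [st psw' le tw]]] := pairing r YG psw.
have {}st := perm_trans sp st; exists ps', t; split=> //.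
  by apply: (aniso_kill YG _ tw); exact: aniso_perm st sA.
apply: I3_test_cancel (I3_test_pairs m YG psw').
by apply: I3_test_kill; exact: I3_test_perm st sT.
Qed.

Lemma residue_start Y s : char_group Y -> aniso Y s -> I3_test Y s -> 0 < size s ->
  exists w ps t, [/\ perm_eq s (flatten_pairs ps ++ t), pairs_ratio Y w ps,
    0 < size ps, aniso (kill Y (m ** w)) t & I3_test (kill Y (m ** w)) t].
Proof.
move=> YG sA sT s0.
have ev := I3_test_size sT; case: s s0 ev sA sT => [|a [|b r]] // _ _ sA sT.
have [||ps [t [h1 h2 h3 h4 h5]]] := @residue Y (a ** b) _ [:: (a, b)] r YG sA sT.
- exact: perm_refl.
- by apply/pairs_ratio_cons; split=> //=; char_tac YG.
by exists (a ** b), ps, t.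
Qed.

Lemma pairs_rho Y w s ps t : char_group Y -> aniso Y s -> I3_test Y s ->
    perm_eq s (flatten_pairs ps ++ t) -> pairs_ratio Y w ps -> I3_test Y t ->
  ~~ odd (size ps) /\ forall al, Y al -> al w = false ->
    odd (count al (unzip1 ps)) = odd (size ps)./2 && al m.
Proof.
case: ps => [|p ps]; first by split=> // al _ _; rewrite andbF.
move=> YG sA sT st psw tT; have [be Ybe bmw] := pairs_nontriv sA st psw isT YG.
exact: (pairs_test YG psw (I3_test_perm st sT) tT Ybe bmw).
Qed.

(** A form [<<-w>> <a, b>] of trivial discriminant modulo [w] is hyperbolic. *)
Lemma aniso2 Y w a a' b b' t : char_group Y -> aniso Y ([:: a; a'; b; b'] ++ t) ->
  eqv Y a' (w ** a) -> eqv (kill Y w) b (m ** a) -> False.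
Proof.
move=> YG sA aa /(eqv_kill YG)[h|h].
  by apply: (sA a b ([:: a'; b'] ++ t)) h; perm_by.
by apply: (sA a' b ([:: a; b'] ++ t)); [perm_by | char_tac YG].
Qed.

(** The analogue of the Hauptsatz: after one pair has been split off, induction
    applied modulo [-w] leaves [<<-w>> rho] with [rho] of size 1, 2 or 3; the size
    is even, and size 2 is hyperbolic. *)
Lemma aniso_lt8 Y s : char_group Y -> aniso Y s -> I3_test Y s -> size s < 8 -> s = [::].
Proof.
have [n] := ubnP (size s); elim: n Y s => // n IH Y s sn YG sA sT s8.
case s0: (size s) => [|k]; first exact: size0nil.
have [|w [ps [t [st psw ps0 tA tT]]]] := residue_start YG sA sT; first by rewrite s0.
have szs := perm_size st; rewrite size_cat size_flatten_pairs in szs.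
have t0 : t = [::] by apply: IH (kill_group _ YG) tA tT _; lia.
subst t; rewrite cats0 /= in st szs; have T0 : I3_test Y [::] by split.
have [|ev rho] := pairs_rho YG sA sT _ psw T0; first by rewrite cats0.
have : size ps = 2 by lia.
case: ps st psw rho {ps0 ev szs} => [|[a a'] [|[b b'] []]] // st psw rho _.
move: psw => /pairs_ratio_cons[/= aa _].
case: (@aniso2 Y w a a' b b' [::] YG) => //.
  by apply: aniso_perm sA; apply: perm_trans st _; rewrite /flatten_pairs; perm_by.
move=> al [Yal alw]; have /= := rho al Yal alw; rewrite (charM YG) //.
by case: (al a); case: (al b); case: (al m).
Qed.

(** If [rho] has size 4 and discriminant 1 modulo [w], one of its entries can be
    multiplied by [w], which does not change [<<-w>> rho], so that the
    discriminant is 1; then [rho] is a scaled 2-fold Pfister form. *)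
Lemma pairs4_flat Y w ps : char_group Y -> pairs_ratio Y w ps -> size ps = 4 ->
    (forall al, Y al -> al w = false -> odd (count al (unzip1 ps)) = false) ->
  exists c x y t, perm_eq (flatten_pairs ps) t /\ same Y t (flat3 c x y w).
Proof.
move=> YG; case: ps => [|[a a'] [|[b b'] [|[d d'] [|[e e'] []]]]] //= psw _ rho.
move: psw => /pairs_ratio_cons[/= aa] /pairs_ratio_cons[/= bb].
move=> /pairs_ratio_cons[/= dd] /pairs_ratio_cons[/= ee _].
have : eqv (kill Y w) e (a ** b ** d).
  move=> al [Yal alw]; move: (rho al Yal alw); rewrite !(charM YG) //.
  by case: (al a); case: (al b); case: (al d); case: (al e).
case/(eqv_kill YG) => ex; exists a, (a ** b), (a ** d).
  exists [:: a; a'; b; b'; d; d'; e; e']; rewrite /flatten_pairs.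
  by split; [perm_by | do ?split; char_tac YG].
exists [:: a; a'; b; b'; d; d'; e'; e]; rewrite /flatten_pairs.
by split; [perm_by | do ?split; char_tac YG].
Qed.

Lemma pairs4_is_flat Y w ps : char_group Y -> pairs_ratio Y w ps -> size ps = 4 ->
    (forall al, Y al -> al w = false -> odd (count al (unzip1 ps)) = false) ->
  is_flat Y (flatten_pairs ps).
Proof.
move=> YG psw s4 rho; have [c [x [y [t [h1 h2]]]]] := pairs4_flat YG psw s4 rho.
by exists c, x, y, w, t.
Qed.

Lemma aniso_size8 Y s : char_group Y -> aniso Y s -> I3_test Y s -> size s = 8 ->
  is_flat Y s.
Proof.
move=> YG sA sT s8.
have [|w [ps [t [st psw ps0 tA tT]]]] := residue_start YG sA sT; first by rewrite s8.
have szs := perm_size st; rewrite size_cat size_flatten_pairs s8 in szs.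
have t0 : t = [::] by apply: aniso_lt8 (kill_group _ YG) tA tT _; lia.
subst t; rewrite cats0 /= in st szs; have T0 : I3_test Y [::] by split.
have [|_ rho] := pairs_rho YG sA sT _ psw T0; first by rewrite cats0.
have s4 : size ps = 4 by lia.
have [|c [x [y [t [h1 h2]]]]] := pairs4_flat YG psw s4.
  by move=> al Yal alw; rewrite rho // s4.
by exists c, x, y, w, t; split=> //; exact: perm_trans h1.
Qed.

(** The cases of [twisted_flat] for a residue of size 8. An entry [-w c] in the
    place of [c] means the summand [<<-w>> (-c)], since [<-w c> = <c> + <-c, -w c>]:
    it enlarges [rho] by [-c], and [pairs_test] applies to the enlarged list. *)
Lemma residue8_type Y w s ps t : char_group Y -> aniso Y s -> I3_test Y s ->
    perm_eq s (flatten_pairs ps ++ t) -> pairs_ratio Y w ps -> 0 < size ps ->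
    is_flat (kill Y (m ** w)) t ->
  exists c x y z t', perm_eq t t' /\
    [\/ [/\ same Y t' (flat3 c x y z), ~~ odd (size ps) &
           forall al, Y al -> al w = false ->
           odd (count al (unzip1 ps)) = odd (size ps)./2 && al m],
        [/\ same Y t' (m ** w ** c :: behead (flat3 c x y z)), odd (size ps) &
           forall al, Y al -> al w = false ->
           odd (count al (unzip1 ps ++ [:: m ** c])) = odd (size ps).+1./2 && al m] |
        [/\ same Y t' (m ** w ** c :: m ** w ** (c ** z) :: drop 2 (flat3 c x y z)),
           ~~ odd (size ps) &
           forall al, Y al -> al w = false ->
           odd (count al (unzip1 ps ++ [:: m ** c; m ** (c ** z)]))
             = ~~ odd (size ps)./2 && al m]].
Proof.
move=> YG sA sT st psw ps0 tF.
have [c [x [y [z [t' [tt ty]]]]]] := twisted_flat YG tF.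
exists c, x, y, z, t'; split=> //.
have [be Ybe bmw] := pairs_nontriv sA st psw ps0 YG.
have {tF}sT' : I3_test Y (flatten_pairs ps ++ t').
  apply: I3_test_perm sT; apply: perm_trans st _; perm_by.
have fT := I3_test_flat m c x y z YG.
case: ty => ty.
- constructor 1; have t'T : I3_test Y t' by apply: I3_test_same fT; exact: same_sym.
  have [h1 h2] := pairs_test YG psw sT' t'T Ybe bmw.
  by split.
- constructor 2; case: t' ty {tt} sT' => [|t0 t'] // ty sT'.
  have psw' : pairs_ratio Y w ((m ** c, t0) :: ps).
    apply/pairs_ratio_cons; split=> //=; case: ty => h0 _; char_tac YG.
  have t'T : I3_test Y (c :: t').
    by apply: I3_test_same (same_sym _) fT; case: ty => _; split.
  have [|h1 h2] := pairs_test YG psw' _ t'T Ybe bmw.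
    apply: I3_test_perm _ (I3_test_cat sT' (I3_test_hyp m c YG)).
    rewrite /flatten_pairs; perm_by.
  split=> // [|al Yal alw]; first by move: h1 => /= /negPn.
  by rewrite -h2 // count_cat /= addn0 addnC.
- constructor 3; case: t' ty {tt} sT' => [|t0 [|t1 t']] //= ty sT'; try tauto.
  have psw' : pairs_ratio Y w [:: (m ** c, t0), (m ** (c ** z), t1) & ps].
    case: ty => h0 [h1 _].
    by do 2?[apply/pairs_ratio_cons; split=> //=]; char_tac YG.
  have t'T : I3_test Y [:: c, c ** z & t'].
    by apply: I3_test_same (same_sym _) fT; case: ty => _ [_ h]; split=> //; split.
  have [|h1 h2] := pairs_test YG psw' _ t'T Ybe bmw.
    apply: I3_test_perm _ (I3_test_cat (I3_test_cat sT' (I3_test_hyp m c YG)) (I3_test_hyp m (c ** z) YG)).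
    rewrite /flatten_pairs; perm_by.
  split=> // [|al Yal alw]; first by move: h1; rewrite /= negbK.
  have := h2 al Yal alw; rewrite /= => <-; rewrite count_cat /= !oddD !oddb /=.
  by case: (al (m ** c)); case: (al (m ** _)); case: (odd _).
Qed.

(** A single pair and a twisted flat remain. By parity the flat is twisted at one
    point [c], and [<<-w>> <a, -c>] has trivial discriminant, so that [a] agrees with
    [c] up to [w]: a hyperbolic plane appears. *)
Lemma aniso_size10 Y s : char_group Y -> aniso Y s -> I3_test Y s -> size s <> 10.
Proof.
move=> YG sA sT s10.
have [|w [ps [t [st psw ps0 tA tT]]]] := residue_start YG sA sT; first by rewrite s10.
have szs := perm_size st; rewrite size_cat size_flatten_pairs s10 in szs.
have [t8|t8] := ltnP (size t) 8.
  have t0 := aniso_lt8 (kill_group _ YG) tA tT t8; subst t.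
  have T0 : I3_test Y [::] by split.
  by have [ev _] := pairs_rho YG sA sT st psw T0; move: szs ev => /=; lia.
have tF : is_flat (kill Y (m ** w)) t.
  by apply: (aniso_size8 (kill_group _ YG) tA tT); lia.
have s1 : size ps = 1 by lia.
have [c [x [y [z [t' [tt ty]]]]]] := residue8_type YG sA sT st psw ps0 tF.
case: ty; rewrite s1 => -[ty // _ rho].
case: ps st psw s1 rho {ps0 szs} => [|[a a'] []] // st psw _ rho.
move: psw => /pairs_ratio_cons[/= aa _].
case: t' ty tt => [|t0 t'] // [h0 _] tt.
have ac : eqv (kill Y w) a c.
  move=> al [Yal alw]; have := rho al Yal alw; rewrite /= (charM YG) //.
  by case: (al a); case: (al c); case: (al m).
have sp : perm_eq s [:: t0, a, a' & t'].
  by apply: perm_trans st _; rewrite /flatten_pairs; perm_by.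
case: (eqv_kill YG ac) => {}ac.
  by apply: (sA t0 a' (a :: t')); [perm_by | char_tac YG].
by apply: (sA t0 a (a' :: t')); [perm_by | char_tac YG].
Qed.

(** If two pairs and a twisted flat remain, the flat is twisted along an edge of
    direction [z]; the discriminant condition shows that the entries of the pairs
    also differ by [z], up to [w], and the whole list is divisible by
    [<<-z>>]. *)
Lemma aniso_size12 Y s : char_group Y -> aniso Y s -> I3_test Y s -> size s = 12 ->
  exists w ps, perm_eq s (flatten_pairs ps) /\ pairs_ratio Y w ps.
Proof.
move=> YG sA sT s12.
have [|w [ps [t [st psw ps0 tA tT]]]] := residue_start YG sA sT; first by rewrite s12.
have szs := perm_size st; rewrite size_cat size_flatten_pairs s12 in szs.
have [t8|t8] := ltnP (size t) 8.
  have t0 := aniso_lt8 (kill_group _ YG) tA tT t8; subst t.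
  by exists w, ps; rewrite cats0 in st.
have t10 := aniso_size10 (kill_group _ YG) tA tT.
have tF : is_flat (kill Y (m ** w)) t.
  by apply: (aniso_size8 (kill_group _ YG) tA tT); lia.
have s2 : size ps = 2 by lia.
have [c [x [y [z [t' [tt ty]]]]]] := residue8_type YG sA sT st psw ps0 tF.
case: ps st psw s2 ty {ps0 szs} => [|[a a'] [|[b b'] []]] // st psw _ ty.
move: psw => /pairs_ratio_cons[/= aa] /pairs_ratio_cons[/= bb _].
have sp : perm_eq s ([:: a; a'; b; b'] ++ t').
  by apply: perm_trans st _; rewrite /flatten_pairs; perm_by.
case: ty => -[ty //= _ rho].
  case: (aniso2 YG (aniso_perm sp sA) aa) => al [Yal alw].
  have := rho al Yal alw; rewrite /= (charM YG) //.
  by case: (al a); case: (al b); case: (al m).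
have : eqv (kill Y w) b (a ** z).
  move=> al [Yal alw]; have := rho al Yal alw; rewrite /= !(charM YG) //.
  by case: (al a); case: (al b); case: (al c); case: (al m); case: (al z).
case: t' ty {tt} sp => [|t0 [|t1 [|t2 [|t3 [|t4 [|t5 [|t6 [|t7 []]]]]]]]];
  try by move=> /=; tauto.
move=> /= [h0 [h1 [h2 [h3 [h4 [h5 [h6 [h7 _]]]]]]]] sp.
case/(eqv_kill YG) => hb.
  exists z, [:: (a, b); (a', b'); (t0, t1); (t2, t3); (t4, t5); (t6, t7)].
  split; first by apply: perm_trans sp _; rewrite /flatten_pairs; perm_by.
  by do 6?[apply/pairs_ratio_cons; split=> /=]; try char_tac YG.
exists z, [:: (a, b'); (a', b); (t0, t1); (t2, t3); (t4, t5); (t6, t7)].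
split; first by apply: perm_trans sp _; rewrite /flatten_pairs; perm_by.
by do 6?[apply/pairs_ratio_cons; split=> /=]; try char_tac YG.
Qed.

Lemma pairs_split Y v w ps : char_group Y -> pairs_ratio (kill Y v) w ps ->
  exists ps1 ps2, [/\ perm_eq (flatten_pairs ps) (flatten_pairs ps1 ++ flatten_pairs ps2),
    perm_eq (unzip1 ps) (unzip1 ps1 ++ unzip1 ps2),
    pairs_ratio Y w ps1, pairs_ratio Y (v ** w) ps2 &
    size ps = size ps1 + size ps2].
Proof.
move=> YG; elim: ps => [|[a b] ps IH] psw; first by exists [::], [::].
move: psw => /pairs_ratio_cons[/= ab /IH[ps1 [ps2 [pE pE1 r1 r2 sE]]]].
rewrite /flatten_pairs in pE.
case: (eqv_kill YG ab) => {}ab.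
  exists ((a, b) :: ps1), ps2; split=> //=; last by rewrite sE.
  - by move: pE {pE1} => pE; rewrite /flatten_pairs; perm_by.
  - by move: pE1 {pE} => pE1; perm_by.
  - exact/pairs_ratio_cons.
exists ps1, ((a, b) :: ps2); split=> //=; last by rewrite sE addnS.
- by move: pE {pE1} => pE; rewrite /flatten_pairs; perm_by.
- by move: pE1 {pE} => pE1; perm_by.
- apply/pairs_ratio_cons; split=> //=; char_tac YG.
Qed.

(** A pair of ratio [w] modulo [v] has the ratio [w] or [v w], and one of the two
    occurs at least half of the time. *)
Lemma pairs_ratio_kill Y v w ps : char_group Y -> pairs_ratio (kill Y v) w ps ->
  exists w' ps' r, [/\ perm_eq (flatten_pairs ps) (flatten_pairs ps' ++ r),
    pairs_ratio Y w' ps' & size ps <= (size ps').*2].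
Proof.
move=> YG psw; have [ps1 [ps2 [pE _ r1 r2 sE]]] := pairs_split YG psw.
have [le|le] := leqP (size ps1) (size ps2).
  by exists (v ** w), ps2, (flatten_pairs ps1); split=> //; [perm_by | lia].
by exists w, ps1, (flatten_pairs ps2); split=> //; lia.
Qed.

Lemma aniso_size14 Y s : char_group Y -> aniso Y s -> I3_test Y s -> size s = 14 ->
  exists w ps t, [/\ perm_eq s (flatten_pairs ps ++ t), pairs_ratio Y w ps &
    2 < size ps].
Proof.
move=> YG sA sT s14.
have [|w [ps [t [st psw ps0 tA tT]]]] := residue_start YG sA sT; first by rewrite s14.
have szs := perm_size st; rewrite size_cat size_flatten_pairs s14 in szs.
have [k|k] := ltnP 2 (size ps); first by exists w, ps, t.
have t10 := aniso_size10 (kill_group _ YG) tA tT.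
have [|w1 [ps1 [tps1 ps1w]]] := aniso_size12 (kill_group _ YG) tA tT; first by lia.
have szt := perm_size tps1; rewrite size_flatten_pairs in szt.
have [w2 [ps2 [r [pE ps2w le]]]] := pairs_ratio_kill YG ps1w.
exists w2, ps2, (flatten_pairs ps ++ r); split=> //; last by lia.
apply: perm_trans st _; have tE := perm_trans tps1 pE; move: tE => {tps1 pE} tE; perm_by.
Qed.

(** The number of pairs is improved by changing the ratio: one pair leaves a
    residue of size 14, which has three pairs of one ratio modulo [-w], hence two
    pairs for a suitable lift of that ratio; two pairs leave a residue of size 12
    and give three pairs in the same way; three are impossible by
    [aniso_size10], and five, six or seven by [aniso_lt8]. *)
Lemma aniso_size16 Y s : char_group Y -> aniso Y s -> I3_test Y s -> size s = 16 ->
  exists w ps t, [/\ perm_eq s (flatten_pairs ps ++ t), pairs_ratio Y w ps,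
    aniso (kill Y (m ** w)) t &
    (size ps = 8 /\ t = [::]) \/ (size ps = 4 /\ is_flat (kill Y (m ** w)) t)].
Proof.
move=> YG sA sT s16.
(* The residue has size at most 10, hence 0 or 8 by the gaps 2, 4, 6 and 10. *)
have three w ps r : perm_eq s (flatten_pairs ps ++ r) -> pairs_ratio Y w ps ->
    2 < size ps -> exists w ps t, [/\ perm_eq s (flatten_pairs ps ++ t),
    pairs_ratio Y w ps, aniso (kill Y (m ** w)) t &
    (size ps = 8 /\ t = [::]) \/ (size ps = 4 /\ is_flat (kill Y (m ** w)) t)].
  move=> sp psw k; have [ps' [t [st psw' le tA tT]]] := residue YG sA sT sp psw.
  have szs := perm_size st; rewrite size_cat size_flatten_pairs s16 in szs.
  exists w, ps', t; split=> //.
  have [t8|t8] := ltnP (size t) 8.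
    have t0 := aniso_lt8 (kill_group _ YG) tA tT t8; subst t.
    left; split=> //; move: szs => /=; lia.
  have t10 := aniso_size10 (kill_group _ YG) tA tT.
  by right; split; [lia | apply: (aniso_size8 (kill_group _ YG) tA tT); lia].
(* The residue has size 12, which is a multiple of a binary form: it contributes
   six pairs of one ratio modulo [-w], of which three lift to a common ratio. *)
have two w ps r : perm_eq s (flatten_pairs ps ++ r) -> pairs_ratio Y w ps ->
    1 < size ps -> exists w ps r, [/\ perm_eq s (flatten_pairs ps ++ r),
      pairs_ratio Y w ps & 2 < size ps].
  move=> sp psw k; have [ps' [t [st psw' le tA tT]]] := residue YG sA sT sp psw.
  have szs := perm_size st; rewrite size_cat size_flatten_pairs s16 in szs.
  have [k3|k3] := ltnP 2 (size ps'); first by exists w, ps', t.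
  have [|w1 [ps1 [tps1 ps1w]]] := aniso_size12 (kill_group _ YG) tA tT; first by lia.
  have szt := perm_size tps1; rewrite size_flatten_pairs in szt.
  have [w2 [ps2 [q [pE ps2w le2]]]] := pairs_ratio_kill YG ps1w.
  exists w2, ps2, (flatten_pairs ps' ++ q); split=> //; last by lia.
  apply: perm_trans st _; have tE := perm_trans tps1 pE; move: tE => {sp tps1 pE} tE; perm_by.
have [|w [ps [t [st psw ps0 tA tT]]]] := residue_start YG sA sT; first by rewrite s16.
have szs := perm_size st; rewrite size_cat size_flatten_pairs s16 in szs.
suff [w1 [ps1 [r1 [h1 h2 h3]]]] : exists w ps r,
    [/\ perm_eq s (flatten_pairs ps ++ r), pairs_ratio Y w ps & 1 < size ps].
  by have [w2 [ps2 [r2 [k1 k2 k3]]]] := two _ _ _ h1 h2 h3; exact: three k1 k2 k3.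
have [k|k] := ltnP 1 (size ps); first by exists w, ps, t.
have [|w1 [ps1 [t1 [tps1 ps1w k1]]]] := aniso_size14 (kill_group _ YG) tA tT.
  by lia.
have [w2 [ps2 [q [pE ps2w le2]]]] := pairs_ratio_kill YG ps1w.
exists w2, ps2, (flatten_pairs ps ++ t1 ++ q); split=> //; last by lia.
apply: perm_trans st _; move: pE tps1 => /seq.permP pE /seq.permP tps1.
apply/seq.permP => p; move: (pE p) (tps1 p); rewrite !count_cat => -> ->; lia.
Qed.

End Sizes.

(** * Witt equivalence of lists; the generic decomposition *)

Section WittLists.

Variables (V : eqType) (mul : V -> V -> V) (m : V).
Local Infix "**" := mul (at level 40, left associativity).
Variables (lev2 : Prop) (Y : (V -> bool) -> Prop).
Hypothesis YG : char_group mul Y.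

Implicit Types (a b c v w : V) (s t r : seq V).
Implicit Types (ps : seq (V * V)).

Local Notation aniso := (aniso mul m).
Local Notation I3_test := (I3_test m).
Local Notation flat3 := (flat3 mul).
Local Notation is_flat := (is_flat mul).
Local Notation pairs_ratio := (pairs_ratio mul).

(** Witt equivalence of diagonal forms, presented by generators. The constructor
    [weq_dbl] is available when [lev2] holds, that is, when [-1] is a sum of two
    squares. *)
Inductive weq : seq V -> seq V -> Prop :=
| weq_perm s t of perm_eq s t : weq s t
| weq_same s t of same Y s t : weq s t
| weq_hyp a : weq [:: a; m ** a] [::]
| weq_dbl a of lev2 : weq [:: a; a] [:: m ** a; m ** a]
| weq_cat s s' t t' of weq s s' & weq t t' : weq (s ++ t) (s' ++ t')
| weq_sym s t of weq s t : weq t s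
| weq_trans s t r of weq s t & weq t r : weq s r.

Lemma weq_refl s : weq s s. Proof. exact/weq_perm/perm_refl. Qed.

Lemma weq_perm_same s t r : perm_eq s t -> same Y t r -> weq s r.
Proof. by move=> /weq_perm st /weq_same; exact: weq_trans. Qed.

Lemma same_cat s s' t t' : same Y s s' -> same Y t t' -> same Y (s ++ t) (s' ++ t').
Proof. by elim: s s' => [|a s IH] [|a' s'] //= [aa /IH ss] /ss. Qed.

Lemma weq_addhyp s a : weq s (s ++ [:: a; m ** a]).
Proof.
by rewrite -{1}[s]cats0; apply: weq_cat; [exact: weq_refl|exact/weq_sym/weq_hyp].
Qed.

Lemma weq_scale w s t : weq s t -> weq (map (mul w) s) (map (mul w) t).
Proof.
elim=> {s t} [s t st|s t st|a|a l2|s s' t t' _ IH1 _ IH2|s t _|s t r _ + _].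
- exact/weq_perm/perm_map.
- apply: weq_same; elim: s t st => [|a s IH] [|b t] //= [ab /IH]; split=> //.
  by char_tac YG.
- apply: weq_trans (weq_hyp (w ** a)); apply: weq_same.
  by do ?split => //; char_tac YG.
- apply: weq_trans (weq_trans (weq_dbl (w ** a) l2) _); first exact: weq_refl.
  by apply: weq_same; do ?split => //; char_tac YG.
- by rewrite !map_cat; exact: weq_cat.
- exact: weq_sym.
- exact: weq_trans.
Qed.

(** The list of [<<-w>>] times [r]. *)
Definition times w r := r ++ map (mul w) r.

Lemma weq_times w s t : weq s t -> weq (times w s) (times w t).
Proof. by move=> st; apply: weq_cat (weq_scale w st). Qed.

Lemma times_cat w s t : perm_eq (times w (s ++ t)) (times w s ++ times w t).
Proof. by rewrite /times map_cat; perm_by. Qed.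

Lemma weq_pairs w ps : pairs_ratio Y w ps -> weq (flatten_pairs ps) (times w (unzip1 ps)).
Proof.
move=> psw; apply: weq_cat; first exact: weq_refl.
apply: weq_same; elim: ps psw => //= p ps IH /pairs_ratio_cons[pw /IH]; split=> //.
Qed.

Definition flat2 c x y := [:: c; c ** x; c ** y; c ** x ** y].

Lemma times_flat2 c x y w : weq (times w (flat2 c x y)) (flat3 c x y w).
Proof.
apply: (@weq_perm_same _ [:: c; w ** c; c ** x; w ** (c ** x); c ** y; w ** (c ** y);
  c ** x ** y; w ** (c ** x ** y)]); first by rewrite /times /=; perm_by.
by do ?split => //; char_tac YG.
Qed.

(** Multiplication by [<<-w>>] identifies [b] and [w b]. *)
Lemma weq_times_swap w s a b : eqv (kill Y w) a b ->
  weq (times w (rcons s a)) (times w (rcons s b)).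
Proof.
case/(eqv_kill YG) => h.
  by apply/weq_times/weq_same; rewrite -!cats1; apply: same_cat (same_refl _ _) _.
rewrite -!cats1; apply: weq_trans (weq_perm (times_cat _ _ _)) _.
apply: weq_sym; apply: weq_trans (weq_perm (times_cat _ _ _)) _.
apply: weq_cat (weq_refl _) _; apply: (@weq_perm_same _ [:: w ** b; b]).
  by rewrite /times /=; perm_by.
by do ?split => //; char_tac YG.
Qed.

(** An Albert form [<a, b, c, d, e, f>] is [<a, b, c, abc>] plus
    [<d, e, f, -abc>], and its discriminant makes the second form a scaled 2-fold
    Pfister form. *)
Lemma weq_times6 w a b c d e f :
    (forall al, Y al -> al w = false -> odd (count al [:: a; b; c; d; e; f]) = al m) ->
  weq (times w [:: a; b; c; d; e; f])
    (flat3 a (a ** b) (a ** c) w ++ flat3 d (d ** e) (m ** a ** b ** c ** e) w).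
Proof.
move=> prod; pose f0 := m ** a ** b ** c ** d ** e.
apply: weq_trans (@weq_times_swap w [:: a; b; c; d; e] f f0 _) _.
  move=> al [Yal alw]; have := prod al Yal alw; rewrite /= !(charM YG) //.
  by case: (al a); case: (al b); case: (al c); case: (al d); case: (al e);
     case: (al f); case: (al m).
apply: weq_trans (weq_cat (times_flat2 _ _ _ _) (times_flat2 _ _ _ _)).
apply: weq_trans (weq_perm (times_cat _ _ _)); apply: weq_times.
apply: weq_trans (weq_addhyp _ (a ** b ** c)) _.
apply: (@weq_perm_same _ [:: a; b; c; a ** b ** c; d; e; f0; m ** (a ** b ** c)]).
  by rewrite /=; perm_by.
by rewrite /f0; do ?split => //; char_tac YG.
Qed.

Definition sum3 s := exists fl : seq (V * V * V * V), size fl <= 3 /\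
  weq s (flatten [seq flat3 p.1.1.1 p.1.1.2 p.1.2 p.2 | p <- fl]).

Lemma sum3_of2 s c x y z c' x' y' z' :
  weq s (flat3 c x y z ++ flat3 c' x' y' z') -> sum3 s.
Proof. by exists [:: (c, x, y, z); (c', x', y', z')]. Qed.

Lemma sum3_of3 s c x y z c' x' y' z' c2 x2 y2 z2 :
  weq s (flat3 c x y z ++ flat3 c' x' y' z' ++ flat3 c2 x2 y2 z2) -> sum3 s.
Proof. by exists [:: (c, x, y, z); (c', x', y', z'); (c2, x2, y2, z2)]. Qed.

Lemma sum3_weq s t : weq s t -> sum3 t -> sum3 s.
Proof. by move=> st [fl [h1 h2]]; exists fl; split=> //; exact: weq_trans st h2. Qed.

Lemma weq_type3 w ps t t' c x y z : pairs_ratio Y w ps -> perm_eq t t' ->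
    same Y t' (m ** w ** c :: m ** w ** (c ** z) :: drop 2 (flat3 c x y z)) ->
  weq (flatten_pairs ps ++ t)
   (times w (unzip1 ps ++ [:: m ** c; m ** (c ** z)]) ++ flat3 c x y z).
Proof.
move=> psw tt ty; case: t' tt ty => [|t0 [|t1 t']] tt //=; try tauto.
move=> [h0 [h1 h2]].
have {h2} h2 : same Y [:: c, c ** z & t'] (flat3 c x y z) by [].
have psw' : pairs_ratio Y w [:: (m ** c, t0), (m ** (c ** z), t1) & ps].
  by do 2?[apply/pairs_ratio_cons; split=> //=]; char_tac YG.
apply: weq_trans (weq_addhyp _ c) _; apply: weq_trans (weq_addhyp _ (c ** z)) _.
apply: weq_trans (weq_trans _ (weq_cat (weq_pairs psw') (weq_same h2))) _.
  by apply: weq_perm; rewrite /flatten_pairs; perm_by.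
apply: weq_cat (weq_refl _); apply/weq_times/weq_perm.
by rewrite /=; perm_by.
Qed.

(** Eight pairs of ratio [w]: the form [rho] is split as [<a, b, c, abc>] plus an
    Albert form. Four pairs: see [residue8_type]. *)
Lemma sum3_I3 s : aniso Y s -> I3_test Y s -> size s = 16 -> sum3 s.
Proof.
move=> sA sT s16; have [w [ps [t [st psw tA cs]]]] := aniso_size16 YG sA sT s16.
apply: sum3_weq (weq_perm st) _; case: cs => -[psn tE].
  subst t; rewrite cats0; have T0 : I3_test Y [::] by split.
  have [_] := pairs_rho YG sA sT st psw T0; rewrite psn => rho.
  apply: sum3_weq (weq_pairs psw) _; move: rho => {st sA sT s16 psw tA}.
  move: (unzip1 ps) (size_map fst ps : size (unzip1 ps) = size ps).
  rewrite psn => {ps psn}; case=> [|a [|b [|c [|d [|e [|f [|g [|h []]]]]]]]] // _ rho.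
  pose q := m ** (a ** b ** c).
  apply: sum3_of3; apply: weq_trans (weq_cat (times_flat2 a (a ** b) (a ** c) w)
    (@weq_times6 w q d e f g h _)); last first.
    move=> al Yal alw; have := rho al Yal alw; rewrite /= /q !(charM YG) //.
    by case: (al a); case: (al b); case: (al c); case: (al d); case: (al e);
      case: (al f); case: (al g); case: (al h); case: (al m).
  apply: weq_trans (weq_perm (times_cat _ _ _)); apply: weq_times.
  apply: weq_trans (weq_addhyp _ (a ** b ** c)) _.
  apply: (@weq_perm_same _ [:: a; b; c; a ** b ** c; q; d; e; f; g; h]).
    by rewrite /q /=; perm_by.
  by rewrite /q; do ?split => //; char_tac YG.
have [|c [x [y [z [t' [tt ty]]]]]] := residue8_type YG sA sT st psw _ tE.
  by rewrite psn.
case: ty; rewrite psn => -[ty //= _ rho].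
  have [//|c1 [x1 [y1 [t1 [tt1 ty1]]]]] := pairs4_flat YG psw psn.
  apply: (@sum3_of2 _ c1 x1 y1 w c x y z).
  apply: weq_cat; [exact: weq_perm_same tt1 ty1 | exact: weq_perm_same tt ty].
apply: sum3_weq (weq_type3 psw tt ty) _; move: rho => {st psw}.
move: (unzip1 ps) (size_map fst ps : size (unzip1 ps) = size ps); rewrite psn.
case=> [|a [|b [|d [|e []]]]] // _ rho.
apply: sum3_of3; rewrite catA; apply: weq_cat (weq_refl _).
exact: weq_times6.
Qed.

End WittLists.

Arguments weq_perm {V mul m lev2 Y s t}.
Arguments weq_refl {V mul m lev2 Y s}.
Arguments weq_same {V mul m lev2 Y s t}.
Arguments weq_hyp {V mul m lev2 Y} a.
Arguments weq_dbl {V mul m lev2 Y} a _.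
Arguments weq_perm_same {V mul m lev2 Y s t r}.
Arguments weq_addhyp {V mul m lev2 Y} s a.
Arguments weq_pairs {V mul m lev2 Y w ps}.
Arguments times_flat2 {V mul m lev2 Y} YG c x y w.
Arguments weq_times6 {V mul m lev2 Y} YG {w a b c d e f}.
Arguments weq_times_swap {V mul m lev2 Y} YG {w} s {a b}.
Arguments weq_trans {V mul m lev2 Y s t r}.

(** * Fields of level two *)

Section Level2.

Variables (V : eqType) (mul : V -> V -> V) (m : V).
Local Infix "**" := mul (at level 40, left associativity).
Variables (lev2 : Prop) (Y : (V -> bool) -> Prop).
Hypothesis YG : char_group mul Y.

Implicit Types (G : (V -> bool) -> Prop) (a b c v w : V) (s t r : seq V).
Implicit Types (ps : seq (V * V)).

Local Notation aniso := (aniso mul m).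
Local Notation I3_test := (I3_test m).
Local Notation flat3 := (flat3 mul).
Local Notation is_flat := (is_flat mul).
Local Notation pairs_ratio := (pairs_ratio mul).
Local Notation weq := (weq mul m lev2 Y).
Local Notation sum3 := (sum3 mul m lev2 Y).
Local Notation times := (times mul).

Definition triv G v := forall al, G al -> al v = false.

Lemma triv_kill G v a : char_group mul G ->
  triv (kill G v) a -> triv G a \/ triv G (v ** a).
Proof.
move=> GG h; have [|e|e] := @eqv_kill _ _ G v a (a ** a) GG.
- by move=> al Gal; rewrite (h al Gal) (charM GG) ?addbb //; case: Gal.
- by left=> al Gal; rewrite e // (charM GG) // addbb.
- by right=> al Gal; have := e al Gal; rewrite !(charM GG) // addbb => ->; case: (al v).
Qed.

(** The condition extends from the characters with [al m = true] to the whole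
    group, because the difference of two of those vanishes at [m]. *)
Lemma char_odd G g (b : bool) : char_group mul G -> ~ triv G m ->
    (forall al, G al -> al m = true -> al g = b) ->
  forall al, G al -> al g = b && al m.
Proof.
move=> GG ntm h al Gal; case alm: (al m); first by rewrite h // andbT.
rewrite andbF; apply: contrapT => alg; apply: ntm => be Gbe.
apply: contrapT => bem; apply: alg.
have {}bem : be m = true by case: (be m) bem.
have := h _ (charD GG Gal Gbe); rewrite /= alm bem (h be) // => /(_ erefl).
by case: (al g); case: b h.
Qed.

Lemma count_ratio w ps al : pairs_ratio Y w ps -> Y al ->
  count al (flatten_pairs ps) =
    if al w then size ps else (count al (unzip1 ps)).*2.
Proof.
move=> psw Yal; rewrite count_pairs (pairs_count YG psw Yal).
have := count_size al (unzip1 ps); rewrite size_map.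
by case: ifP => _; lia.
Qed.

Lemma ratio_neg w ps : pairs_ratio Y w ps -> pairs_ratio Y (m ** (m ** w)) ps.
Proof. by move=> psw p /psw h; char_tac YG. Qed.

Variable s : seq V.
Hypothesis l2 : lev2.
Hypothesis s16 : size s = 16.
Hypothesis sA : aniso (kill Y m) s.
Hypothesis sT : I3_test (kill Y m) s.
Hypothesis ntm : ~ triv Y m.
Hypothesis sgn4 : forall al, Y al -> al m = true -> (16 + 6 * count al s) %% 8 = 4.

Lemma distinct a b r : perm_eq s [:: a, b & r] -> triv (kill Y m) (a ** b) -> False.
Proof.
move=> sp h; apply: (sA sp) => al Gal; have := h al Gal; case: Gal => Yal alm.
by rewrite !(charM YG) // alm; case: (al a); case: (al b).
Qed.

Lemma triv_killW G v a : triv G a -> triv (kill G v) a.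
Proof. by move=> h al [/h]. Qed.

Lemma ratio_ntriv w a b r :
  perm_eq s [:: a, b & r] -> eqv (kill Y m) b (w ** a) -> ~ triv (kill Y m) w.
Proof.
move=> sp ab wt; apply: (distinct sp) => al Gal; have := ab al Gal; have := wt al Gal.
by case: Gal => Yal alm; rewrite !(charM YG) // => -> ->; rewrite addbb.
Qed.

(** If [-1] were trivial modulo [w] without being trivial, it would equal [w]. *)
Lemma ex_char w : ~ triv (kill Y m) w ->
  ~ triv (kill Y w) m /\ ~ triv (kill Y (m ** w)) m.
Proof.
move=> ntw; split=> /(triv_kill YG)[//|h]; apply: ntw => al [Yal alm];
  have := h al Yal; rewrite !(charM YG) // alm; by case: (al w).
Qed.

(** The signatures at the characters with a given value at [w] see only one of
    the two families of pairs; being 4 modulo 8, they force both families to have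
    four pairs, each with discriminant [-1]. In [<<w>> <a, b, d, -abd>] the last
    entry is changed into [abd] at the cost of [<<w>> <-abd, -abd>], which equals
    [<<-w>> <-abd, -abd>] because doubled entries may change sign; it completes the
    other family to an Albert form. *)
Lemma sum3_eight_core w ps1 ps2 : pairs_ratio Y w ps1 -> pairs_ratio Y (m ** w) ps2 ->
    perm_eq s (flatten_pairs ps1 ++ flatten_pairs ps2) ->
    size ps1 + size ps2 = 8 -> size ps2 <= size ps1 -> ~ triv (kill Y m) w ->
  sum3 s.
Proof.
move=> r1 r2 sp sz le /ex_char[ex0 ex1].
have cnt al : Y al -> al m = true ->
    (16 + 6 * (if al w then size ps1 + 2 * count al (unzip1 ps2)
      else 2 * count al (unzip1 ps1) + size ps2)) %% 8 = 4.
  move=> Yal alm; have := sgn4 Yal alm; rewrite (seq.permP sp) count_cat.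
  rewrite (count_ratio r1) // (count_ratio r2) // (charM YG) // alm.
  by case: (al w) => /=; rewrite -!mul2n.
have GG0 := kill_group w YG; have GG1 := kill_group (m ** w) YG.
have cnt1 al : kill Y (m ** w) al -> al m = true ->
    (16 + 6 * (size ps1 + 2 * count al (unzip1 ps2))) %% 8 = 4.
  move=> [Yal alw] alm; have := cnt al Yal alm.
  by move: alw; rewrite (charM YG) // alm; case: (al w).
have cnt0 al : kill Y w al -> al m = true ->
    (16 + 6 * (2 * count al (unzip1 ps1) + size ps2)) %% 8 = 4.
  by move=> [Yal alw] alm; have := cnt al Yal alm; rewrite alw.
have [al0 G1al0 al0m] : exists2 al, kill Y (m ** w) al & al m = true.
  apply: contrapT => h; apply: ex1 => al Gal.
  by case alm: (al m) => //; case: h; exists al.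
have := cnt1 _ G1al0 al0m.
case sz2: (size ps2) sz le => [|[|[|[|[|k]]]]] sz le h; try lia.
- by move: h; rewrite (size0nil sz2) /=; lia.
- exfalso; case: ps2 r2 sp sz2 cnt1 {cnt cnt0 h} => [|[a a'] [|[b b'] []]] // r2 sp _ cnt1.
  move: r2 => /pairs_ratio_cons[/= aa] /pairs_ratio_cons[/= bb _].
  have abt : triv (kill Y (m ** w)) (a ** b).
    move=> al Gal; rewrite (@char_odd _ _ false GG1 ex1) // => {Gal} {}al Gal alm.
    have := cnt1 al Gal alm; rewrite (charM GG1) //= (_ : size ps1 = 6); last by lia.
    by case: (al a); case: (al b).
  case: (triv_kill YG abt) => t1.
    apply: (@distinct a b (flatten_pairs ps1 ++ [:: a'; b'])); last exact: triv_killW.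
    by apply: perm_trans sp _; rewrite /flatten_pairs; perm_by.
  apply: (@distinct a' b (flatten_pairs ps1 ++ [:: a; b'])).
    by apply: perm_trans sp _; rewrite /flatten_pairs; perm_by.
  move=> al [Yal _]; have := t1 al Yal; rewrite !(charM YG) // (aa _ Yal).
  by rewrite !(charM YG) // -!addbA.
have {}sz : size ps1 = 4 by lia.
have rho0 al : Y al -> al w = false -> odd (count al (unzip1 ps1)) = al m.
  case: ps1 sz cnt0 {r1 sp cnt cnt1 h le} => [|[a ?] [|[b ?] [|[c ?] [|[d ?] []]]]] //= _ cnt0.
  move=> Yal alw; rewrite -[al m]andTb.
  rewrite -(@char_odd (kill Y w) (a ** b ** c ** d) true GG0 ex0) //.
    by rewrite !(charM YG) //; case: (al a); case: (al b); case: (al c); case: (al d).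
  move=> {Yal alw}al Gal alm; have := cnt0 al Gal alm; rewrite sz2 !(charM GG0) //.
  by case: (al a); case: (al b); case: (al c); case: (al d).
have rho1 al : Y al -> al (m ** w) = false -> odd (count al (unzip1 ps2)) = al m.
  case: ps2 sz2 cnt1 {r2 sp cnt cnt0 h le} => [|[a ?] [|[b ?] [|[c ?] [|[d ?] []]]]] //= _ cnt1.
  move=> Yal alw; rewrite -[al m]andTb.
  rewrite -(@char_odd (kill Y (m ** w)) (a ** b ** c ** d) true GG1 ex1) //.
    by rewrite !(charM YG) //; case: (al a); case: (al b); case: (al c); case: (al d).
  move=> {Yal alw}al Gal alm; have := cnt1 al Gal alm; rewrite sz !(charM GG1) //.
  by case: (al a); case: (al b); case: (al c); case: (al d).
apply: sum3_weq (weq_perm sp) _.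
apply: sum3_weq (weq_cat (weq_pairs r1) (weq_pairs r2)) _.
move: (unzip1 ps1) (size_map fst ps1 : size (unzip1 ps1) = size ps1) rho0.
move: (unzip1 ps2) (size_map fst ps2 : size (unzip1 ps2) = size ps2) rho1.
rewrite sz sz2; case=> [|a [|b [|d [|e []]]]] // _ rho1.
case=> [|a1 [|b1 [|d1 [|e1 []]]]] // _ rho0.
pose g := a ** b ** d; set w2 := m ** w.
have eg : eqv (kill Y w2) e (m ** g).
  move=> al [Yal alw]; have := rho1 al Yal alw; rewrite /= !(charM YG) //.
  by case: (al a); case: (al b); case: (al d); case: (al e); case: (al m).
apply: sum3_weq (weq_cat weq_refl (weq_times_swap YG [:: a; b; d] eg)) _.
have flip : weq (times w2 [:: m ** g]) (times w2 [:: g] ++ times w [:: m ** g; m ** g]).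
  apply: weq_sym; apply: (@weq_trans _ _ _ _ _ _
    ([:: w ** (m ** g); w ** (m ** g)] ++ [:: g; m ** g] ++ [:: m ** g; w2 ** g])).
    by apply: weq_perm; rewrite /times /=; perm_by.
  apply: weq_trans (weq_cat (weq_dbl _ l2) (weq_cat (weq_hyp _) weq_refl)) _.
  apply: (@weq_trans _ _ _ _ _ _ ([:: m ** g; w ** g] ++ [:: w2 ** g; m ** (w2 ** g)])).
    apply: (@weq_perm_same _ _ _ _ _ _ [:: m ** g; m ** (w ** (m ** g)); w2 ** g; m ** (w ** (m ** g))]).
      by rewrite /=; perm_by.
    by rewrite /w2; do ?split => //; char_tac YG.
  apply: weq_trans (weq_cat weq_refl (weq_hyp _)) _.
  by rewrite cats0; apply: weq_same; rewrite /w2; do ?split => //; char_tac YG.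
apply: sum3_of3; apply: weq_trans (weq_cat (times_flat2 YG a (a ** b) (a ** d) w2)
  (@weq_times6 _ _ _ _ _ YG w a1 b1 d1 e1 (m ** g) (m ** g) _)); last first.
  move=> al Yal alw; have := rho0 al Yal alw; rewrite /= !(charM YG) //.
  by case: (al a1); case: (al b1); case: (al d1); case: (al e1); case: (al a);
    case: (al b); case: (al d); case: (al m).
apply: (@weq_trans _ _ _ _ _ _ (times w [:: a1; b1; d1; e1] ++ times w2 [:: a; b; d] ++
    (times w2 [:: g] ++ times w [:: m ** g; m ** g]))).
  apply: weq_cat weq_refl _.
  apply: weq_trans _ (weq_cat weq_refl flip).
  by apply: weq_perm; rewrite /times /=; perm_by.
apply: (@weq_perm_same _ _ _ _ _ _ (times w2 [:: a; b; d; g] ++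
  times w [:: a1; b1; d1; e1; m ** g; m ** g])); first by rewrite /times /=; perm_by.
apply: same_cat (same_refl _ _).
by rewrite /times /flat2 /g /w2; do ?split => //; char_tac YG.
Qed.

Lemma sum3_eight w ps : pairs_ratio (kill Y m) w ps -> perm_eq s (flatten_pairs ps) ->
  size ps = 8 -> sum3 s.
Proof.
move=> psw sp sz.
have ntw : ~ triv (kill Y m) w.
  case: ps psw sp sz => [|[a b] ps] // /pairs_ratio_cons[/= ab _] sp _.
  apply: (@ratio_ntriv w a b (flatten_pairs ps)) ab.
  by apply: perm_trans sp _; rewrite /flatten_pairs; perm_by.
have ntmw : ~ triv (kill Y m) (m ** w).
  by move=> h; apply: ntw => al [Yal alm]; have := h al (conj Yal alm); rewrite (charM YG) // alm.
have [ps1 [ps2 [pE _ r1 r2 szE]]] := pairs_split YG psw.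
have {pE}sp := perm_trans sp pE.
have [le|le] := leqP (size ps2) (size ps1).
  by apply: sum3_eight_core r1 r2 sp _ le ntw; lia.
apply: (sum3_eight_core r2 (ratio_neg r1) _ _ _ ntmw); [|lia|lia].
by rewrite perm_sym perm_catC perm_sym.
Qed.

Lemma count_flat c x y z al : Y al -> al m = true ->
  (8 + 6 * count al (flat3 c x y z)) %% 8 = 0.
Proof. by move=> Yal alm; case: (I3_test_flat m c x y z YG) => _ _ /(_ al Yal alm). Qed.

(** Both flats lift from the quotient by [-1] up to 0, 1 or 2 wrong signs. The
    signatures exclude all combinations except 2 and 2, and then the edges that
    carry the wrong signs have opposite directions [z] and [-z]: twice these four
    entries is a further flat. *)
Lemma sum3_flats A B : is_flat (kill Y m) A -> is_flat (kill Y m) B ->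
  perm_eq s (A ++ B) -> sum3 s.
Proof.
move=> /(twisted_flat YG)[c [x [y [z [A' [AA tA]]]]]].
move=> /(twisted_flat YG)[c' [x' [y' [z' [B' [BB tB]]]]]] sp.
have {AA BB}sp : perm_eq s (A' ++ B') by perm_by.
have [al0 Yal0 al0m] : exists2 al, Y al & al m = true.
  apply: contrapT => h; apply: ntm => al Gal.
  by case alm: (al m) => //; case: h; exists al.
have cnt al : Y al -> al m = true -> (16 + 6 * (count al A' + count al B')) %% 8 = 4.
  by move=> Yal alm; have := sgn4 Yal alm; rewrite (seq.permP sp) count_cat.
have cnt1 C c0 x0 y0 z0 al : same Y C (flat3 c0 x0 y0 z0) -> Y al -> al m = true ->
    count al C %% 4 = 0.
  move=> /same_count h Yal alm; rewrite (h _ Yal) {h}.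
  by have := count_flat c0 x0 y0 z0 Yal alm; lia.
have cnt2 C c0 x0 y0 z0 al : same Y C (m ** c0 :: behead (flat3 c0 x0 y0 z0)) ->
    Y al -> al m = true -> (count al C + 2 * al c0) %% 4 = 1.
  move=> /same_count h Yal alm; rewrite (h _ Yal) {h}.
  have := count_flat c0 x0 y0 z0 Yal alm; pose n := count al (behead (flat3 c0 x0 y0 z0)).
  rewrite -[count al (flat3 _ _ _ _)]/(al c0 + n)%N.
  rewrite -[count al (_ :: _)]/(al (m ** c0) + n)%N (charM YG Yal m) alm.
  by case: (al c0) => /=; move: n => n; lia.
have cnt3 C c0 x0 y0 z0 al :
    same Y C (m ** c0 :: m ** (c0 ** z0) :: drop 2 (flat3 c0 x0 y0 z0)) ->
    Y al -> al m = true -> (count al C + 2 * (al c0 + al (c0 ** z0))) %% 4 = 2.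
  move=> /same_count h Yal alm; rewrite (h _ Yal) {h}.
  have := count_flat c0 x0 y0 z0 Yal alm; pose n := count al (drop 2 (flat3 c0 x0 y0 z0)).
  rewrite -[count al (flat3 _ _ _ _)]/(al c0 + (al (c0 ** z0) + n))%N.
  rewrite -[count al (_ :: _)]/(al (m ** c0) + (al (m ** (c0 ** z0)) + n))%N.
  rewrite !(charM YG Yal m) alm.
  by case: (al c0); case: (al (c0 ** z0)) => /=; move: n => n; lia.
have sp' : perm_eq s (B' ++ A') by perm_by.
(* Against a correct flat, two wrong signs at [c0] and [c0 z0] give the signature
   4 only if [z0] is trivial, so that two entries of [s] agree. *)
have mixed C c0 x0 y0 z0 D c1 x1 y1 z1 : perm_eq s (C ++ D) ->
    same Y C (flat3 c1 x1 y1 z1) ->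
    same Y D (m ** c0 :: m ** (c0 ** z0) :: drop 2 (flat3 c0 x0 y0 z0)) -> False.
  move=> spCD tC tD.
  have zt : triv Y z0.
    move=> al Yal; apply: (@char_odd Y z0 false YG ntm) Yal => {}al Yal alm.
    have := sgn4 Yal alm; rewrite (seq.permP spCD) count_cat.
    have := cnt1 _ _ _ _ _ _ tC Yal alm; have := cnt3 _ _ _ _ _ _ tD Yal alm.
    by rewrite (charM YG Yal c0); case: (al c0); case: (al z0) => /=; lia.
  case: D tD spCD => [|t0 [|t1 D]] //=; try tauto; move=> [h0 [h1 _]] spCD.
  apply: (@distinct t0 t1 (C ++ D)); first by apply: perm_trans spCD _; perm_by.
  move=> al [Yal _]; rewrite (charM YG) // (h0 _ Yal) (h1 _ Yal) !(charM YG) //.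
  by rewrite (zt _ Yal) addbF addbb.
case: tA tB => tA [] tB.
- by have := cnt _ Yal0 al0m; have := cnt1 _ _ _ _ _ _ tA Yal0 al0m;
    have := cnt1 _ _ _ _ _ _ tB Yal0 al0m; lia.
- by have := cnt _ Yal0 al0m; have := cnt1 _ _ _ _ _ _ tA Yal0 al0m;
    have := cnt2 _ _ _ _ _ _ tB Yal0 al0m; lia.
- by case: (mixed _ _ _ _ _ _ _ _ _ _ sp tA tB).
- by have := cnt _ Yal0 al0m; have := cnt2 _ _ _ _ _ _ tA Yal0 al0m;
    have := cnt1 _ _ _ _ _ _ tB Yal0 al0m; lia.
- exfalso; have cc : triv Y (c ** c').
    move=> al Yal; apply: (@char_odd Y (c ** c') false YG ntm) Yal => {}al Yal alm.
    have := cnt _ Yal alm; rewrite (charM YG) //.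
    have := cnt2 _ _ _ _ _ _ tA Yal alm; have := cnt2 _ _ _ _ _ _ tB Yal alm.
    by case: (al c); case: (al c') => /=; lia.
  case: A' tA sp {sp' cnt} => [|t0 A'] //= [h0 _] sp.
  case: B' tB sp => [|t1 B'] //= [h1 _] sp.
  apply: (@distinct t0 t1 (A' ++ B')); first by apply: perm_trans sp _; perm_by.
  move=> al [Yal _]; rewrite (charM YG) // (h0 _ Yal) (h1 _ Yal) !(charM YG) //.
  have := cc _ Yal; rewrite (charM YG) //; by case: (al m); case: (al c); case: (al c').
- by have := cnt _ Yal0 al0m; have := cnt2 _ _ _ _ _ _ tA Yal0 al0m;
    have := cnt3 _ _ _ _ _ _ tB Yal0 al0m; lia.
- by case: (mixed _ _ _ _ _ _ _ _ _ _ sp' tB tA).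
- by have := cnt _ Yal0 al0m; have := cnt3 _ _ _ _ _ _ tA Yal0 al0m;
    have := cnt2 _ _ _ _ _ _ tB Yal0 al0m; lia.
have zz al : Y al -> al z' = al m (+) al z.
  move=> Yal; have := @char_odd Y (z ** z') true YG ntm _ al Yal.
  rewrite (charM YG) //= => <-; first by case: (al z); case: (al z').
  move=> {Yal}al Yal alm; have := cnt _ Yal alm; rewrite (charM YG) //.
  have := cnt3 _ _ _ _ _ _ tA Yal alm; have := cnt3 _ _ _ _ _ _ tB Yal alm.
  rewrite !(charM YG Yal).
  by case: (al c); case: (al c'); case: (al z); case: (al z') => /=; lia.
have zE : eqv Y z' (m ** z) by move=> al Yal; rewrite zz // (charM YG).
apply: (@sum3_of3 _ _ _ _ _ _ c x y z c' x' y' z' (m ** c) (c ** c') (c ** c) z).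
apply: weq_trans (weq_perm sp) _; apply: weq_sym.
pose hyps := [:: c; m ** c] ++ [:: c ** z; m ** (c ** z)] ++ [:: c'; m ** c'].
pose e := c' ** z'; pose rest := drop 2 (flat3 c x y z) ++ drop 2 (flat3 c' x' y' z').
have hyps0 : weq hyps [::].
  exact: weq_cat (weq_hyp c) (weq_cat (weq_hyp (c ** z)) (weq_hyp c')).
apply: (@weq_trans _ _ _ _ _ _ ([:: e; e] ++
    (hyps ++ [:: e; m ** c; m ** (c ** z); m ** c'] ++ rest))).
  rewrite catA; apply: (@weq_trans _ _ _ _ _ _ ((flat3 c x y z ++ flat3 c' x' y' z') ++
    [:: m ** c; m ** (c ** z); m ** c'; e; m ** c; m ** (c ** z); m ** c'; e])).
    apply: weq_cat weq_refl _; apply: weq_same.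
    by rewrite /e; do ?split => //; char_tac YG.
  by apply: weq_perm; rewrite /hyps /rest /e /=; perm_by.
apply: weq_trans (weq_cat (weq_dbl e l2) weq_refl) _.
apply: (@weq_trans _ _ _ _ _ _ (hyps ++ [:: e; m ** e] ++
    [:: m ** c; m ** (c ** z); m ** c'; m ** e] ++ rest)).
  by apply: weq_perm; rewrite /hyps /rest /=; perm_by.
apply: weq_trans (weq_cat hyps0 (weq_cat (weq_hyp e) weq_refl)) _.
apply: (@weq_perm_same _ _ _ _ _ _ ((m ** c :: m ** (c ** z) :: drop 2 (flat3 c x y z)) ++
  (m ** c' :: m ** e :: drop 2 (flat3 c' x' y' z')))).
  by rewrite /rest /=; perm_by.
by apply: same_cat; exact: same_sym.
Qed.

Lemma triv_kill2 u z a : triv (kill (kill Y u) z) a ->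
  [\/ triv Y a, triv Y (u ** a), triv Y (z ** a) | triv Y (u ** (z ** a))].
Proof.
have GG := kill_group u YG.
by case/(triv_kill GG); case/(triv_kill YG) => h;
  [apply: Or41|apply: Or42|apply: Or43|apply: Or44].
Qed.

Lemma perm_swap2 a b : perm_eq [:: a; b] [:: b; a].
Proof. by perm_by. Qed.

(** A pair of ratio [w] may be read in both directions; choosing the directions
    removes the factors [u] and [z] from a relation. *)
Lemma adjust_pairs u z x b b' f f' : eqv Y b' (u ** b) -> eqv Y f' (z ** f) ->
    triv (kill (kill Y u) z) (x ** b ** f) ->
  exists b1 b2 f1 f2, [/\ perm_eq [:: b; b'] [:: b1; b2],
    perm_eq [:: f; f'] [:: f1; f2], eqv Y b2 (u ** b1), eqv Y f2 (z ** f1) &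
    triv Y (x ** b1 ** f1)].
Proof.
move=> bb ff /triv_kill2[] t.
- by exists b, b', f, f'.
- exists b', b, f, f'; split=> //; first exact: perm_swap2; first by char_tac YG.
  move=> al Yal; have := t al Yal; rewrite !(charM YG) // (bb _ Yal) (charM YG) //.
  by case: (al u); case: (al x); case: (al b); case: (al f).
- exists b, b', f', f; split=> //; first exact: perm_swap2; first by char_tac YG.
  move=> al Yal; have := t al Yal; rewrite !(charM YG) // (ff _ Yal) (charM YG) //.
  by case: (al z); case: (al x); case: (al b); case: (al f).
- exists b', b, f', f; split; [exact: perm_swap2|exact: perm_swap2| | |].
  + by char_tac YG.
  + by char_tac YG.
  move=> al Yal; have := t al Yal; rewrite !(charM YG) // (bb _ Yal) (ff _ Yal).
  rewrite !(charM YG) //.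
  by case: (al u); case: (al z); case: (al x); case: (al b); case: (al f).
Qed.

Lemma adjust_pair z x h h' : eqv Y h' (m ** z ** h) ->
    triv (kill (kill Y m) z) (x ** h) ->
  exists h1 h2, [/\ perm_eq [:: h; h'] [:: h1; h2], eqv Y h2 (m ** z ** h1) &
    triv Y (x ** h1) \/ triv Y (m ** (x ** h1))].
Proof.
move=> hh /triv_kill2[] t.
- by exists h, h'; split=> //; left.
- by exists h, h'; split=> //; right.
- exists h', h; split; [exact: perm_swap2|by char_tac YG|right].
  move=> al Yal; have := t al Yal; rewrite !(charM YG) // (hh _ Yal) !(charM YG) //.
  by case: (al m); case: (al z); case: (al x); case: (al h).
- exists h', h; split; [exact: perm_swap2|by char_tac YG|left].
  move=> al Yal; have := t al Yal; rewrite !(charM YG) // (hh _ Yal) !(charM YG) //.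
  by case: (al m); case: (al z); case: (al x); case: (al h).
Qed.

(** The choice of the direction is invisible to the characters that vanish at the
    ratio. *)
Lemma adjust_char w h h' h1 h2 al : Y al -> al w = false ->
    eqv Y h' (w ** h) -> eqv Y h2 (w ** h1) ->
  perm_eq [:: h; h'] [:: h1; h2] -> al h = al h1.
Proof.
move=> Yal alw hh hh1 /seq.permP/(_ al) /=.
rewrite (hh _ Yal) (hh1 _ Yal) !(charM YG) // alw /=.
by case: (al h); case: (al h1).
Qed.

(** The list on the right is
    [a <<-u, x>> + c <<u, xz>> + e <<-x, -z>> + d <<-xu, z>>]. The three flats add
    [-d] times the first three 2-fold forms, and the sum of the four 2-fold forms
    is 4, which vanishes when doubled entries may change sign. *)
Lemma cross_identity a c e d u z x :
  weq (flat3 a (m ** a ** d) u (m ** x) ++ flat3 c (m ** c ** d) (m ** u) (m ** x ** z) ++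
       flat3 e (m ** e ** d) z x)
    ([:: a; u ** a; m ** x ** a; u ** (m ** x ** a)] ++
     [:: c; m ** u ** c; m ** z ** x ** c; m ** u ** (m ** z ** x ** c)] ++
     [:: e; z ** e; x ** e; z ** (x ** e)] ++
     [:: d; m ** z ** d; u ** x ** d; m ** z ** (u ** x ** d)]).
Proof.
pose blocks := [:: a; u ** a; m ** x ** a; u ** (m ** x ** a)] ++
     [:: c; m ** u ** c; m ** z ** x ** c; m ** u ** (m ** z ** x ** c)] ++
     [:: e; z ** e; x ** e; z ** (x ** e)].
pose tl := [:: m ** z ** d; u ** x ** d; m ** z ** (u ** x ** d)].
pose hyp b := [:: b; m ** b].
apply: (@weq_trans _ _ _ _ _ _ ([:: m ** d; m ** d] ++ (hyp (u ** d) ++ hyp (x ** d) ++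
  hyp (x ** z ** d) ++ [:: m ** d] ++ blocks ++ tl))).
  apply: (@weq_trans _ _ _ _ _ _ (
    [:: a; m ** x ** a; m ** d; x ** d; u ** a; u ** (m ** x ** a); m ** (u ** d);
        u ** x ** d] ++
    [:: c; m ** z ** x ** c; m ** d; x ** z ** d; m ** u ** c;
        m ** u ** (m ** z ** x ** c); u ** d; m ** z ** (u ** x ** d)] ++
    [:: e; x ** e; m ** d; m ** (x ** d); z ** e; z ** (x ** e); m ** z ** d;
        m ** (x ** z ** d)])).
    apply: weq_same; apply: same_cat; [|apply: same_cat];
      by do ?split => //; char_tac YG.
  by apply: weq_perm; rewrite /blocks /tl /hyp /=; perm_by.
apply: weq_trans (weq_cat (weq_sym (weq_dbl d l2)) (weq_cat (weq_hyp _)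
  (weq_cat (weq_hyp _) (weq_cat (weq_hyp _) weq_refl)))) _.
apply: (@weq_trans _ _ _ _ _ _ (hyp d ++ ([:: d] ++ blocks ++ tl))).
  by apply: weq_perm; rewrite /hyp /=; perm_by.
apply: weq_trans (weq_cat (weq_hyp d) weq_refl) _.
by apply: weq_perm; rewrite /blocks /tl /=; perm_by.
Qed.

Lemma perm_ratio_ntriv w ps r : pairs_ratio (kill Y m) w ps -> 0 < size ps ->
  perm_eq s (flatten_pairs ps ++ r) -> ~ triv (kill Y m) w.
Proof.
case: ps => [|[a b] ps] // /pairs_ratio_cons[/= ab _] _ sp.
apply: (@ratio_ntriv w a b (flatten_pairs ps ++ r)) ab.
by apply: perm_trans sp _; rewrite /flatten_pairs; perm_by.
Qed.

Section Cross.

Variables (u z : V).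
Hypotheses (ntu : ~ triv (kill Y m) u) (ntz : ~ triv (kill Y m) z).
Hypothesis ntuz : ~ triv (kill Y m) (u ** z).

(** The element [-1] is independent of [u] and [z], whatever signs these carry. *)
Lemma ex_char2 u' z' : u' = u \/ u' = m ** u -> z' = z \/ z' = m ** z ->
  ~ triv (kill (kill Y u') z') m.
Proof.
move=> hu hz.
have [uE zE] : (forall al, Y al -> al m = false -> al u' = al u) /\
    (forall al, Y al -> al m = false -> al z' = al z).
  by split=> al Yal alm; [case: hu|case: hz] => ->; rewrite ?(charM YG) ?alm.
have GG := kill_group u' YG.
case/(triv_kill GG); case/(triv_kill YG) => // h.
- by apply: ntu => al [Yal alm]; have := h al Yal; rewrite (charM YG) // alm addbF uE.
- by apply: ntz => al [Yal alm]; have := h al Yal; rewrite (charM YG) // alm addbF zE.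
- apply: ntuz => al [Yal alm]; have := h al Yal.
  by rewrite !(charM YG) // alm addbF uE // zE.
Qed.

Variables (ps1 ps2 qs1 qs2 : seq (V * V)).
Hypotheses (r1 : pairs_ratio Y u ps1) (r2 : pairs_ratio Y (m ** u) ps2).
Hypotheses (q1 : pairs_ratio Y z qs1) (q2 : pairs_ratio Y (m ** z) qs2).
Hypotheses (szp : size ps1 + size ps2 = 4) (szq : size qs1 + size qs2 = 4).
Hypothesis sp : perm_eq s (flatten_pairs ps1 ++ flatten_pairs ps2 ++
  flatten_pairs qs1 ++ flatten_pairs qs2).

(** At a character with given values on [u] and [z], the pairs of the ratios that
    are mapped to [-1] cancel and the others count twice. *)
Lemma cross_count al : Y al -> al m = true ->
  (6 * ((if al u then size ps1 + 2 * count al (unzip1 ps2)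
         else 2 * count al (unzip1 ps1) + size ps2) +
        (if al z then size qs1 + 2 * count al (unzip1 qs2)
         else 2 * count al (unzip1 qs1) + size qs2))) %% 8 = 4.
Proof.
move=> Yal alm; have := sgn4 Yal alm; rewrite (seq.permP sp) (count_cat _ (flatten_pairs ps1)).
rewrite (count_cat _ (flatten_pairs ps2)) (count_cat _ (flatten_pairs qs1)).
rewrite (count_ratio r1) // (count_ratio r2) // (count_ratio q1) //.
rewrite (count_ratio q2) // !(charM YG) // alm.
by case: (al u); case: (al z); rewrite /= -!mul2n; lia.
Qed.

Lemma cross_count00 al : kill (kill Y u) z al -> al m = true ->
  (6 * (2 * count al (unzip1 ps1) + size ps2 +
        (2 * count al (unzip1 qs1) + size qs2))) %% 8 = 4.
Proof. by move=> [[Yal alu] alz] alm; have := cross_count Yal alm; rewrite alu alz. Qed.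

Lemma cross_count01 al : kill (kill Y u) (m ** z) al -> al m = true ->
  (6 * (2 * count al (unzip1 ps1) + size ps2 +
        (size qs1 + 2 * count al (unzip1 qs2)))) %% 8 = 4.
Proof.
move=> [[Yal alu] alz] alm; have := cross_count Yal alm; rewrite alu.
by move: alz; rewrite (charM YG) // alm; case: (al z).
Qed.

Lemma cross_count10 al : kill (kill Y (m ** u)) z al -> al m = true ->
  (6 * (size ps1 + 2 * count al (unzip1 ps2) +
        (2 * count al (unzip1 qs1) + size qs2))) %% 8 = 4.
Proof.
move=> [[Yal alu] alz] alm; have := cross_count Yal alm; rewrite alz.
by move: alu; rewrite (charM YG) // alm; case: (al u).
Qed.

Lemma cross_count11 al : kill (kill Y (m ** u)) (m ** z) al -> al m = true ->
  (6 * (size ps1 + 2 * count al (unzip1 ps2) +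
        (size qs1 + 2 * count al (unzip1 qs2)))) %% 8 = 4.
Proof.
move=> [[Yal alu] alz] alm; have := cross_count Yal alm.
by move: alu alz; rewrite !(charM YG) // alm; case: (al u); case: (al z).
Qed.

Hypothesis prodq : forall al, Y al -> al m = false -> al z = false ->
  odd (count al (unzip1 qs1 ++ unzip1 qs2)) = al u.

Lemma ex_char2W u' z' : u' = u \/ u' = m ** u -> z' = z \/ z' = m ** z ->
  exists2 al, kill (kill Y u') z' al & al m = true.
Proof.
move=> hu hz; apply: contrapT => h; apply: (ex_char2 hu hz) => al Gal.
by case alm: (al m) => //; case: h; exists al.
Qed.

Lemma cross_parity : ~~ odd (size ps2 + size qs2).
Proof.
have [||al Gal alm] := @ex_char2W u z; [by left|by left|].
by have := cross_count00 Gal alm; lia.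
Qed.

Lemma cross_0_0 : size ps2 = 0 -> size qs2 = 0 -> False.
Proof.
move=> p0 q0; have [||al Gal alm] := @ex_char2W (m ** u) (m ** z); [by right|by right|].
have := cross_count11 Gal alm; rewrite (size0nil p0) (size0nil q0) /=; lia.
Qed.

(** One pair of each exceptional kind would make two entries equal up to sign. *)
Lemma cross_1_1 : size ps2 = 1 -> size qs2 = 1 -> False.
Proof.
move=> p1 q1'; have GG := kill_group (m ** z) (kill_group (m ** u) YG).
case: ps2 p1 r2 sp cross_count11 szp => [|[a a'] []] // _ + + cnt szp'.
move=> /pairs_ratio_cons[/= aa _].
case: qs2 q1' q2 cnt szq => [|[r r'] []] // _ + cnt szq' sp'.
move=> /pairs_ratio_cons[/= rr _].
have /triv_kill2 : triv (kill (kill Y (m ** u)) (m ** z)) (a ** r).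
  move=> al Gal; apply: (@char_odd _ _ false GG _ _ al Gal).
    by apply: ex_char2; right.
  move=> {Gal}be Gbe bem; have := cnt be Gbe bem; rewrite (charM GG) //=.
  by move: szp' szq'; rewrite /=; case: (be a); case: (be r); lia.
have spP : perm_eq s [:: a, r, a', r' & flatten_pairs ps1 ++ flatten_pairs qs1].
  by apply: perm_trans sp' _; rewrite /flatten_pairs /=; perm_by.
case=> h.
- by apply: (distinct spP) => al [Yal _]; exact: h.
- apply: (@distinct a' r [:: a, r' & flatten_pairs ps1 ++ flatten_pairs qs1]).
    by apply: perm_trans spP _; perm_by.
  move=> al [Yal _]; have := h al Yal; rewrite !(charM YG) // (aa _ Yal).
  by rewrite !(charM YG) // !addbA.
- apply: (@distinct a r' [:: a', r & flatten_pairs ps1 ++ flatten_pairs qs1]).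
    by apply: perm_trans spP _; perm_by.
  move=> al [Yal _]; have := h al Yal; rewrite !(charM YG) // (rr _ Yal).
  rewrite !(charM YG) //.
  by case: (al m); case: (al z); case: (al a); case: (al r).
- apply: (@distinct a' r' [:: a, r & flatten_pairs ps1 ++ flatten_pairs qs1]).
    by apply: perm_trans spP _; perm_by.
  move=> al [Yal _]; have := h al Yal; rewrite !(charM YG) // (aa _ Yal) (rr _ Yal).
  rewrite !(charM YG) //.
  by case: (al m); case: (al z); case: (al u); case: (al a); case: (al r).
Qed.

(** The two signature conditions give two relations between the entries of the
    second family; their product contradicts its discriminant. *)
Lemma cross_0_2 : size ps2 = 0 -> size qs2 = 2 -> False.
Proof.
move=> p0 q2'; have p1 : size ps1 = 4 by lia.
have q1' : size qs1 = 2 by lia.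
have GG0 := kill_group z (kill_group (m ** u) YG).
have GG1 := kill_group (m ** z) (kill_group (m ** u) YG).
have := cross_count10; have := cross_count11; rewrite p1 q1' q2' (size0nil p0) /=.
case: qs1 q1' q1 sp prodq => [|[a a'] [|[b b'] []]] // _ +.
move=> /pairs_ratio_cons[/= aa] /pairs_ratio_cons[/= bb _].
case: qs2 q2' q2 => [|[c c'] [|[d d'] []]] // _ +.
move=> /pairs_ratio_cons[/= cc] /pairs_ratio_cons[/= dd _] sp' prod cnt11 cnt10.
have spP : perm_eq s ([:: a; b; a'; b'; c; d; c'; d'] ++ flatten_pairs ps1).
  apply: perm_trans sp' _; rewrite (size0nil p0) /flatten_pairs /=; perm_by.
have abE al : Y al -> al m = false -> al (a ** b) = al u \/ al (a ** b) = al u (+) al z.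
  have /triv_kill2 : triv (kill (kill Y (m ** u)) z) (a ** b).
    move=> be Gbe; apply: (@char_odd _ _ false GG0 _ _ be Gbe).
      by apply: ex_char2; [right|left].
    move=> {Gbe}be Gbe bem; have := cnt10 be Gbe bem; rewrite (charM GG0) //=.
    by case: (be a); case: (be b); lia.
  move=> + Yal alm; case=> h.
  - case: (@distinct a b ([:: a'; b'; c; d; c'; d'] ++ flatten_pairs ps1) spP).
    by move=> be [Ybe _]; exact: h.
  - by left; have := h al Yal; rewrite !(charM YG) // alm; case: (al u); case: (al a); case: (al b).
  - case: (@distinct a' b ([:: a; b'; c; d; c'; d'] ++ flatten_pairs ps1)).
      by apply: perm_trans spP _; perm_by.
    by move=> be [Ybe _]; have := h be Ybe; rewrite !(charM YG) // (aa _ Ybe) !(charM YG) // addbA.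
  - right; have := h al Yal; rewrite !(charM YG) // alm.
    by case: (al u); case: (al z); case: (al a); case: (al b).
have cdE al : Y al -> al m = false -> al (c ** d) = al u \/ al (c ** d) = al u (+) al z.
  have /triv_kill2 : triv (kill (kill Y (m ** u)) (m ** z)) (c ** d).
    move=> be Gbe; apply: (@char_odd _ _ false GG1 _ _ be Gbe).
      by apply: ex_char2; right.
    move=> {Gbe}be Gbe bem; have := cnt11 be Gbe bem; rewrite (charM GG1) //=.
    by case: (be c); case: (be d); lia.
  move=> + Yal alm; case=> h.
  - case: (@distinct c d ([:: a; b; a'; b'; c'; d'] ++ flatten_pairs ps1)).
      by apply: perm_trans spP _; perm_by.
    by move=> be [Ybe _]; exact: h.
  - by left; have := h al Yal; rewrite !(charM YG) // alm; case: (al u); case: (al c); case: (al d).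
  - case: (@distinct c' d ([:: a; b; a'; b'; c; d'] ++ flatten_pairs ps1)).
      by apply: perm_trans spP _; perm_by.
    move=> be [Ybe _]; have := h be Ybe; rewrite !(charM YG) // (cc _ Ybe) !(charM YG) //.
    by rewrite !addbA.
  - right; have := h al Yal; rewrite !(charM YG) // alm.
    by case: (al u); case: (al z); case: (al c); case: (al d).
have /(triv_kill (kill_group m YG)) : triv (kill (kill Y m) z) u.
  move=> al [[Yal alm] alz]; have := prod al Yal alm alz.
  move: (abE al Yal alm) (cdE al Yal alm); rewrite alz addbF !(charM YG) //= .
  case: (al u) => //=; case: (al a); case: (al b); case: (al c); case: (al d);
    by move=> [] // _ [].
case=> // h; apply: ntuz => al Gal; have := h al Gal; case: Gal => Yal alm.
by rewrite !(charM YG) // addbC.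
Qed.

(** The four signature conditions determine the signs in the discriminants of
    the four families of two pairs, and the list becomes that of
    [cross_identity]. *)
Lemma cross_2_2 : size ps2 = 2 -> size qs2 = 2 ->
  (forall al, Y al -> al m = false -> al u = false ->
    odd (count al (unzip1 ps1 ++ unzip1 ps2)) = al z) -> sum3 s.
Proof.
move=> p2 q2' prodp; have p1 : size ps1 = 2 by lia.
have q1' : size qs1 = 2 by lia.
have GG00 := kill_group z (kill_group u YG).
have GG01 := kill_group (m ** z) (kill_group u YG).
have GG10 := kill_group z (kill_group (m ** u) YG).
have ex00 : ~ triv (kill (kill Y u) z) m by apply: ex_char2; left.
have [al01 al01G al01m] : exists2 al, kill (kill Y u) (m ** z) al & al m = true.
  by apply: ex_char2W; [left|right].
have [al10 al10G al10m] : exists2 al, kill (kill Y (m ** u)) z al & al m = true.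
  by apply: ex_char2W; [right|left].
have := cross_count00; have := cross_count01 al01G al01m.
have := cross_count10 al10G al10m; rewrite p1 p2 q1' q2'.
move: prodp; case: ps1 p1 r1 sp => [|[a a'] [|[b b'] []]] // _ +.
move=> /pairs_ratio_cons[/= aa] /pairs_ratio_cons[/= bb _].
case: ps2 p2 r2 => [|[c c'] [|[d d'] []]] // _ +.
move=> /pairs_ratio_cons[/= cc] /pairs_ratio_cons[/= dd _].
move: prodq; case: qs1 q1' q1 => [|[e e'] [|[f f'] []]] // _ +.
move=> /pairs_ratio_cons[/= ee] /pairs_ratio_cons[/= ff _].
case: qs2 q2' q2 => [|[g g'] [|[h h'] []]] // _ +.
move=> /pairs_ratio_cons[/= gg] /pairs_ratio_cons[/= hh _].
move=> prodq' sp' prodp cnt10 cnt01 cnt00.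
have [b1 [b2 [f1 [f2 [bP fP bb1 ff1 bt]]]]] : exists b1 b2 f1 f2,
    [/\ perm_eq [:: b; b'] [:: b1; b2], perm_eq [:: f; f'] [:: f1; f2],
     eqv Y b2 (u ** b1), eqv Y f2 (z ** f1) & triv Y (m ** a ** e ** b1 ** f1)].
  apply: (adjust_pairs bb ff) => al Gal.
  have := @char_odd _ (a ** b ** e ** f) true GG00 ex00 _ al Gal.
  rewrite !(charM GG00) //= => <-.
    by case: (al a); case: (al b); case: (al e); case: (al f).
  move=> {Gal}be Gbe bem; have := cnt00 be Gbe bem; rewrite /= !(charM GG00) //.
  by case: (be a); case: (be b); case: (be e); case: (be f).
have bE : eqv Y b1 (m ** a ** (e ** f1)).
  move=> al Yal; have := bt al Yal; rewrite !(charM YG) //.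
  by case: (al m); case: (al a); case: (al e); case: (al b1); case: (al f1).
have [h1 [h2 [hP hh1 ht]]] : exists h1 h2, [/\ perm_eq [:: h; h'] [:: h1; h2],
    eqv Y h2 (m ** z ** h1) &
    triv Y (u ** e ** f1 ** g ** h1) \/ triv Y (m ** (u ** e ** f1 ** g ** h1))].
  apply: (adjust_pair hh) => al [[Yal alm] alz]; have := prodq' al Yal alm alz.
  rewrite !(charM YG) //= -(adjust_char Yal alz ff ff1 fP) => <-.
  by case: (al e); case: (al f); case: (al g); case: (al h).
have hE : eqv Y h1 (u ** (e ** f1) ** g).
  case: ht => t al Yal.
    have := t al Yal; rewrite !(charM YG) //.
    by case: (al u); case: (al e); case: (al f1); case: (al g); case: (al h1).
  exfalso; case: al01G cnt01 => -[Y0 al01u] al01z.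
  rewrite (adjust_char Y0 al01z hh hh1 hP) (adjust_char Y0 al01u bb bb1 bP).
  move: (t _ Y0); rewrite (bE _ Y0) !(charM YG) // al01m al01u.
  by case: (al01 a); case: (al01 e); case: (al01 f1); case: (al01 g); case: (al01 h1).
have [d1 [d2 [dP dd1 dt]]] : exists d1 d2, [/\ perm_eq [:: d; d'] [:: d1; d2],
    eqv Y d2 (m ** u ** d1) &
    triv Y (z ** a ** b1 ** c ** d1) \/ triv Y (m ** (z ** a ** b1 ** c ** d1))].
  apply: (adjust_pair dd) => al [[Yal alm] alu]; have := prodp al Yal alm alu.
  rewrite !(charM YG) //= -(adjust_char Yal alu bb bb1 bP) => <-.
  by case: (al a); case: (al b); case: (al c); case: (al d).
have dE : eqv Y d1 (m ** z ** (e ** f1) ** c).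
  case: dt => t al Yal.
    have := t al Yal; have := bE al Yal; rewrite !(charM YG) // => ->.
    by case: (al m); case: (al z); case: (al e); case: (al f1); case: (al a);
      case: (al c); case: (al d1).
  exfalso; case: al10G cnt10 => -[Y0 al10u] al10z.
  rewrite (adjust_char Y0 al10u dd dd1 dP) (adjust_char Y0 al10z ff ff1 fP).
  move: (t _ Y0); rewrite !(charM YG) // (bE _ Y0) !(charM YG) // al10m al10z.
  by case: (al10 a); case: (al10 e); case: (al10 f1); case: (al10 c); case: (al10 d1).
apply: sum3_of3; apply: weq_trans (weq_sym (cross_identity a c e g u z (e ** f1))).
apply: (@weq_perm_same _ _ _ _ _ _ ([:: a; a'; b1; b2] ++ [:: c; c'; d1; d2] ++
  [:: e; e'; f1; f2] ++ [:: g; g'; h1; h2])).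
  apply: perm_trans sp' _; rewrite /flatten_pairs /=.
  by clear -bP fP hP dP; perm_by.
by do ?split => //; char_tac YG.
Qed.


End Cross.

Lemma cross_core u z ps1 ps2 qs1 qs2 : ~ triv (kill Y m) u -> ~ triv (kill Y m) z ->
    ~ triv (kill Y m) (u ** z) ->
    pairs_ratio Y u ps1 -> pairs_ratio Y (m ** u) ps2 ->
    pairs_ratio Y z qs1 -> pairs_ratio Y (m ** z) qs2 ->
    size ps1 + size ps2 = 4 -> size qs1 + size qs2 = 4 ->
    perm_eq s (flatten_pairs ps1 ++ flatten_pairs ps2 ++
               flatten_pairs qs1 ++ flatten_pairs qs2) ->
    (forall al, Y al -> al m = false -> al u = false ->
      odd (count al (unzip1 ps1 ++ unzip1 ps2)) = al z) ->
    (forall al, Y al -> al m = false -> al z = false ->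
      odd (count al (unzip1 qs1 ++ unzip1 qs2)) = al u) ->
  size ps2 <= size ps1 -> size qs2 <= size qs1 -> sum3 s.
Proof.
move=> ntu ntz ntuz r1 r2 q1 q2 szp szq sp prodp prodq lep leq.
have ev := cross_parity ntu ntz ntuz r1 r2 q1 q2 szp szq sp.
have ntzu : ~ triv (kill Y m) (z ** u).
  move=> h; apply: ntuz => al Gal; have := h al Gal; case: Gal => Yal _.
  by rewrite !(charM YG) // addbC.
have sp' : perm_eq s (flatten_pairs qs1 ++ flatten_pairs qs2 ++
               flatten_pairs ps1 ++ flatten_pairs ps2).
  by apply: perm_trans sp _; clear; perm_by.
case p2: (size ps2) ev => [|[|[|k]]]; case q2': (size qs2) => [|[|[|l]]] // _; try lia.
- by case: (cross_0_0 ntu ntz ntuz r1 r2 q1 q2 szp szq sp p2 q2').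
- by case: (cross_0_2 ntu ntz ntuz r1 r2 q1 q2 szp szq sp prodq p2 q2').
- by case: (cross_1_1 ntu ntz ntuz r1 r2 q1 q2 szp szq sp p2 q2').
- by case: (cross_0_2 ntz ntu ntzu q1 q2 r1 r2 szq szp sp' prodp q2' p2).
- exact: (cross_2_2 ntu ntz ntuz r1 r2 q1 q2 szp szq sp prodq p2 q2' prodp).
Qed.

(** The list consists of four pairs of ratio [u] and four pairs of ratio [z] up
    to sign; exchanging [u] with [-u] and [z] with [-z], one may assume that the
    pairs with the wrong sign are not in the majority. *)
Lemma sum3_cross u z ps qs : pairs_ratio (kill Y m) u ps -> pairs_ratio (kill Y m) z qs ->
    size ps = 4 -> size qs = 4 -> perm_eq s (flatten_pairs ps ++ flatten_pairs qs) ->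
    (forall al, Y al -> al m = false -> al u = false ->
      odd (count al (unzip1 ps)) = al z) ->
    (forall al, Y al -> al m = false -> al z = false ->
      odd (count al (unzip1 qs)) = al u) ->
  ~ triv (kill Y m) (u ** z) -> sum3 s.
Proof.
move=> psu qsz szp szq sp prodp prodq ntuz.
have ntu : ~ triv (kill Y m) u by apply: (perm_ratio_ntriv psu _ sp); rewrite szp.
have ntz : ~ triv (kill Y m) z.
  apply: (@perm_ratio_ntriv _ _ (flatten_pairs ps) qsz); first by rewrite szq.
  by apply: perm_trans sp _; clear; perm_by.
have [ps1 [ps2 [pE pE1 r1 r2 sE]]] := pairs_split YG psu.
have [qs1 [qs2 [qE qE1 q1 q2 sE']]] := pairs_split YG qsz.
have {pE qE}sp' : perm_eq s (flatten_pairs ps1 ++ flatten_pairs ps2 ++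
    flatten_pairs qs1 ++ flatten_pairs qs2).
  by apply: perm_trans sp _; clear -pE qE; perm_by.
have {pE1}prodp1 al : Y al -> al m = false -> al u = false ->
    odd (count al (unzip1 ps1 ++ unzip1 ps2)) = al z.
  by move=> Yal alm alu; rewrite -(seq.permP pE1) prodp.
have {qE1}prodq1 al : Y al -> al m = false -> al z = false ->
    odd (count al (unzip1 qs1 ++ unzip1 qs2)) = al u.
  by move=> Yal alm alz; rewrite -(seq.permP qE1) prodq.
have neg (w : V) : ~ triv (kill Y m) w -> ~ triv (kill Y m) (m ** w).
  move=> h k; apply: h => al Gal; have := k al Gal; case: Gal => Yal alm.
  by rewrite (charM YG) // alm.
have negl (w w' : V) : ~ triv (kill Y m) (w ** w') -> ~ triv (kill Y m) (m ** w ** w').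
  move=> h k; apply: h => al Gal; have := k al Gal; case: Gal => Yal alm.
  by rewrite !(charM YG) // alm.
have negr (w w' : V) : ~ triv (kill Y m) (w ** w') -> ~ triv (kill Y m) (w ** (m ** w')).
  move=> h k; apply: h => al Gal; have := k al Gal; case: Gal => Yal alm.
  by rewrite !(charM YG) // alm.
have swap (t t' : seq V) al : count al (t' ++ t) = count al (t ++ t').
  by rewrite !count_cat addnC.
have [lep|lep] := leqP (size ps2) (size ps1); have [leq|leq] := leqP (size qs2) (size qs1).
- apply: (cross_core ntu ntz ntuz r1 r2 q1 q2 _ _ sp' prodp1 prodq1 lep leq); lia.
- apply: (cross_core ntu (neg _ ntz) (negr _ _ ntuz) r1 r2 q2 (ratio_neg q1)
    _ _ _ _ _ lep (ltnW leq)); try lia.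
  + by apply: perm_trans sp' _; clear; perm_by.
  + by move=> al Yal alm alu; rewrite prodp1 // (charM YG) // alm.
  + move=> al Yal alm; rewrite (charM YG) // alm => alz.
    by rewrite swap prodq1.
- apply: (cross_core (neg _ ntu) ntz (negl _ _ ntuz) r2 (ratio_neg r1) q1 q2
    _ _ _ _ _ (ltnW lep) leq); try lia.
  + by apply: perm_trans sp' _; clear; perm_by.
  + move=> al Yal alm; rewrite (charM YG) // alm => alz.
    by rewrite swap prodp1.
  + by move=> al Yal alm alu; rewrite prodq1 // (charM YG) // alm.
- apply: (cross_core (neg _ ntu) (neg _ ntz) (negl _ _ (negr _ _ ntuz)) r2 (ratio_neg r1)
    q2 (ratio_neg q1) _ _ _ _ _ (ltnW lep) (ltnW leq)); try lia.
  + by apply: perm_trans sp' _; clear; perm_by.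
  + move=> al Yal alm; rewrite (charM YG) // alm => alz.
    by rewrite swap prodp1 // (charM YG) // alm.
  + move=> al Yal alm; rewrite (charM YG) // alm => alz.
    by rewrite swap prodq1 // (charM YG) // alm.
Qed.

(** The structure of lists of size 16 is applied to the quotient by [-1]. Four
    pairs and a flat twisted along an edge of direction [z] form a cross: the
    entries of the flat, twisted or not, are four pairs of ratio [z]. *)
Lemma sum3_level2 : sum3 s.
Proof.
have GG := kill_group m YG.
have [w [ps [t [st psw tA cs]]]] := aniso_size16 GG sA sT s16.
case: cs => -[psn tE].
  by subst t; rewrite cats0 in st; exact: sum3_eight psw st psn.
have [|c [x [y [z [t' [tt ty]]]]]] := residue8_type GG sA sT st psw _ tE.
  by rewrite psn.
have {}st : perm_eq s (flatten_pairs ps ++ t').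
  by apply: perm_trans st _; clear -tt; perm_by.
case: ty; rewrite psn => -[ty //= _ rho].
  apply: sum3_flats st; last by exists c, x, y, z, t'; split.
  apply: (pairs4_is_flat GG psw psn) => al [Yal alm] alw.
  exact: rho al (conj Yal alm) alw.
have {}tA : aniso (kill (kill Y m) (m ** w)) t' by exact: aniso_perm tt tA.
case: t' ty {tt} st tA => [|t0 [|t1 [|t2 [|t3 [|t4 [|t5 [|t6 [|t7 []]]]]]]]];
  try by move=> /=; tauto.
move=> /= [h0 [h1 [h2 [h3 [h4 [h5 [h6 [h7 _]]]]]]]] st tA.
pose qs := [:: (t0, t1); (t2, t3); (t4, t5); (t6, t7)].
apply: (@sum3_cross w z ps qs psw) => //.
- by do 4?[apply/pairs_ratio_cons; split=> /=]; try char_tac GG.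
- by apply: perm_trans st _; rewrite /flatten_pairs /=; clear; perm_by.
- move=> al Yal alm alw; have := rho al (conj Yal alm) alw.
  rewrite count_cat oddD /= !(charM YG) // alm ?andbF /=.
  by case: (odd (count _ _)); case: (al c); case: (al z).
- move=> al Yal alm alz; have Gal : kill Y m al by split.
  rewrite /= (h0 _ Gal) (h2 _ Gal) (h4 _ Gal) (h6 _ Gal) !(charM YG) // alm.
  by case: (al w); case: (al c); case: (al x); case: (al y).
move=> wz; apply: (tA t0 t1 [:: t2; t3; t4; t5; t6; t7]); first exact: perm_refl.
move=> al [Gal]; have := wz al Gal; rewrite (h1 _ Gal).
case: Gal => Yal alm; rewrite !(charM YG) // (h0 _ (conj Yal alm)) !(charM YG) // alm.
by case: (al w); case: (al c); case: (al z).
Qed.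

End Level2.

(** * Isometries and diagonal forms *)

Import GRing.Theory.
Local Open Scope ring_scope.

Section Isometries.
Variable F : fieldType.
Implicit Types (q : qform F) (a b c : unitsF F) (s t r : seq (unitsF F)).

Lemma isometric_dim q1 q2 : isometric q1 q2 -> qdim q1 = qdim q2.
Proof. by case=> P [/eqP h1 /eqP h2 _]; exact: etrans (esym h1) h2. Qed.

(** Invertibility of [P] comes for free from that of the Gram matrices. *)
Lemma isometric_mx n (A B P : 'M[F]_n) (As : A^T = A) (Au : A \in unitmx)
    (Bs : B^T = B) (Bu : B \in unitmx) :
  P *m B *m P^T = A -> isometric (QForm As Au) (QForm Bs Bu).
Proof.
move=> h; exists P => /=; have : P \in unitmx.
  by move: Au; rewrite -h !unitmx_mul => /andP[/andP[]].
by rewrite -row_free_unit => Pf; split=> //; rewrite row_full_unit -row_free_unit.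
Qed.

Lemma isometric_refl q : isometric q q.
Proof. by case: q => n A As Au; apply: (@isometric_mx n A A 1%:M); rewrite mul1mx trmx1 mulmx1. Qed.

Lemma isometric_sym q1 q2 : isometric q1 q2 -> isometric q2 q1.
Proof.
move=> h; have e := isometric_dim h; case: q1 q2 e h => n A As Au [n' B Bs Bu] /= e.
subst n' => -[/= P [Pf _ h]]; apply: (@isometric_mx n B A (invmx P)).
have Pu : P \in unitmx by rewrite -row_free_unit.
rewrite -h -!mulmxA trmx_inv mulmxV ?unitmx_tr // mulmx1.
by rewrite mulmxA mulVmx // mul1mx.
Qed.

Lemma isometric_trans q1 q2 q3 :
  isometric q1 q2 -> isometric q2 q3 -> isometric q1 q3.
Proof.
move=> h h'; have e := isometric_dim h; have e' := isometric_dim h'.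
case: q1 q2 q3 e e' h h' => n A As Au [n' B Bs Bu] [n2 C Cs Cu] /= e e'.
subst n2 n' => -[/= P [_ _ h]] -[/= Q [_ _ h']].
by apply: (@isometric_mx n A C (P *m Q)); rewrite trmx_mul -h -h' !mulmxA.
Qed.

Lemma isometric_qsum q1 q2 q1' q2' : isometric q1 q1' -> isometric q2 q2' ->
  isometric (qsum q1 q2) (qsum q1' q2').
Proof.
move=> h h'; have e := isometric_dim h; have e' := isometric_dim h'.
case: q1 q2 q1' q2' e e' h h' => n A As Au [n' B Bs Bu] [n2 C Cs Cu] [n3 D Ds Du] /= e e'.
subst n2 n3 => -[/= P [_ _ h]] -[/= Q [_ _ h']].
apply: (@isometric_mx _ _ _ (block_mx P 0 0 Q)).
rewrite tr_block_mx !trmx0 !mulmx_block.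
by rewrite !(mulmx0, mul0mx, addr0, add0r) h h'.
Qed.

Lemma isometric_qtens q1 q2 q1' q2' : isometric q1 q1' -> isometric q2 q2' ->
  isometric (qtens q1 q2) (qtens q1' q2').
Proof.
move=> h h'; have e := isometric_dim h; have e' := isometric_dim h'.
case: q1 q2 q1' q2' e e' h h' => n A As Au [n' B Bs Bu] [n2 C Cs Cu] [n3 D Ds Du] /= e e'.
subst n2 n3 => -[/= P [_ _ h]] -[/= Q [_ _ h']].
apply: (@isometric_mx _ _ _ (P *t Q)) => /=.
by rewrite trmx_tens !tensmx_mul h h'.
Qed.

Lemma isometric_qscale c q1 q2 : isometric q1 q2 ->
  isometric (qscale c q1) (qscale c q2).
Proof.
case=> P [Pf Pu h]; exists P; split=> //=.
by rewrite -scalemxAr -scalemxAl h.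
Qed.

Definition umul a b : unitsF F :=
  exist _ (val a * val b) (mulf_neq0 (valP a) (valP b)).

Definition qdl s : qform F := qdiag (in_tuple s).

Lemma qdiag_val n n' (t : n.-tuple (unitsF F)) (t' : n'.-tuple (unitsF F)) :
  val t = val t' -> isometric (qdiag t) (qdiag t').
Proof.
move=> e; have n'E : n' = n by rewrite -(size_tuple t) -(size_tuple t') /= e.
subst n'; rewrite (val_inj e); exact: isometric_refl.
Qed.

Lemma qdiag_qdl n (t : n.-tuple (unitsF F)) : isometric (qdiag t) (qdl t).
Proof. exact: qdiag_val. Qed.

Lemma qsum_qdl s t : isometric (qsum (qdl s) (qdl t)) (qdl (s ++ t)).
Proof.
apply: isometric_trans (qdiag_qdl (cat_tuple (in_tuple s) (in_tuple t))).
apply: (@isometric_mx _ _ _ 1%:M); rewrite mul1mx trmx1 mulmx1 /=.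
apply/matrixP => i j; rewrite !mxE.
case: (splitP i) => i' iE; rewrite !mxE; case: (splitP j) => j' jE; rewrite !mxE.
- rewrite -!val_eqE /= iE jE; congr (_ *+ _).
  by rewrite !(tnth_nth (one_unit F)) /= nth_cat iE ltn_ord.
- by rewrite -val_eqE /= iE jE; case: eqP => // e; have := ltn_ord i'; rewrite e ltnNge leq_addr.
- by rewrite -val_eqE /= iE jE; case: eqP => // e; have := ltn_ord j'; rewrite -e ltnNge leq_addr.
- rewrite -!val_eqE /= iE jE eqn_add2l; congr (_ *+ _).
  by rewrite !(tnth_nth (one_unit F)) /= nth_cat iE ltnNge leq_addr /= addKn.
Qed.

Lemma qdl_cat s s' t t' : isometric (qdl s) (qdl s') -> isometric (qdl t) (qdl t') ->
  isometric (qdl (s ++ t)) (qdl (s' ++ t')).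
Proof.
move=> ss tt; apply: isometric_trans (isometric_sym (qsum_qdl s t)) _.
exact: isometric_trans (isometric_qsum ss tt) (qsum_qdl s' t').
Qed.

Lemma qdl_perm s t : perm_eq s t -> isometric (qdl s) (qdl t).
Proof.
move=> st; have e : size s = size t by exact: perm_size.
have st' : perm_eq (tcast e (in_tuple s)) (in_tuple t) by rewrite val_tcast.
have [p pE] := tuple_permP st'.
apply: (@isometric_trans _ (qdiag (tcast e (in_tuple s)))).
  by apply: qdiag_val; rewrite /= val_tcast.
apply: (@isometric_mx _ _ _ (perm_mx p)); apply/matrixP => i j.
have sE k : tnth (tcast e (in_tuple s)) k = tnth (in_tuple t) (p k).
  by have -> : tcast e (in_tuple s) = [tuple tnth (in_tuple t) (p i) | i < _];
    [exact: val_inj | rewrite tnth_mktuple].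
rewrite -row_permE tr_perm_mx -col_permE !mxE sE.
by rewrite (inj_eq perm_inj).
Qed.

Lemma qdl_prod s t : isometric (qtens (qdl s) (qdl t)) (qdl [seq umul a b | a <- s, b <- t]).
Proof.
pose f (k : 'I_(size s * size t)) := umul (tnth (in_tuple s) (mxtens_unindex k).1)
  (tnth (in_tuple t) (mxtens_unindex k).2).
apply: (@isometric_trans _ (qdiag [tuple f k | k < size s * size t])).
  apply: (@isometric_mx _ _ _ 1%:M); rewrite mul1mx trmx1 mulmx1 /=.
  apply/matrixP => i j.
  case: (mxtens_indexP i) => i0 i1; case: (mxtens_indexP j) => j0 j1.
  rewrite tensmxE !mxE tnth_mktuple /f mxtens_indexK /=.
  rewrite (inj_eq (can_inj (@mxtens_indexK _ _))) xpair_eqE.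
  by case: eqP; case: eqP; rewrite ?mulr1n ?mulr0n ?mul0r ?mulr0.
apply: isometric_trans (qdiag_qdl _) (qdl_perm _).
rewrite /= -[X in perm_eq _ (allpairs _ X _)](map_tnth_enum (in_tuple s)).
rewrite -[X in perm_eq _ (allpairs _ _ X)](map_tnth_enum (in_tuple t)).
rewrite /allpairs allpairs_mapl (allpairs_mapr _ (fun=> tnth (in_tuple t))).
have -> : [seq umul (tnth (in_tuple s) i) (tnth (in_tuple t) j) |
    i <- enum 'I_(size s), j <- enum 'I_(size t)] =
  map f [seq mxtens_index (i, j) | i <- enum 'I_(size s), j <- enum 'I_(size t)].
  by rewrite map_allpairs; apply: eq_allpairs => i j; rewrite /f mxtens_indexK.
apply: perm_map; apply: uniq_perm; first exact: enum_uniq.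
  apply: allpairs_uniq; rewrite ?enum_uniq // => -[x1 x2] [y1 y2] _ _ /=.
  by move/(can_inj (@mxtens_indexK _ _)).
move=> k; rewrite mem_enum; apply/esym/allpairsP.
exists (mxtens_unindex k); rewrite !mem_enum; split=> //.
by rewrite -surjective_pairing mxtens_unindexK.
Qed.

End Isometries.

(** * Binary forms and Witt cancellation *)

Section Binary.
Variable F : fieldType.
Implicit Types (q : qform F) (a b c : unitsF F) (s t r : seq (unitsF F)).

Local Notation sq := (@same_square_class F).

Lemma sq_sym a b : sq a b -> sq b a.
Proof.
case=> x e; exists x^-1; rewrite e.
have x0 : x != 0 by have := valP a; rewrite e; apply: contra => /eqP ->; rewrite expr0n mulr0.
by field.
Qed.

Lemma sq_trans a b c : sq a b -> sq b c -> sq a c.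
Proof. by move=> [x e] [y f]; exists (x * y); rewrite e f; ring. Qed.

Lemma qdl_sq a b : sq a b -> isometric (qdl [:: a]) (qdl [:: b]).
Proof.
case=> x /= e; apply: (@isometric_mx _ _ _ _ x%:M).
apply/matrixP => i j; rewrite tr_scalar_mx mul_scalar_mx mul_mx_scalar !mxE.
rewrite !ord1 !eqxx !mulr1n !(tnth_nth a) /= e; ring.
Qed.

Lemma qdl_binary a b c x y : val c = val a * x ^+ 2 + val b * y ^+ 2 ->
  isometric (qdl [:: c; umul (umul a b) c]) (qdl [:: a; b]).
Proof.
move=> /= e; pose P : 'M[F]_2 := \matrix_(i, j)
  (if i == 0 then if j == 0 then x else y
   else if j == 0 then - val b * y else val a * x).
apply: (@isometric_mx _ _ _ _ P).
apply/matrixP => i j; rewrite !mxE !big_ord_recl big_ord0 !mxE !big_ord_recl !big_ord0.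
rewrite !mxE !(tnth_nth a) /=.
case: i => [[|[|//]] ?]; case: j => [[|[|//]] ?]; rewrite /= ?e ?mulr1n ?mulr0n; ring.
Qed.

Definition hyp_list n : seq (unitsF F) :=
  flatten (nseq n [:: one_unit F; opp_unit (one_unit F)]).

Lemma hyperbolic_qdl n : isometric (hyperbolic F n) (qdl (hyp_list n)).
Proof.
rewrite /hyperbolic /qsum_family; elim: n => [|n IH].
  by rewrite big_ord0; exact: qdiag_val.
rewrite big_ord_recl; apply: isometric_trans (isometric_qsum _ IH) _.
  exact: qdiag_qdl.
by apply: isometric_trans (qsum_qdl _ _) (isometric_refl _).
Qed.

Hypothesis char2 : 2%:R != 0 :> F.

Lemma qdl_hyp a : isometric (qdl [:: a; opp_unit a]) (qdl (hyp_list 1)).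
Proof.
have a0 := valP a; rewrite /= in a0.
(* 1 = a ((1 + 1/a) / 2)^2 - a ((1 - 1/a) / 2)^2 *)
have h : val (one_unit F) = val a * ((1 + (val a)^-1) / 2%:R) ^+ 2 +
    val (opp_unit a) * ((1 - (val a)^-1) / 2%:R) ^+ 2.
  by rewrite /=; field; rewrite char2 a0.
apply: isometric_sym; apply: isometric_trans (qdl_binary h).
apply: (@qdl_cat _ [:: _] [:: _] [:: _]); first exact: isometric_refl.
apply: qdl_sq; exists (val a)^-1 => /=; field; exact: a0.
Qed.


Lemma qdl_dbl a (x y : F) : -1 = x ^+ 2 + y ^+ 2 ->
  isometric (qdl [:: opp_unit a; opp_unit a]) (qdl [:: a; a]).
Proof.
move=> e; have h : val (opp_unit a) = val a * x ^+ 2 + val a * y ^+ 2.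
  by rewrite -mulrDr -e /= mulrN1.
apply: isometric_trans (qdl_binary h).
apply: (@qdl_cat _ [:: _] [:: _] [:: _]); first exact: isometric_refl.
have a0 := valP a; rewrite /= in a0.
apply: qdl_sq; exists (val a)^-1 => /=; field; exact: a0.
Qed.

(** If [[p, r; c, M]] is an isometry from [<b> + A] to [<b> + B], then
    [M - c r / (1 + p)] is an isometry from [A] to [B]: it is the composition with
    the reflection that brings the image of the first basis vector back to
    itself, up to sign. *)
Lemma witt_cancel_mx n (A B M : 'M[F]_n) (c : 'cV_n) (r : 'rV_n) (p b : F) :
    p ^+ 2 * b + (r *m B *m r^T) 0 0 = b ->
    (p * b) *: c + M *m B *m r^T = 0 ->
    b *: (c *m c^T) + M *m B *m M^T = A -> B^T = B -> 1 + p != 0 ->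
  (M - (1 + p)^-1 *: (c *m r)) *m B *m (M - (1 + p)^-1 *: (c *m r))^T = A.
Proof.
move=> h1 h2 h3 Bs p1.
have rB : r *m B *m r^T = (b * (1 - p ^+ 2))%:M.
  apply/matrixP => i j; rewrite !ord1 [RHS]mxE eqxx mulr1n.
  by move: h1 => /(canRL (addKr _)) ->; ring.
have MB : M *m B *m r^T = - ((p * b) *: c).
  by apply/eqP; rewrite -addr_eq0 addrC h2.
have rM : r *m B *m M^T = - ((p * b) *: c^T).
  by have := congr1 trmx MB; rewrite !trmx_mul trmxK Bs mulmxA linearN linearZ.
have MM : M *m B *m M^T = A - b *: (c *m c^T).
  by rewrite -h3 addrC addKr.
set k := (1 + p)^-1.
have -> : (M - k *: (c *m r))^T = M^T - k *: (r^T *m c^T).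
  by rewrite linearB linearZ /= trmx_mul.
rewrite !mulmxBl !mulmxBr MM.
have -> : M *m B *m (k *: (r^T *m c^T)) = - (k * (p * b)) *: (c *m c^T).
  by rewrite -scalemxAr mulmxA MB mulNmx -scalemxAl scalerN scalerA scaleNr.
have -> : k *: (c *m r) *m B *m M^T = - (k * (p * b)) *: (c *m c^T).
  rewrite -!scalemxAl -(mulmxA c r B) -(mulmxA c) rM mulmxN -scalemxAr scalerN.
  by rewrite scalerA scaleNr.
have -> : k *: (c *m r) *m B *m (k *: (r^T *m c^T)) =
    (k ^+ 2 * (b * (1 - p ^+ 2))) *: (c *m c^T).
  rewrite -!scalemxAl -scalemxAr scalerA -(mulmxA c r B) -(mulmxA c).
  by rewrite (mulmxA (r *m B)) rB mul_scalar_mx -scalemxAr scalerA -expr2.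
rewrite -addrA -[LHS]addrA -[RHS]addr0; congr (_ + _).
rewrite -!scaleNr -!scalerDl -!scalerBl -!scalerDl.
by rewrite (_ : _ + _ = 0) ?scale0r // /k; field.
Qed.

(** If [1 + p = 0], the sign of the first row is changed. *)
Lemma qdiag_cancel n b (s t : n.-tuple (unitsF F)) :
  isometric (qdiag [tuple of b :: s]) (qdiag [tuple of b :: t]) ->
  isometric (qdiag s) (qdiag t).
Proof.
case=> /= P [_ _].
pose D (u : n.-tuple (unitsF F)) : 'M[F]_n := diag_mx (\row_i val (tnth u i)).
have DE (u : n.-tuple (unitsF F)) : diag_mx (\row_i val (tnth [tuple of b :: u] i)) =
    block_mx (val b)%:M 0 0 (D u) :> 'M_(1 + n).
  apply/matrixP => i j; rewrite !mxE.
  case: (splitP i) => i' iE; rewrite !mxE; case: (splitP j) => j' jE; rewrite !mxE.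
  - by rewrite !ord1 -!val_eqE /= iE jE !ord1 /= (tnth_nth b) /= iE ord1.
  - by rewrite -val_eqE /= iE jE ord1.
  - by rewrite -val_eqE /= iE jE ord1.
  - by rewrite -!val_eqE /= iE jE /= !(tnth_nth b) /= iE.
rewrite !DE; move: P.
change (forall P : 'M[F]_(1 + n), P *m block_mx (val b)%:M 0 0 (D t) *m P^T =
  block_mx (val b)%:M 0 0 (D s) -> isometric (qdiag s) (qdiag t)) => P.
rewrite -[P]submxK tr_block_mx !mulmx_block !(mulmx0, mul0mx, addr0, add0r).
set p := ulsubmx _; set r := ursubmx _; set c := dlsubmx _; set M := drsubmx _.
case/eq_block_mx => h1 _ h2 h3.
rewrite -!mulmxA !mul_scalar_mx in h1 h2 h3.
have pE : p = (p 0 0)%:M by rewrite -mx11_scalar.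
have h1' : (p 0 0) ^+ 2 * val b + (r *m D t *m r^T) 0 0 = val b.
  move: h1; rewrite {1 2}pE tr_scalar_mx -scalemxAr mul_scalar_mx !scale_scalar_mx.
  move/matrixP/(_ 0 0); rewrite mxE [X in X + _]mxE [RHS]mxE eqxx !mulr1n mulmxA => h.
  by rewrite -[RHS]h; congr (_ + _); ring.
have h2' : (p 0 0 * val b) *: c + M *m D t *m r^T = 0.
  rewrite -h2 pE tr_scalar_mx -scalemxAr mul_mx_scalar scalerA mulmxA.
  by rewrite mxE eqxx mulr1n mulrC.
have h3' : val b *: (c *m c^T) + M *m D t *m M^T = D s.
  by rewrite -h3 -scalemxAr mulmxA.
have Ds : (D t)^T = D t by exact: tr_diag_mx.
have [p1|p1] := eqVneq (1 + p 0 0) 0; last first.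
  by apply: isometric_mx; exact: (witt_cancel_mx h1' h2' h3' Ds p1).
have p2 : 1 + - p 0 0 != 0.
  apply: contra char2 => /eqP e.
  have -> : 2%:R = (1 + p 0 0) + (1 + - p 0 0) :> F by ring.
  by rewrite p1 e addr0.
have rN : (- r)^T = - r^T by rewrite linearN.
apply: isometric_mx; apply: (@witt_cancel_mx _ _ _ M c (- r) _ _ _ _ h3' Ds p2).
  by rewrite sqrrN rN !mulNmx mulmxN opprK.
by rewrite rN mulmxN mulNr scaleNr -opprD h2' oppr0.
Qed.

Lemma qdl_cancel b s t :
  isometric (qdl (b :: s)) (qdl (b :: t)) -> isometric (qdl s) (qdl t).
Proof.
move=> h; have e := isometric_dim h; case: e => e.
apply: isometric_trans (qdiag_val _) (_ : isometric (qdiag (tcast e (in_tuple s))) _).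
  by rewrite /= val_tcast.
apply: (@qdiag_cancel _ b); apply: isometric_trans (isometric_trans _ h) _.
  by apply: qdiag_val; rewrite /= val_tcast.
exact: qdiag_val.
Qed.

End Binary.

(** * Diagonalization *)

Section Diagonalization.
Variable F : fieldType.
Implicit Types (q : qform F) (a b c : unitsF F) (s t r : seq (unitsF F)).
Hypothesis char2 : 2%:R != 0 :> F.

(** If the diagonal of [A] vanishes, adding to the first row a row [j] with
    [A 0 j != 0] produces the diagonal entry [2 A 0 j]. *)
Lemma pivot n (A : 'M[F]_n.+1) : A^T = A -> A \in unitmx ->
  exists2 P, P \in unitmx & (P *m A *m P^T) 0 0 != 0.
Proof.
move=> As Au; have [i Ai|A0] := pickP (fun i => A i i != 0).
  exists (tperm_mx 0 i); first exact: unitmx_perm.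
  have -> : (tperm_mx 0 i)^T = tperm_mx 0 i :> 'M[F]_n.+1.
    by rewrite /tperm_mx tr_perm_mx tpermV.
  by rewrite -xrowE -xcolE !mxE tpermL.
have {}A0 i : A i i = 0 by apply/eqP; have := A0 i; case: eqP.
have [j Aj|A00] := pickP (fun j => A 0 j != 0); last first.
  exfalso; have : delta_mx 0 0 *m A = 0 :> 'rV_n.+1.
    by apply/rowP => j; rewrite -rowE !mxE; apply/eqP; have := A00 j; case: eqP.
  move/(congr1 (mulmx^~ (invmx A))); rewrite mulmxK // mul0mx.
  by move/rowP/(_ 0); rewrite !mxE !eqxx /= => /eqP; rewrite oner_eq0.
have j0 : 0 != j by apply: contra Aj => /eqP <-; rewrite A0.
pose E : 'M[F]_n.+1 := delta_mx 0 j.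
have EE : E *m E = 0 by rewrite /E mul_delta_mx_0 // eq_sym.
exists (1%:M + E).
  suff /mulmx1_unit[] : (1%:M + E) *m (1%:M - E) = 1%:M by [].
  by rewrite mulmxDl mul1mx mulmxBr mulmx1 EE subr0 subrK.
have EA k l : (E *m A) k l = (k == 0)%:R * A j l.
  rewrite !mxE (bigD1 j) //= big1 => [|i ij]; rewrite !mxE ?eqxx ?andbT ?addr0 //.
  by rewrite (negbTE ij) andbF mul0r.
have AE (B : 'M_n.+1) k l : (B *m E^T) k l = B k j * (l == 0)%:R.
  rewrite !mxE (bigD1 j) //= big1 => [|i ij]; rewrite !mxE ?eqxx ?andbT ?addr0 //.
  by rewrite (negbTE ij) andbF mulr0.
have BE k : ((1%:M + E) *m A) 0 k = A 0 k + A j k.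
  by rewrite mulmxDl mul1mx mxE EA eqxx mul1r.
rewrite linearD /= trmx1 mulmxDr mulmx1 mxE AE !BE !A0 eqxx mulr1.
have -> : A j 0 = A 0 j by rewrite -[in LHS]As mxE.
rewrite addr0 add0r (_ : A 0 j + A 0 j = 2%:R * A 0 j); last by ring.
by rewrite mulf_neq0.
Qed.
Lemma qform_block n (A : 'M[F]_(1 + n)) (As : A^T = A) (Au : A \in unitmx) :
  A 0 0 != 0 -> exists a n' (C : 'M[F]_n') (Cs : C^T = C) (Cu : C \in unitmx),
    n' = n /\ isometric (QForm As Au) (qsum (qdl [:: a]) (QForm Cs Cu)).
Proof.
move=> A0; pose a : unitsF F := exist _ (A 0 0) A0.
pose c : 'cV_n := dlsubmx A; pose C := drsubmx A - (A 0 0)^-1 *: (c *m c^T).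
have cE : ursubmx A = c^T by rewrite /c trmx_dlsub As.
have AE : A = block_mx (A 0 0)%:M c^T c (drsubmx A).
  rewrite -[LHS]submxK cE; congr (block_mx _ _ _ _).
  by apply/matrixP => i j; rewrite !ord1 !mxE eqxx mulr1n; congr (A _ _); exact: val_inj.
have Cs : C^T = C.
  by rewrite /C linearB linearZ /= trmx_mul trmxK trmx_drsub As.
pose L : 'M_(1 + n) := block_mx 1%:M 0 (- (A 0 0)^-1 *: c) 1%:M.
have LA : L *m A *m L^T = block_mx (A 0 0)%:M 0 0 C.
  rewrite {1}AE /L tr_block_mx !trmx1 trmx0 !mulmx_block linearZ /=.
  rewrite !(mul1mx, mulmx1, mulmx0, mul0mx, addr0, add0r).
  have -> : (A 0 0)%:M *m (- (A 0 0)^-1 *: c^T) + c^T = 0.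
    by rewrite mul_scalar_mx scalerA mulrN mulfV // scaleN1r addNr.
  have -> : - (A 0 0)^-1 *: c *m (A 0 0)%:M + c = 0.
    by rewrite mul_mx_scalar scalerA mulrN mulfV // scaleN1r addNr.
  by rewrite mul0mx add0r /C -scalemxAl scaleNr addrC.
have Cu : C \in unitmx.
  have : L *m A *m L^T \in unitmx.
    rewrite !unitmx_mul Au unitmx_tr andbT andbb unitmxE det_lblock !det1 mulr1.
    exact: unitr1.
  rewrite LA.
  by rewrite !unitmxE det_ublock unitrM => /andP[].
exists a, n, C, Cs, Cu; split=> //; apply: isometric_sym.
apply: (@isometric_mx _ _ _ _ L); rewrite LA; congr (block_mx _ _ _ _).
by apply/matrixP => i j; rewrite !ord1 !mxE.
Qed.

Lemma qform_diag q : exists s, isometric q (qdl s).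
Proof.
case: q => n; elim: n => [|n IH] A As Au.
  by exists [::]; apply: (@isometric_mx _ _ _ _ 0); apply/matrixP => -[].
have [P Pu PA] := pivot As Au; set B := P *m A *m P^T in PA.
have Bs : B^T = B by rewrite /B !trmx_mul trmxK As mulmxA.
have Bu : B \in unitmx by rewrite /B !unitmx_mul unitmx_tr Pu Au.
have [a [n' [C [Cs [Cu [nE AB]]]]]] := @qform_block n B Bs Bu PA; subst n'.
have [s Cs'] := IH C Cs Cu; exists (a :: s).
apply: (@isometric_trans _ _ (QForm Bs Bu)).
  by apply: isometric_sym; exact: (@isometric_mx _ _ _ _ P).
apply: isometric_trans AB _; apply: isometric_trans (qsum_qdl [:: a] s).
exact: isometric_qsum (isometric_refl _) Cs'.
Qed.

End Diagonalization.

(** * Rigid fields: invariants of isometry classes *)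

Section Rigid.
Variable F : fieldType.
Implicit Types (q : qform F) (a b c d : unitsF F) (s r : seq (unitsF F)).
Hypothesis char2 : 2%:R != 0 :> F.
Hypothesis rigidF : rigid_field F.

Local Notation sq := (@same_square_class F).

Lemma unit_neq0 a : val a != 0. Proof. exact: (valP a). Qed.

Lemma sq_neq0 a b x : val a = val b * x ^+ 2 -> x != 0.
Proof.
by move=> e; have := unit_neq0 a; rewrite e; apply: contra => /eqP ->; rewrite expr0n mulr0.
Qed.

Lemma sq_umul a a' b b' : sq a a' -> sq b b' -> sq (umul a b) (umul a' b').
Proof. by move=> [x /= e] [y /= f]; exists (x * y); rewrite /= e f; ring. Qed.

Lemma sq_opp a b : sq a b -> sq (opp_unit a) (opp_unit b).
Proof. by move=> [x /= e]; exists x; rewrite /= e mulNr. Qed.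

Lemma sq_oppK a : sq (opp_unit (opp_unit a)) a.
Proof. by exists 1; rewrite /= opprK expr1n mulr1. Qed.

Lemma qeval_qdl s (v : 'rV_(size s)) : qeval (q := qdl s) v =
  \sum_i val (tnth (in_tuple s) i) * v 0 i ^+ 2.
Proof.
rewrite /qeval /= mxE; apply: eq_bigr => i _.
by rewrite mul_mx_diag !mxE; ring.
Qed.

Lemma qdl2_represents a b c x y : val c = val a * x ^+ 2 + val b * y ^+ 2 ->
  represents (qdl [:: a; b]) c.
Proof.
move=> e; exists (\row_(i < 2) if i == 0 then x else y).
by rewrite qeval_qdl !big_ord_recl big_ord0 !mxE !(tnth_nth a) /= e addr0.
Qed.

Lemma qdl2_aniso a b : ~ sq b (opp_unit a) -> anisotropic (qdl [:: a; b]).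
Proof.
move=> nab v v0; apply/negP; rewrite qeval_qdl !big_ord_recl big_ord0 addr0.
rewrite !(tnth_nth a) /=; set x := v 0 _; set y := v 0 _ => /eqP e.
have [y0|y0] := eqVneq y 0.
  move: e; rewrite y0 expr0n mulr0 addr0 => /eqP.
  rewrite mulf_eq0 (negbTE (unit_neq0 a)) expf_eq0 /= => /eqP x0.
  move/eqP: v0; apply; apply/rowP => i; rewrite mxE.
  case: i => [[|[|//]] Hi]; [rewrite -x0 /x | rewrite -y0 /y];
    by congr (v 0 _); exact: val_inj.
apply: nab; exists (x / y) => /=.
by apply: (mulIf (expf_neq0 2 y0)); rewrite expr_div_n -mulrA divfK ?expf_neq0 //;
  apply/eqP; rewrite -subr_eq0 mulNr opprK addrC e.
Qed.

Lemma rigid_class a b : ~ sq b (opp_unit a) -> exists w1 w2, forall c x y,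
  val c = val a * x ^+ 2 + val b * y ^+ 2 -> sq c w1 \/ sq c w2.
Proof.
move=> /qdl2_aniso/(rigidF (erefl : qdim (qdl [:: a; b]) = 2))[w1 [w2 h]].
by exists w1, w2 => c x y e; apply: h; exact: qdl2_represents e.
Qed.

(** This includes the case in which [-1] is a square. *)
Definition level2 := exists x y : F, -1 = x ^+ 2 + y ^+ 2.

Lemma rigid_pigeonhole a b c1 c2 c3 x1 y1 x2 y2 x3 y3 : ~ sq b (opp_unit a) ->
    val c1 = val a * x1 ^+ 2 + val b * y1 ^+ 2 ->
    val c2 = val a * x2 ^+ 2 + val b * y2 ^+ 2 ->
    val c3 = val a * x3 ^+ 2 + val b * y3 ^+ 2 ->
  [\/ sq c1 c2, sq c1 c3 | sq c2 c3].
Proof.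
move=> /rigid_class[w1 [w2 h]] /h h1 /h h2 /h h3.
case: h1 h2 h3 => h1 [] h2 [] h3;
 by [ apply: Or31; exact: sq_trans h1 (sq_sym h2)
    | apply: Or32; exact: sq_trans h1 (sq_sym h3)
    | apply: Or33; exact: sq_trans h2 (sq_sym h3)].
Qed.

(** Suppose that [a] and [b] have the same class and [c] another one, so that
    [v = c / a] is a sum of two squares. The form [<1, -v>] represents 1, [-v] and,
    since [x^2 - v] is minus a square, [-1]; two of these classes coincide, and
    the only possibility is that [v] is the class of [-1]. *)
Lemma rigid_rep a b c x y : ~ sq b (opp_unit a) ->
    val c = val a * x ^+ 2 + val b * y ^+ 2 ->
  [\/ sq c a, sq c b | [/\ sq a b, sq c (opp_unit a) & level2]].
Proof.
move=> nab e.
have ea : val a = val a * 1 ^+ 2 + val b * 0 ^+ 2 by rewrite expr1n expr0n mulr0 mulr1 addr0.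
have eb : val b = val a * 0 ^+ 2 + val b * 1 ^+ 2 by rewrite expr1n expr0n mulr0 mulr1 add0r.
case: (rigid_pigeonhole nab e ea eb) => [h|h|ab]; [by constructor 1|by constructor 2|].
case: (EM (sq c a)) => [h|nca]; first by constructor 1.
have [z /= bE] := sq_sym ab.
have a0 := unit_neq0 a; have c0 := unit_neq0 c; rewrite /= in e a0 c0.
(* [v = c / a]; the square [z^2 = b / a] is absorbed in the second term. *)
have v0 : x ^+ 2 + (z * y) ^+ 2 != 0.
  apply: contra c0 => /eqP h; apply/eqP; rewrite e bE.
  transitivity (sval a * (x ^+ 2 + (z * y) ^+ 2)); [by ring | by rewrite h mulr0].
pose v : unitsF F := exist (fun w : F => is_true (w != 0)) _ v0.
have cv : val c = val a * val v by rewrite /= e bE; ring.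
have nv1 : ~ sq v (one_unit F).
  by move=> [w /= vw]; apply: nca; exists w; rewrite cv /= vw mul1r.
have zy0 : z * y != 0.
  by apply/eqP => h; apply: nv1; exists x; rewrite /= h expr0n addr0 mul1r.
have n1v : ~ sq (opp_unit v) (opp_unit (one_unit F)).
  move=> h; apply: nv1; apply: sq_trans (sq_sym (sq_oppK v)) _.
  exact: sq_trans (sq_opp h) (sq_oppK _).
have m10 : -1 != 0 :> F by rewrite oppr_eq0 oner_eq0.
have e1 : val (one_unit F) = val (one_unit F) * 1 ^+ 2 + val (opp_unit v) * 0 ^+ 2.
  by rewrite /=; ring.
have e2 : val (opp_unit v) = val (one_unit F) * 0 ^+ 2 + val (opp_unit v) * 1 ^+ 2.
  by rewrite /=; ring.
have e3 : val (opp_unit (one_unit F)) =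
    val (one_unit F) * (x / (z * y)) ^+ 2 + val (opp_unit v) * ((z * y)^-1) ^+ 2.
  by move: zy0; rewrite mulf_eq0 negb_or /= => /andP[z0 y0]; field; rewrite z0 y0.
have ca : sq v (opp_unit (one_unit F)) -> sq c (opp_unit a).
  by move=> [w /= vw]; exists w; rewrite cv /= vw; ring.
constructor 3; split=> //.
  apply: ca; case: (rigid_pigeonhole n1v e1 e2 e3) => h.
  - by apply: sq_trans (sq_sym (sq_oppK v)) _; apply: sq_opp; exact: sq_sym.
  - exfalso; apply: nab; apply: sq_trans (sq_sym ab) _.
    by case: h => w /= hw; exists w; rewrite -[LHS]mulr1 hw /=; ring.
  - exfalso; apply: nv1; apply: sq_trans (sq_sym (sq_oppK v)) _.
    by apply: sq_trans (sq_opp h) _; exact: sq_oppK.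
case: (rigid_pigeonhole n1v e1 e2 e3) => h.
- have [w hw] := sq_sym h; have w0 := sq_neq0 hw; rewrite /= in hw.
  exists (x / w), ((z * y) / w); move: hw; rewrite mul1r => hw.
  apply: (mulIf (expf_neq0 2 w0)).
  rewrite mulN1r !expr_div_n mulrDl !divfK ?expf_neq0 // -hw opprK.
  by [].
- have [w /= hw] := sq_sym h; exists w, 0; rewrite hw expr0n addr0 mul1r //.
- by exfalso; apply: nv1; apply: sq_trans (sq_sym (sq_oppK v)) _;
    apply: sq_trans (sq_opp h) _; exact: sq_oppK.
Qed.

(** Conditions on a function of square classes for its sum over the entries of a
    diagonal form to be an invariant of the Witt class modulo [mu]. *)
Record weight (mu : int) (t : unitsF F -> int) : Prop := Weight {
  weight_sq : forall a b, sq a b -> t a = t b;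
  weight_opp : forall a, (mu %| t a + t (opp_unit a))%Z;
  weight_dbl : level2 -> forall a, (mu %| 2 * t a - 2 * t (opp_unit a))%Z }.

Definition total (t : unitsF F -> int) s : int := \sum_(a <- s) t a.

Lemma total_nil t : total t [::] = 0. Proof. exact: big_nil. Qed.

Lemma total_cons t a s : total t (a :: s) = t a + total t s.
Proof. exact: big_cons. Qed.

Lemma total_cat t s r : total t (s ++ r) = total t s + total t r.
Proof. exact: big_cat. Qed.

Definition totalE := (total_cons, total_nil, total_cat).

Lemma sq_mul_left a b c : sq c a -> sq (umul (umul a b) c) b.
Proof. by move=> [x /= e]; exists (sval a * x); rewrite /= e; ring. Qed.

Lemma sq_mul_right a b c : sq c b -> sq (umul (umul a b) c) a.
Proof. by move=> [x /= e]; exists (sval b * x); rewrite /= e; ring. Qed.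

Lemma weight_binary mu t a b c x y : weight mu t ->
    val c = val a * x ^+ 2 + val b * y ^+ 2 ->
  (mu %| t a + t b - (t c + t (umul (umul a b) c)))%Z.
Proof.
case=> tsq topp tdbl e; case: (EM (sq b (opp_unit a))) => [h|nab].
  rewrite (tsq _ _ h) (tsq (umul _ c) (opp_unit c)) ?rpredB //.
  by case: h => z /= bE; exists (sval a * z); rewrite /= bE; ring.
case: (rigid_rep nab e) => [h|h|[ab h l2]].
- by rewrite (tsq _ _ h) (tsq _ _ (sq_mul_left b h)) subrr dvdz0.
- by rewrite (tsq _ _ h) (tsq _ _ (sq_mul_right a h)) [t b + t a]addrC subrr dvdz0.
rewrite -(tsq _ _ ab) (tsq (umul _ c) (opp_unit a)) ?(tsq _ _ h).
  by have := tdbl l2 a; rewrite !mulr2n !mulrDl !mul1r.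
apply: sq_trans h; have [z /= bE] := sq_sym ab; exists (sval a * z).
by rewrite /= bE; ring.
Qed.

Fixpoint qval s (xs : seq F) : F :=
  if s is a :: s' then
    if xs is x :: xs' then val a * x ^+ 2 + qval s' xs' else 0
  else 0.

(** A represented element is moved to the front by a chain of changes of binary
    subforms, none of which affects the sum. *)
Lemma weight_represents mu t s xs c : weight mu t -> val c = qval s xs ->
  exists r, isometric (qdl s) (qdl (c :: r)) /\
    (mu %| total t s - total t (c :: r))%Z.
Proof.
move=> tw; elim: s xs c => [|a s IH] [|x xs] c /= e;
  try by have := unit_neq0 c; rewrite /= e eqxx.
have one a1 a2 r1 : sq a1 a2 -> isometric (qdl (a1 :: r1)) (qdl (a2 :: r1)).
  move=> h; apply: (@qdl_cat _ [:: a1] [:: a2] r1 r1); first exact: qdl_sq.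
  exact: isometric_refl.
have [e0|e0] := eqVneq (qval s xs) 0.
  have h : sq c a by exists x; rewrite /= e e0 addr0.
  exists s; split; first by apply: one; exact: sq_sym.
  by rewrite !totalE (weight_sq tw h) subrr dvdz0.
pose d : unitsF F := exist (fun w : F => is_true (w != 0)) _ e0.
have [r [sr tr]] := IH xs d erefl.
have sr' : isometric (qdl (a :: s)) (qdl [:: a, d & r]).
  by apply: (@qdl_cat _ [:: a] [:: a] s (d :: r)); first exact: isometric_refl.
have e' : val c = val a * x ^+ 2 + val d * 1 ^+ 2 by rewrite /= e expr1n mulr1.
exists (umul (umul a d) c :: r); split.
  apply: isometric_trans sr' _.
  apply: (@qdl_cat _ [:: a; d] [:: c; umul (umul a d) c] r r); last exact: isometric_refl.
  by apply: isometric_sym; exact: qdl_binary e'.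
have := rpredD tr (weight_binary tw e'); rewrite !totalE.
by congr (_ %| _)%Z; ring.
Qed.

Lemma qval_nth s (xs : seq F) :
  \sum_i val (tnth (in_tuple s) i) * xs`_i ^+ 2 = qval s xs.
Proof.
elim: s xs => [|a s IH] xs; first by rewrite big_ord0.
rewrite big_ord_recl; case: xs => [|x xs] /=.
  by rewrite big1 => [|i _]; rewrite ?nth_nil expr0n mulr0 ?addr0.
by rewrite -IH; congr (_ + _); apply: eq_bigr => i _; rewrite !(tnth_nth a).
Qed.

Lemma isometric_qval c s r :
  isometric (qdl (c :: r)) (qdl s) -> exists xs, val c = qval s xs.
Proof.
case=> P [_ _ /= h]; rewrite mul_mx_diag in h.
have := congr1 (fun N : 'M[F]_((size r).+1) => N ord0 ord0) h.
rewrite !mxE /= (tnth_nth c) /= mulr1n => <-.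
exists [seq P ord0 i | i <- enum 'I_(size s)]; rewrite -qval_nth.
apply: eq_bigr => j _; rewrite !mxE /= (nth_map j) ?size_enum_ord // nth_ord_enum.
ring.
Qed.

Lemma aniso_qval s (xs : seq F) : anisotropic (qdl s) -> (size xs <= size s)%N ->
  qval s xs = 0 -> forall i, xs`_i = 0.
Proof.
move=> sA sz e i; pose v : 'rV[F]_(size s) := \row_i xs`_i.
have [v0|v0] := eqVneq v 0.
  have [ixs|xsi] := ltnP i (size xs); last by rewrite nth_default.
  by have /rowP/(_ (Ordinal (leq_trans ixs sz))) := v0; rewrite !mxE.
have := sA _ v0; rewrite qeval_qdl (_ : \sum_i _ = 0) ?eqxx // -[RHS]e -qval_nth.
by apply: eq_bigr => j _; rewrite mxE.
Qed.

Lemma weight_isometric mu t s r : weight mu t -> isometric (qdl s) (qdl r) ->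
  (mu %| total t s - total t r)%Z.
Proof.
move=> tw; elim: r s => [|b r IH] s h.
  by have /= := isometric_dim h; case: s h => // _ _; rewrite subrr dvdz0.
have [xs e] := isometric_qval (isometric_sym h).
have [r' [sr tr]] := weight_represents tw e.
have /IH tr' : isometric (qdl r') (qdl r).
  apply: (@qdl_cancel _ char2 b); exact: isometric_trans (isometric_sym sr) h.
by have := rpredD tr tr'; rewrite !totalE; congr (_ %| _)%Z; ring.
Qed.

Lemma total_hyp mu t n : weight mu t -> (mu %| total t (hyp_list F n))%Z.
Proof.
move=> tw; elim: n => [|n IH]; first by rewrite /hyp_list /= total_nil dvdz0.
rewrite /hyp_list /= !totalE -/(hyp_list F n) addrA rpredD //.
exact: weight_opp.
Qed.

Lemma witt_qdl q1 q2 s r : isometric q1 (qdl s) -> isometric q2 (qdl r) ->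
  witt_equiv q1 q2 -> exists n k, isometric (qdl (s ++ hyp_list F n)) (qdl (r ++ hyp_list F k)).
Proof.
move=> h1 h2 [n [k h]]; exists n, k.
have g q l j : isometric q (qdl l) ->
    isometric (qsum q (hyperbolic F j)) (qdl (l ++ hyp_list F j)).
  move=> ql; apply: isometric_trans (qsum_qdl _ _).
  exact: isometric_qsum ql (hyperbolic_qdl F j).
apply: isometric_trans (isometric_sym (g _ _ n h1)) _.
exact: isometric_trans h (g _ _ k h2).
Qed.

Lemma qdl_witt q1 q2 s r n k : isometric q1 (qdl s) -> isometric q2 (qdl r) ->
  isometric (qdl (s ++ hyp_list F n)) (qdl (r ++ hyp_list F k)) -> witt_equiv q1 q2.
Proof.
move=> h1 h2 h; exists n, k.
have g q l j : isometric q (qdl l) ->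
    isometric (qsum q (hyperbolic F j)) (qdl (l ++ hyp_list F j)).
  move=> ql; apply: isometric_trans (qsum_qdl _ _).
  exact: isometric_qsum ql (hyperbolic_qdl F j).
apply: isometric_trans (g _ _ n h1) _.
exact: isometric_trans h (isometric_sym (g _ _ k h2)).
Qed.

Lemma weight_witt mu t q1 q2 s r : weight mu t -> isometric q1 (qdl s) ->
  isometric q2 (qdl r) -> witt_equiv q1 q2 -> (mu %| total t s - total t r)%Z.
Proof.
move=> tw h1 h2 /(witt_qdl h1 h2)[n [k /(weight_isometric tw)]].
have := rpredB (total_hyp k tw) (total_hyp n tw); rewrite !total_cat => h h'.
by have := rpredD h' h; congr (_ %| _)%Z; ring.
Qed.

Lemma witt_odd q1 q2 : witt_equiv q1 q2 -> odd (qdim q1) = odd (qdim q2).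
Proof.
have [[s h1] [r h2]] := (qform_diag char2 q1, qform_diag char2 q2).
move=> /(witt_qdl h1 h2)[n [k /isometric_dim /=]].
rewrite !size_cat (isometric_dim h1) (isometric_dim h2) /=.
have hs j : odd (size (hyp_list F j)) = false.
  by elim: j => //= j IH; rewrite /hyp_list /= -/(hyp_list F j) negbK.
by move/(congr1 odd); rewrite !oddD !hs !addbF.
Qed.

End Rigid.

(** * Characters of the group of square classes *)

Section SquareClassCharacters.
Variable F : fieldType.
Implicit Types (a b c d g x : unitsF F).

Local Notation sq := (@same_square_class F).
Local Notation one := (one_unit F).
Local Notation mone := (opp_unit (one_unit F)).
Local Notation mul := (@umul F).

Definition uchar (al : unitsF F -> bool) := forall a b, al (mul a b) = al a (+) al b.

Lemma uchar_group : char_group mul uchar.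
Proof.
split=> [al h|al be ha hb a b] //; rewrite ha hb.
by case: (al a); case: (al b); case: (be a); case: (be b).
Qed.

Lemma umulC a b : mul a b = mul b a.
Proof. by apply: val_inj; rewrite /= mulrC. Qed.

Lemma umulA a b c : mul a (mul b c) = mul (mul a b) c.
Proof. by apply: val_inj; rewrite /= mulrA. Qed.

Lemma umul_mone a : opp_unit a = mul mone a.
Proof. by apply: val_inj; rewrite /= mulN1r. Qed.

Lemma sq_square a : sq (mul a a) one.
Proof. by exists (val a); rewrite /= mul1r expr2. Qed.

Lemma sq_ex a b : sq a b -> exists c, b = mul a (mul c c).
Proof.
case=> x e; have x0 := sq_neq0 e; have x0' : x^-1 != 0 by rewrite invr_eq0.
exists (exist (fun w : F => is_true (w != 0)) _ x0'); apply: val_inj => /=.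
by move: e => /= ->; field.
Qed.

Lemma uchar_sq al a b : uchar al -> sq a b -> al a = al b.
Proof. by move=> h /sq_ex[c ->]; rewrite !h addbb addbF. Qed.

Lemma uchar_opp al a : uchar al -> al (opp_unit a) = al mone (+) al a.
Proof. by move=> h; rewrite umul_mone h. Qed.

(** A subgroup that contains the squares, avoids [g] and is maximal for this has
    index 2: for [x] outside of it, the subgroup generated by [x] contains [g].
    Squares are adjoined in [ad] so that the union of the empty chain is
    allowed. *)
Lemma uchar_exists g : ~ sq g one -> exists2 al, uchar al & al g = true.
Proof.
move=> ng; pose ad (H : set (unitsF F)) c := H c \/ sq c one.
pose P (H : set (unitsF F)) :=
  (forall c d, ad H c -> ad H d -> ad H (mul c d)) /\ ~ H g.
have sqm c d : sq c one -> sq d one -> sq (mul c d) one.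
  move=> hc hd; apply: sq_trans (sq_umul hc hd) _; exists 1.
  by rewrite /= !mul1r expr1n.
have [FS PF tot|A [[AM nAg] Amax]] := @Zorn_bigcup _ P.
  split; last by move=> [H FH Hg]; have [_] := PF _ FH.
  have adU H c : FS H -> ad H c -> ad (\bigcup_(X in FS) X)%classic c.
    by move=> FH [Hc|?]; [left; exists H|right].
  move=> c d [[H FH Hc]|hc] [[K FK Kd]|hd]; last by right; exact: sqm.
  - have [HK|KH] := tot _ _ FH FK.
      by apply: (adU K) => //; apply: (PF _ FK).1; left; [exact: HK|].
    by apply: (adU H) => //; apply: (PF _ FH).1; left; [|exact: KH].
  - by apply: (adU H) => //; apply: (PF _ FH).1; [left|right].
  - by apply: (adU K) => //; apply: (PF _ FK).1; [right|left].
pose K := ad A; have nKg : ~ K g by case.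
have Ksq c d : sq c d -> K c -> K d.
  move=> /sq_ex[e ->] Kc; apply: AM => //; right; exact: sq_square.
have coset x : ~ K x -> K (mul x g).
  move=> nKx; apply: contrapT => nKxg.
  pose B : set (unitsF F) := fun c => K c \/ K (mul x c).
  have BM c d : B c -> B d -> B (mul c d).
    have KM c' d' : K (mul c' x) -> K (mul x d') -> K (mul c' d').
      move=> h1 h2; apply: Ksq (AM _ _ h1 h2).
      exists (val x); rewrite /=; ring.
    move=> [Kc|Kxc] [Kd|Kxd].
    - by left; apply: AM.
    - by right; rewrite umulA (umulC x) -umulA; apply: AM.
    - by right; rewrite umulA; apply: AM.
    - by left; apply: KM => //; rewrite umulC.
  apply: (Amax B).
    split; first by move=> c Ac; left; left.
    by move=> h; apply: nKx; left; apply: h; right; right; exact: sq_square.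
  have adB c : ad B c -> B c by case=> // h; left; right.
  split; first by move=> c d /adB Bc /adB Bd; left; exact: BM.
  by case.
exists (fun c => ~~ `[< K c >]); last by apply/asboolPn.
move=> c d; have [Kc|nKc] := asboolP (K c); have [Kd|nKd] := asboolP (K d) => /=.
- by apply/negbF; rewrite asboolE; exact: AM.
- apply/asboolPn => Kcd; apply: nKd; apply: Ksq (AM _ _ Kc Kcd).
  by exists (val c); rewrite /=; ring.
- apply/asboolPn => Kcd; apply: nKc; apply: Ksq (AM _ _ Kcd Kd).
  by exists (val d); rewrite /=; ring.
- apply/negbF; rewrite asboolE.
  apply: Ksq (AM _ _ (coset c nKc) (coset d nKd)).
  by exists (val g); rewrite /=; ring.
Qed.

Lemma uchar_sep a b : eqv uchar a b -> sq a b.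
Proof.
move=> h; apply: contrapT => nab; have [|al hal alg] := @uchar_exists (mul a b).
  move=> [x /= e]; apply: nab.
  have b0 : sval b != 0 by exact: (valP b).
  exists (x / sval b); rewrite /= expr_div_n -[LHS](mulfK b0) e; field; exact: b0.
by move: alg; rewrite hal (h _ hal) addbb.
Qed.

Lemma same_sq s t : same uchar s t -> isometric (qdl s) (qdl t).
Proof.
elim: s t => [|a s IH] [|b t] //= => [_|[/uchar_sep ab /IH st]].
  exact: isometric_refl.
by apply: (@qdl_cat _ [:: a] [:: b] s t) => //; exact: qdl_sq.
Qed.

Hypothesis char2 : 2%:R != 0 :> F.

Local Notation weqF := (weq mul mone (level2 F) uchar).

Lemma weq_qdl s t : weqF s t ->
  exists n k, isometric (qdl (s ++ hyp_list F n)) (qdl (t ++ hyp_list F k)).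
Proof.
have base s' t' : isometric (qdl s') (qdl t') ->
    exists n k, isometric (qdl (s' ++ hyp_list F n)) (qdl (t' ++ hyp_list F k)).
  by move=> h; exists 0, 0; rewrite /hyp_list /= !cats0.
have hypD n k : hyp_list F n ++ hyp_list F k = hyp_list F (n + k).
  by rewrite /hyp_list nseqD flatten_cat.
have ext (r s' t' : seq (unitsF F)) : isometric (qdl s') (qdl t') -> isometric (qdl (s' ++ r)) (qdl (t' ++ r)).
  by move=> h; apply: qdl_cat h (isometric_refl _).
elim=> {s t} [s t st|s t st|a|a [x [y e]]|s s' t t' _ [n [k h]] _ [n' [k' h']]
  |s t _ [n [k h]]|s t r _ [n [k h]] _ [n' [k' h']]].
- exact/base/qdl_perm.
- exact/base/same_sq.
- exists 0, 1; rewrite cats0 -umul_mone; exact: qdl_hyp.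
- rewrite -umul_mone; apply/base/isometric_sym; exact: qdl_dbl e.
- exists (n + n'), (k + k'); rewrite -!hypD.
  apply: isometric_trans (qdl_perm _) (isometric_trans (qdl_cat h h') (qdl_perm _)).
    by rewrite -!catA perm_cat2l perm_catCA.
  by rewrite -!catA perm_cat2l perm_catCA.
- by exists k, n; exact: isometric_sym.
- exists (n + n'), (k' + k); rewrite -!hypD !catA.
  apply: isometric_trans (ext _ _ _ h) _.
  apply: isometric_trans (isometric_trans (qdl_perm _) (ext (hyp_list F k) _ _ h')) _.
    by rewrite -!catA perm_cat2l perm_catC.
  exact: isometric_refl.
Qed.

End SquareClassCharacters.

(** * The cube of the fundamental ideal *)

Section Ideals.
Variable F : fieldType.
Implicit Types (a b c : unitsF F) (l r s : seq (unitsF F)) (al be : unitsF F -> bool).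

Local Notation mone := (opp_unit (one_unit F)).
Local Notation mul := (@umul F).

(** Its sum over a form is the coefficient of the Clifford invariant detected by
    [al] and [be]. *)
Definition wpair al be a : int := (al a && be a : nat)%:Z.
Definition wsgn al a : int := (-1) ^+ al a.

Lemma total_pair al be l : total (wpair al be) l = (count (fun a => al a && be a) l)%:Z.
Proof. by elim: l => [|a l IH] //=; rewrite ?total_nil // total_cons IH PoszD. Qed.

Lemma total_sgn al l : total (wsgn al) l = (size l)%:Z - 2 * (count al l)%:Z.
Proof.
elim: l => [|a l IH] /=; first by rewrite total_nil.
by rewrite total_cons IH /wsgn; case: (al a) => /=; lia.
Qed.

Lemma weight_pair al be : uchar al -> uchar be -> al mone = false -> be mone = false ->
  weight 2 (wpair al be).
Proof.
move=> ha hb am bm; split=> [a b ab|a|_ a].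
- by rewrite /wpair (uchar_sq ha ab) (uchar_sq hb ab).
- rewrite /wpair (uchar_opp a ha) (uchar_opp a hb) am bm /=; lia.
- rewrite /wpair (uchar_opp a ha) (uchar_opp a hb) am bm /=; lia.
Qed.

(** In general [<a, a>] and [<-a, -a>] may be isometric, so the signature is an
    invariant modulo 4 only. *)
Lemma weight_sgn al : uchar al -> al mone = true -> weight 4 (wsgn al).
Proof.
move=> ha am; split=> [a b ab|a|_ a].
- by rewrite /wsgn (uchar_sq ha ab).
- by rewrite /wsgn (uchar_opp a ha) am /=; case: (al a).
- by rewrite /wsgn (uchar_opp a ha) am /=; case: (al a).
Qed.

Lemma weight_sgn_real al : ~ level2 F -> uchar al -> al mone = true -> weight 8 (wsgn al).
Proof.
move=> nl2 ha am; split=> [a b ab|a|//].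
- by rewrite /wsgn (uchar_sq ha ab).
- by rewrite /wsgn (uchar_opp a ha) am /=; case: (al a).
Qed.

Lemma weight_sgn2 al be : uchar al -> uchar be -> al mone = true -> be mone = true ->
  weight 8 (fun a => wsgn al a - wsgn be a).
Proof.
move=> ha hb am bm; split=> [a b ab|a|_ a].
- by rewrite /wsgn (uchar_sq ha ab) (uchar_sq hb ab).
- by rewrite /wsgn (uchar_opp a ha) (uchar_opp a hb) am bm /=; case: (al a); case: (be a).
- by rewrite /wsgn (uchar_opp a ha) (uchar_opp a hb) am bm /=; case: (al a); case: (be a).
Qed.

Lemma totalB (t t' : unitsF F -> int) l : total (fun a => t a - t' a) l = total t l - total t' l.
Proof. exact: sumrB. Qed.

Local Notation prod l r := [seq mul a b | a <- l, b <- r].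

Lemma prod_size l r : size (prod l r) = (size l * size r)%N.
Proof. exact: size_allpairs. Qed.

Lemma prod_sgn al l r : uchar al ->
  total (wsgn al) (prod l r) = total (wsgn al) l * total (wsgn al) r.
Proof.
move=> ha; elim: l => [|a l IH]; first by rewrite total_nil mul0r.
rewrite total_cons mulrDl -IH /= total_cat; congr (_ + _) => {IH}.
elim: r => [|b r IH] /=; first by rewrite total_nil mulr0.
rewrite !total_cons IH mulrDr; congr (_ + _).
by rewrite /wsgn ha signr_addb.
Qed.

Lemma prod_count al l r : uchar al -> odd (count al (prod l r)) =
  (odd (size r) && odd (count al l)) (+) (odd (size l) && odd (count al r)).
Proof.
move=> ha; elim: l => [|a l IH]; first by rewrite /= andbF.
rewrite /= count_cat oddD IH.
have -> : odd (count al [seq mul a b | b <- r]) =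
    (odd (size r) && al a) (+) odd (count al r).
  elim: r {IH} => //= b r IH; rewrite !oddD IH !oddb ha.
  by case: (al a); case: (al b); case: (odd (size _)); case: (odd (count _ _)).
rewrite oddD oddb.
by case: (odd (size r)); case: (al a); case: (odd (count al l)); case: (odd (count al r));
  case: (odd (size l)).
Qed.

Lemma prod_pair al be l r : uchar al -> uchar be ->
  odd (count (fun a => al a && be a) (prod l r)) =
  (odd (size r) && odd (count (fun a => al a && be a) l)) (+)
  (odd (size l) && odd (count (fun a => al a && be a) r)) (+)
  (odd (count al l) && odd (count be r)) (+) (odd (count be l) && odd (count al r)).
Proof.
move=> ha hb; elim: l => [|a l IH]; first by rewrite /= andbF.
rewrite /= count_cat oddD IH !oddD !oddb.
have -> : odd (count (fun a => al a && be a) [seq mul a b | b <- r]) =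
    [&& odd (size r), al a & be a] (+) odd (count (fun a => al a && be a) r) (+)
    (al a && odd (count be r)) (+) (be a && odd (count al r)).
  elim: r {IH} => [|b r IH] /=; first by rewrite !andbF.
  rewrite !oddD IH !oddb ha hb.
  case: (al a); case: (be a); case: (al b); case: (be b); case: (odd (size _));
  by case: (odd (count al _)); case: (odd (count be _)); case: (odd (count _ _)).
by case: (al a); case: (be a); case: (odd (size r)); case: (odd (size l));
  case: (odd (count al l)); case: (odd (count be l));
  case: (odd (count al r)); case: (odd (count be r));
  case: (odd (count (fun _ => _ && _) l)); case: (odd (count (fun _ => _ && _) r)).
Qed.

Record good2 l : Prop := Good2 {
  good2_size : ~~ odd (size l);
  good2_count : forall al, uchar al -> al mone = false -> ~~ odd (count al l);
  good2_sgn : forall al, uchar al -> al mone = true -> (4 %| total (wsgn al) l)%Z }.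

Record good3 l : Prop := Good3 {
  good3_size : ~~ odd (size l);
  good3_count : forall al be, uchar al -> uchar be -> al mone = false ->
    be mone = false -> ~~ odd (count (fun a => al a && be a) l);
  good3_sgn : forall al, uchar al -> al mone = true -> (8 %| total (wsgn al) l)%Z }.

Lemma sgn_even al l : ~~ odd (size l) -> (2 %| total (wsgn al) l)%Z.
Proof. by rewrite total_sgn; lia. Qed.

Lemma good2_prod l r : ~~ odd (size l) -> ~~ odd (size r) -> good2 (prod l r).
Proof.
move=> el er; split=> [|al ha am|al ha am].
- by rewrite prod_size oddM (negbTE el).
- by rewrite prod_count // (negbTE el) (negbTE er).
- rewrite prod_sgn // -[4]/(2 * 2 : int); apply: dvdz_mul; exact: sgn_even.
Qed.

(** The product of a form in the square of the fundamental ideal with an even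
    dimensional form; signatures are multiplicative, and the terms of the mixed
    count are products of one even factor with another. *)
Lemma good3_prod l r : good2 l -> ~~ odd (size r) -> good3 (prod l r).
Proof.
move=> [el cl sl] er; split=> [|al be ha hb am bm|al ha am].
- by rewrite prod_size oddM (negbTE el).
- rewrite prod_pair // (negbTE el) (negbTE er) /=.
  by rewrite (negbTE (cl _ ha am)) (negbTE (cl _ hb bm)).
- rewrite prod_sgn // -[8]/(4 * 2 : int); apply: dvdz_mul; first exact: sl.
  exact: sgn_even.
Qed.

Lemma good2_flatten (ls : seq (seq (unitsF F))) :
  (forall l, l \in ls -> good2 l) -> good2 (flatten ls).
Proof.
elim: ls => [|l ls IH] h; first by split=> // al _ _; rewrite total_nil dvdz0.
have [e1 c1 s1] := h l (mem_head _ _).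
have [|e2 c2 s2] := IH; first by move=> k kls; apply: h; rewrite inE kls orbT.
split=> [|al ha am|al ha am] /=.
- by rewrite size_cat oddD (negbTE e1).
- by rewrite count_cat oddD (negbTE (c1 _ ha am)) c2.
- by rewrite total_cat rpredD ?s1 ?s2.
Qed.

Lemma good3_flatten (ls : seq (seq (unitsF F))) :
  (forall l, l \in ls -> good3 l) -> good3 (flatten ls).
Proof.
elim: ls => [|l ls IH] h; first by split=> // al _ _; rewrite total_nil dvdz0.
have [e1 c1 s1] := h l (mem_head _ _).
have [|e2 c2 s2] := IH; first by move=> k kls; apply: h; rewrite inE kls orbT.
split=> [|al be ha hb am bm|al ha am] /=.
- by rewrite size_cat oddD (negbTE e1).
- by rewrite count_cat oddD (negbTE (c1 _ _ ha hb am bm)) c2.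
- by rewrite total_cat rpredD ?s1 ?s2.
Qed.

Lemma family_qdl k (f : 'I_k -> qform F) (L : 'I_k -> seq (unitsF F)) :
  (forall i, isometric (f i) (qdl (L i))) ->
  isometric (qsum_family f) (qdl (flatten [seq L i | i <- enum 'I_k])).
Proof.
rewrite /qsum_family; elim: k f L => [|k IH] f L h.
  by rewrite big_ord0 enum_ord0; exact: qdiag_val.
rewrite big_ord_recl enum_ordSl /= -map_comp.
apply: isometric_trans (qsum_qdl _ _); apply: isometric_qsum; first exact: h.
by apply: (IH _ (fun i => L (lift ord0 i))) => i; exact: h.
Qed.

Hypothesis char2 : 2%:R != 0 :> F.
Hypothesis rigidF : rigid_field F.

(** The generators of a product of ideals are put in diagonal form; the form
    itself has no chosen diagonalization related to them, but it has the same
    weights. *)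
Lemma ideal_mul_list (I J : qform F -> Prop) (g h k : seq (unitsF F) -> Prop) q l :
    (forall q s, I q -> isometric q (qdl s) -> g s) ->
    (forall q s, J q -> isometric q (qdl s) -> h s) ->
    (forall s r, g s -> h r -> k (prod s r)) ->
    (forall ls : seq (seq (unitsF F)), (forall l, l \in ls -> k l) -> k (flatten ls)) ->
  ideal_mul I J q -> isometric q (qdl l) ->
  exists s, k s /\ forall mu t, weight mu t -> (mu %| total t l - total t s)%Z.
Proof.
move=> hI hJ hk hf [n [x [y [Ix Jy qw]]]] ql.
have [X hX] := choice (fun i => qform_diag char2 (x i)).
have [Y hY] := choice (fun i => qform_diag char2 (y i)).
pose L i := prod (X i) (Y i).
have fam : isometric (qsum_family (fun i => qtens (x i) (y i)))
    (qdl (flatten [seq L i | i <- enum 'I_n])).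
  apply: family_qdl => i.
  exact: isometric_trans (isometric_qtens (hX i) (hY i)) (qdl_prod _ _).
exists (flatten [seq L i | i <- enum 'I_n]); split.
  apply: hf => _ /mapP[i _ ->]; apply: hk; [exact: hI (hX i)|exact: hJ (hY i)].
move=> mu t tw; exact: (weight_witt char2 rigidF tw ql fam qw).
Qed.

Lemma ideal1_list q s : fundamental_ideal q -> isometric q (qdl s) -> ~~ odd (size s).
Proof. by rewrite /fundamental_ideal => + /isometric_dim /= <-. Qed.

Lemma ideal_mul_even (I J : qform F -> Prop) q : (forall q, I q -> fundamental_ideal q) ->
  ideal_mul I J q -> fundamental_ideal q.
Proof.
move=> hI [n [x [y [Ix _ /(witt_odd char2) e]]]].
rewrite /fundamental_ideal e {e} /qsum_family.
elim/big_rec: _ => //= i q' _; rewrite oddD => /negbTE ->.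
by rewrite oddM (negbTE (hI _ (Ix i))).
Qed.

Lemma ideal2_list q l : ideal_mul (@fundamental_ideal F) (@fundamental_ideal F) q ->
  isometric q (qdl l) -> good2 l.
Proof.
move=> q2 ql; have ev := ideal1_list (ideal_mul_even (fun _ h => h) q2) ql.
have [s [[es cs ss] ts]] := ideal_mul_list ideal1_list ideal1_list good2_prod
  good2_flatten q2 ql.
split=> // [al ha am|al ha am].
  have := ts _ _ (weight_pair ha ha am am); have := cs _ ha am.
  rewrite !total_pair !(eq_count (fun a => andbb (al a))); lia.
have := rpredD (ts _ _ (weight_sgn ha am)) (ss _ ha am).
by rewrite subrK.
Qed.

Lemma ideal3_list q l : fundamental_ideal3 q -> isometric q (qdl l) ->
  exists s, good3 s /\ forall mu t, weight mu t -> (mu %| total t l - total t s)%Z.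
Proof.
exact: (ideal_mul_list ideal2_list ideal1_list good3_prod good3_flatten).
Qed.

End Ideals.

(** * From forms to lists *)

Lemma perm_cons2 (T : eqType) (x y c d : T) (r t : seq T) :
    perm_eq [:: x, y & r] [:: c, d & t] ->
  [\/ (c = x /\ d = y) \/ (c = y /\ d = x),
      (c = x \/ c = y) /\ exists r', perm_eq r (d :: r'),
      (d = x \/ d = y) /\ exists r', perm_eq r (c :: r') |
      exists r', perm_eq r [:: c, d & r']].
Proof.
move=> rt; have : c \in [:: x, y & r] by rewrite (perm_mem rt) mem_head.
have head z z' : perm_eq [:: z, z' & r] [:: z, d & t] ->
    d = z' \/ exists r', perm_eq r (d :: r').
  rewrite perm_cons => h; have : d \in z' :: r by rewrite (perm_mem h) mem_head.
  by rewrite inE => /predU1P[|/perm_to_rem]; [left | right; exists (rem d r)].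
rewrite !inE => /or3P[/eqP cx|/eqP cy|/perm_to_rem cr].
- subst c; case: (head _ _ rt) => [dy|h]; first by constructor 1; left.
  by constructor 2; split; [left|].
- subst c; have rt' : perm_eq [:: y, x & r] [:: y, d & t].
    by apply: perm_trans rt; apply/seq.permP => p /=; rewrite addnCA.
  case: (head _ _ rt') => [dx|h]; first by constructor 1; right.
  by constructor 2; split; [right|].
have rt' : perm_eq [:: x, y & rem c r] (d :: t).
  rewrite -(perm_cons c); apply: perm_trans rt; rewrite perm_sym.
  by apply/seq.permP => p /=; rewrite (seq.permP cr) /=; lia.
have : d \in [:: x, y & rem c r] by rewrite (perm_mem rt') mem_head.
rewrite !inE => /or3P[/eqP dx|/eqP dy|/perm_to_rem dr].
- by constructor 3; split; [left|exists (rem c r)].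
- by constructor 3; split; [right|exists (rem c r)].
constructor 4; exists (rem d (rem c r)); apply: perm_trans cr _.
by rewrite perm_cons.
Qed.

Section Main.
Variable F : fieldType.
Implicit Types (a b c : unitsF F) (l r s : seq (unitsF F)) (al be : unitsF F -> bool).
Hypothesis char2 : 2%:R != 0 :> F.
Hypothesis rigidF : rigid_field F.

Local Notation sq := (@same_square_class F).
Local Notation mone := (opp_unit (one_unit F)).
Local Notation mul := (@umul F).
Local Notation uchar := (@uchar F).
Local Notation sum3F := (sum3 mul mone (level2 F) uchar).

Lemma isometric_aniso q1 q2 : isometric q1 q2 -> @anisotropic F q2 -> anisotropic q1.
Proof.
case=> P [Pf _ h] q2A v v0; have vP0 : v *m P != 0.
  by apply: contra v0 => /eqP; rewrite -[X in _ = X](mul0mx _ P) => /(row_free_inj Pf) ->.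
have := q2A _ vP0; rewrite /qeval; suff -> : v *m P *m gram q2 *m (v *m P)^T =
  v *m gram q1 *m v^T by [].
by rewrite -h trmx_mul !mulmxA.
Qed.

Section Form.
Variables (q : qform F) (l : seq (unitsF F)).
Hypotheses (qA : anisotropic q) (ql : isometric q (qdl l)).

Lemma form_aniso : aniso mul mone uchar l.
Proof.
move=> a b r lp /uchar_sep[x /= e].
have sA : anisotropic (qdl [:: a, b & r]).
  apply: isometric_aniso qA; apply: isometric_sym.
  exact: isometric_trans ql (qdl_perm lp).
have h : qval [:: a, b & r] [:: x; 1] = 0 by rewrite /= e; case: (r) => [|? ?] /=; ring.
by have /eqP := @aniso_qval F _ [:: x; 1] sA isT h 1; rewrite /= oner_eq0.
Qed.

Lemma form_triple a b c r : level2 F -> perm_eq l [:: a, b, c & r] ->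
  eqv uchar b a -> eqv uchar c a -> False.
Proof.
move=> [x [y e]] lp /uchar_sep[u /= bE] /uchar_sep[v /= cE].
have sA : anisotropic (qdl [:: a, b, c & r]).
  apply: isometric_aniso qA; apply: isometric_sym.
  exact: isometric_trans ql (qdl_perm lp).
have b0 : u != 0 by apply: (@sq_neq0 _ b a).
have c0 : v != 0 by apply: (@sq_neq0 _ c a).
have h : qval [:: a, b, c & r] [:: 1; x / u; y / v] = 0.
  rewrite /= bE cE; transitivity (sval a * (1 + (x ^+ 2 + y ^+ 2))).
    by case: (r) => [|? ?] /=; field; rewrite b0 c0.
  by rewrite -e subrr mulr0.
by have /eqP := @aniso_qval F _ [:: 1; x / u; y / v] sA isT h 0; rewrite /= oner_eq0.
Qed.

Hypotheses (q3 : fundamental_ideal3 q) (l16 : size l = 16).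

Lemma form_count al be : uchar al -> uchar be -> al mone = false -> be mone = false ->
  ~~ odd (count (fun a => al a && be a) l).
Proof.
move=> ha hb am bm; have [s [[_ cs _] ts]] := ideal3_list char2 rigidF q3 ql.
have := ts _ _ (weight_pair ha hb am bm); have := cs _ _ ha hb am bm.
by rewrite !total_pair; lia.
Qed.

Lemma form_sgn_real al : ~ level2 F -> uchar al -> al mone = true ->
  ((16 + 6 * count al l) %% 8 = 0)%N.
Proof.
move=> nl2 ha am; have [s [[_ _ ss] ts]] := ideal3_list char2 rigidF q3 ql.
have := rpredD (ts _ _ (weight_sgn_real nl2 ha am)) (ss _ ha am).
rewrite subrK total_sgn l16 => h; have : (8 %| 16 - 2 * (count al l)%:Z)%Z := h; lia.
Qed.

Lemma form_sgn4 al : uchar al -> al mone = true -> ((16 + 6 * count al l) %% 4 = 0)%N.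
Proof.
move=> ha am; have [s [[_ _ ss] ts]] := ideal3_list char2 rigidF q3 ql.
have := ts _ _ (weight_sgn ha am); have := ss _ ha am.
by rewrite !total_sgn l16; lia.
Qed.

Lemma form_sgn8 al be : uchar al -> uchar be -> al mone = true -> be mone = true ->
  ((16 + 6 * count al l) %% 8 = (16 + 6 * count be l) %% 8)%N.
Proof.
move=> ha hb am bm; have [s [[_ _ ss] ts]] := ideal3_list char2 rigidF q3 ql.
have := ts _ _ (weight_sgn2 ha hb am bm); have := ss _ ha am; have := ss _ hb bm.
by rewrite !totalB !total_sgn l16; lia.
Qed.

(** If the signatures are 0 modulo 8, [sum3_I3] applies. Otherwise [-1] is a sum of
    two squares and they are all 4 modulo 8. Two equal entries are then replaced
    by their opposites, which adds 4 to each signature and keeps the list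
    anisotropic, because no class occurs three times. *)
Lemma form_sum3 : sum3F l.
Proof.
have UG := uchar_group F; have lA := form_aniso.
have evl : ~~ odd (size l) by rewrite l16.
have base : (forall al, uchar al -> al mone = true ->
    ((16 + 6 * count al l) %% 8 = 0)%N) -> sum3F l.
  move=> h; apply: (sum3_I3 _ UG lA) => //; split=> //.
    by move=> al be ha hb am bm; exact: form_count.
  by move=> al ha am; rewrite l16; exact: h.
case: (EM (level2 F)) => [l2|nl2]; last first.
  by apply: base => al ha am; exact: form_sgn_real.
case: (EM (exists2 al, uchar al /\ al mone = true &
    ((16 + 6 * count al l) %% 8 = 0)%N)) => [[be [hb bm] b8]|n0].
  by apply: base => al ha am; rewrite (form_sgn8 ha hb am bm).
have sgn4 al : uchar al -> al mone = true -> ((16 + 6 * count al l) %% 8 = 4)%N.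
  move=> ha am; have := form_sgn4 ha am.
  have : ((16 + 6 * count al l) %% 8 <> 0)%N by move=> h; apply: n0; exists al.
  lia.
case: (EM (triv uchar mone)) => [tm|ntm].
  by apply: base => al ha am; rewrite tm in am.
case: (EM (aniso mul mone (kill uchar mone) l)) => [kA|].
  apply: (sum3_level2 UG l2 l16 kA _ ntm sgn4); split=> //.
    by move=> al be [ha _] [hb _] am bm; exact: form_count.
  by move=> al [_ ->].
move=> nkA; have [a [b [r [lp ab]]]] : exists a b r, perm_eq l [:: a, b & r] /\ eqv uchar b a.
  apply: contrapT => h; apply: nkA => a b r lp ab.
  case: (eqv_kill UG ab) => {}ab; first exact: lA lp ab.
  apply: h; exists a, b, r; split=> // al ha; rewrite (ab al ha) !(charM UG) //.
  by case: (al mone); case: (al a).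
pose l' := [:: mul mone a, mul mone b & r].
have ll' : weq mul mone (level2 F) uchar l l'.
  apply: weq_trans (weq_perm lp) _; apply: (@weq_cat _ _ _ _ _ [:: a; b] [:: mul mone a; mul mone b] r r);
    last exact: weq_refl.
  apply: (weq_trans (t := [:: a; a])); first by apply: weq_same; do ?split.
  apply: weq_trans (weq_dbl a l2) _; apply: weq_same; do ?split => //; char_tac UG.
apply: sum3_weq ll' _; apply: (sum3_I3 _ UG).
- move=> c d t l't cd.
  case: (perm_cons2 l't) => [h|[h [r' rr]]|[h [r' rr]]|[r' rr]].
  + apply: ntm => al ha; have := cd al ha; case: h => -[-> ->];
      rewrite !(charM UG) // (ab al ha); by case: (al mone); case: (al a).
  + apply: (@form_triple a b d r' l2 _ ab).
      by apply: perm_trans lp _; rewrite !perm_cons.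
    move=> al ha; rewrite (cd al ha) (charM UG) //; case: h => ->;
      rewrite (charM UG) // ?(ab al ha); by case: (al mone); case: (al a).
  + apply: (@form_triple a b c r' l2 _ ab).
      by apply: perm_trans lp _; rewrite !perm_cons.
    move=> al ha; have := cd al ha; rewrite (charM UG) //; case: h => ->;
      rewrite (charM UG) // ?(ab al ha); by case: (al mone); case: (al a); case: (al c).
  + apply: (lA c d [:: a, b & r']) cd; apply: perm_trans lp _; clear -rr.
    by apply/seq.permP => p; rewrite /= (seq.permP rr) /=; lia.
- split.
  + by have := perm_size lp; rewrite l16 /l' /=; lia.
  + move=> al be ha hb am bm; have := form_count ha hb am bm.
    by rewrite (seq.permP lp) /= !(charM UG) // am bm.
  + move=> al ha am; have := sgn4 al ha am; have := perm_size lp; rewrite l16.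
    rewrite (seq.permP lp) /= !(charM UG) // am (ab al ha) /= => sz.
    by case: (al a) => /=; lia.
- by have := perm_size lp; rewrite l16 /l' /=; lia.
Qed.

End Form.
End Main.

(** * Pfister forms and the theorem *)

Section Pfister.
Variable F : fieldType.
Implicit Types (a b c : unitsF F) (l r s : seq (unitsF F)).
Local Notation mone := (opp_unit (one_unit F)).
Local Notation mul := (@umul F).

Lemma qscale_qdl c s : isometric (qscale c (qdl s)) (qdl [seq mul c a | a <- s]).
Proof.
apply: (@isometric_trans _ _ (qdiag (map_tuple (mul c) (in_tuple s)))); last exact: qdiag_val.
apply: (@isometric_mx _ _ _ _ 1%:M); rewrite mul1mx trmx1 mulmx1 /=.
by apply/matrixP => i j; rewrite !mxE tnth_map /= mulrnAr.
Qed.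

(** The slots are listed in the order [y, x, z] to obtain the entries in the
    order chosen for flats. *)
Lemma qscale_pfister3 c x y z :
  isometric (qscale c (pfister [tuple opp_unit y; opp_unit x; opp_unit z]))
    (qdl (flat3 mul c x y z)).
Proof.
pose f i : seq (unitsF F) := [:: one_unit F; opp_unit (opp_unit i)].
pose p s r := [seq mul a b | a <- s, b <- r].
have h : isometric (pfister [tuple opp_unit y; opp_unit x; opp_unit z])
    (qdl (p (f y) (p (f x) (p (f z) [:: one_unit F])))).
  rewrite /pfister !big_ord_recl big_ord0.
  apply: isometric_trans (qdl_prod _ _); apply: isometric_qtens; first exact: qdiag_val.
  apply: isometric_trans (qdl_prod _ _); apply: isometric_qtens; first exact: qdiag_val.
  apply: isometric_trans (qdl_prod _ _); apply: isometric_qtens; exact: qdiag_val.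
apply: isometric_trans (isometric_qscale c h) _.
apply: isometric_trans (qscale_qdl _ _) _.
apply: same_sq; rewrite /p /f /=.
have e i : eqv (@uchar F) (opp_unit (opp_unit i)) i.
  by move=> al ha; apply: uchar_sq ha _; exact: sq_oppK.
have e1 : forall al, uchar al -> al (one_unit F) = false.
  move=> al ha; have := ha (one_unit F) (one_unit F).
  have -> : mul (one_unit F) (one_unit F) = one_unit F by apply: val_inj; rewrite /= mulr1.
  by rewrite addbb.
by do ?split => //; move=> al ha; rewrite !ha ?e // !e1 //;
  case: (al c); case: (al x); case: (al y); case: (al z).
Qed.

End Pfister.

Theorem theorem6p3 (F : fieldType) (charF : 2%N \notin [pchar F]%R)
  (rigidF : rigid_field F) (phi : qform F)
  (phi_aniso : anisotropic phi) (phi_dim : qdim phi = 16%N)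
  (phi_I3 : fundamental_ideal3 phi) :
  exists (k : nat) (psi : 'I_k -> qform F),
    [/\ (k <= 3)%N, forall i, GP 3 (psi i) & witt_equiv phi (qsum_family psi)].
Proof.
have char2 : 2%:R != 0 :> F by move: charF; rewrite inE.
have [l phi_l] := qform_diag char2 phi.
have l16 : size l = 16 by have := isometric_dim phi_l; rewrite phi_dim.
have [fl [fl3 lfl]] := form_sum3 char2 rigidF phi_aniso phi_l phi_I3 l16.
pose psi (i : 'I_(size fl)) := let p := tnth (in_tuple fl) i in
  qscale p.1.1.1 (pfister [tuple opp_unit p.1.2; opp_unit p.1.1.2; opp_unit p.2]).
exists (size fl), psi; split=> //.
  move=> i; rewrite /psi /=; set p := tnth _ i.
  exists p.1.1.1, [tuple opp_unit p.1.2; opp_unit p.1.1.2; opp_unit p.2].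
  exact: isometric_refl.
have fam : isometric (qsum_family psi)
    (qdl (flatten [seq flat3 (@umul F) p.1.1.1 p.1.1.2 p.1.2 p.2 | p <- fl])).
  rewrite -[X in flatten (map _ X)](map_tnth_enum (in_tuple fl)) -map_comp.
  by apply: family_qdl => i; exact: qscale_pfister3.
have [n [k h]] := weq_qdl char2 lfl.
exact: qdl_witt phi_l fam h.
Qed.
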